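(* Let $K$ be an imaginary quadratic field whose only roots of unity are $\pm 1$. Let $E$ and $E'$ be complex elliptic curves with complex multiplication by $K$, of conductors $c$ and $c'$ respectively, and put $f=\mathrm{lcm}(c,c')$ and $f'=\gcd(c,c')$. Let $N(E,E')$ be the number of elliptic curves contained in the abelian surface $A=E\times E'$, counted up to the action of $\mathrm{Aut}(A)$. Then \[N(E,E') = \sum_{\ell \mid f} h_\ell \cdot \phi_u\!\left(f/\ell\right) \sum_{g \mid \ell} 2^{\omega(\ell/g)}\, r_{K}\!\left(f', g, f/\ell\right).\]
   Context: For a positive integer $n$, $\mathcal{O}_n=\mathbb{Z}+n\mathcal{O}_K$ is the order of conductor $n$ in $K$. A lattice $\mathfrak{a}\subset K$ (free abelian subgroup of rank 2) has ring of multipliers $\{\alpha\in K:\alpha\mathfrak{a}\subset\mathfrak{a}\}$, which equals $\mathcal{O}_n$ for a unique $n$, called the conductor of $\mathfrak{a}$; the conductor of an elliptic curve $E\cong\mathbb{C}/\mathfrak{a}$ with CM by $K$ is the conductor of $\mathfrak{a}$ (equivalently the index of $\mathrm{End}(E)$ in $\mathcal{O}_K$). $h_\ell=\#\mathrm{Pic}(\mathcal{O}_\ell)= h\cdot \ell\prod_{p\mid \ell}(1-\chi_K(p)/p)$, where $h$ is the class number of $K$ and $\chi_K$ is the quadratic Dirichlet character attached to $K$. $\phi_u(n)=\#\big((\mathbb{Z}/n\mathbb{Z})^\times/\{\pm1\}\big)$, i.e. $\phi(n)/2$ for $n\ge 3$ and $1$ for $n=1,2$. $\omega(n)$ is the number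 of distinct prime divisors of $n$. $r_K(a,b,N)$ is the number of cyclic subgroups $C$ of order $N$ of an elliptic curve $E_0$ with CM by $K$ and conductor $a$ such that $E_0/C$ has conductor $b$ (this number does not depend on the choice of $E_0$). Elliptic curves contained in $A$ means one-dimensional abelian subvarieties of $A$, and $\mathrm{Aut}(A)$ is the group of automorphisms of $A$ as an abelian variety. *)

(* Defs.v *)
From HB Require Import structures.
From mathcomp Require Import all_boot all_order all_algebra.
From mathcomp Require Import complex.
From mathcomp Require Import reals.
From Stdlib Require Import ClassicalEpsilon.
Set Implicit Arguments. Unset Strict Implicit. Unset Printing Implicit Defensive.
Import Order.TTheory GRing.Theory Num.Theory.
Local Open Scope ring_scope.

(* The complex numbers are R[i] for R : realType (the reals). *)

Section Defs.
Variable R : realType.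
Local Notation C := R[i].

(* The imaginary quadratic field K = Q(sqrt(-d)) (d > 0), as a subset of C. *)
Definition sqrtmd (d : nat) : C := Complex 0 (Num.sqrt (d%:R : R)).
Definition inK (d : nat) (z : C) : Prop :=
  exists a b : rat, z = ratr a + ratr b * sqrtmd d.

(* The only roots of unity in K are +1, -1. *)
Definition only_pm1_roots (d : nat) : Prop :=
  forall z : C, inK d z -> forall n : nat, (0 < n)%N -> z ^+ n = 1 ->
    z = 1 \/ z = -1.

(* Ring of integers O_K: elements of K integral over Z. *)
Definition integral_over_Z (z : C) : Prop :=
  exists p : {poly int}, p \is monic /\ (map_poly intr p).[z] = 0.
Definition inOK (d : nat) (z : C) : Prop := inK d z /\ integral_over_Z z.

(* The order of conductor n : O_n = Z + n O_K. *)
Definition inOrder (d n : nat) (z : C) : Prop :=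
  exists (m : int) (w : C), inOK d w /\ z = m%:~R + n%:R * w.

(* Lattices in K: Z-spans of two Z-independent elements of K. *)
Definition zspan (w : C * C) (z : C) : Prop :=
  exists a b : int, z = a%:~R * w.1 + b%:~R * w.2.
Definition is_lattice (d : nat) (w : C * C) : Prop :=
  [/\ inK d w.1, inK d w.2 &
      forall a b : int, a%:~R * w.1 + b%:~R * w.2 = 0 -> a = 0 /\ b = 0].

(* Conductor of a lattice L: its ring of multipliers is O_n. *)
Definition has_conductor (d : nat) (L : C -> Prop) (n : nat) : Prop :=
  (0 < n)%N /\
  forall alpha : C, (inK d alpha /\ forall z, L z -> L (alpha * z))
                    <-> inOrder d n alpha.

(* Number of classes of P modulo eqv (junk 0 if not finite):
   count_is P eqv m means there are exactly m classes. *)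
Definition count_is (X : Type) (P : X -> Prop) (eqv : X -> X -> Prop) (m : nat)
  : Prop :=
  exists f : 'I_m -> X,
    [/\ forall i, P (f i),
        forall i j, eqv (f i) (f j) -> i = j &
        forall x, P x -> exists i, eqv x (f i)].
Definition num_classes (X : Type) (P : X -> Prop) (eqv : X -> X -> Prop) : nat :=
  epsilon (inhabits 0%N) (count_is P eqv).

(* h_l = #Pic(O_l) = number of homothety classes (by K^x) of lattices in K
   whose ring of multipliers is O_l. *)
Definition homothetic (d : nat) (w w' : C * C) : Prop :=
  exists lam : C, [/\ inK d lam, lam != 0 &
    forall z, zspan w' z <-> exists y, zspan w y /\ z = lam * y].
Definition hcl (d l : nat) : nat :=
  num_classes (fun w => is_lattice d w /\ has_conductor d (zspan w) l)
              (homothetic d).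

(* phi_u(n) = #((Z/nZ)^x / {+-1}) *)
Definition phi_u (n : nat) : nat := if (n <= 2)%N then 1%N else (totient n %/ 2)%N.

(* omega(n) = number of distinct prime divisors *)
Definition omega (n : nat) : nat := size (primes n).

(* r_K(a,b,N): E_0 = C/O_a (conductor a).  A cyclic subgroup of order N of
   C/O_a is S/O_a where S = O_a + Z beta, beta of order exactly N modulo O_a;
   E_0/(S/O_a) = C/S.  We count the distinct such S with S of conductor b. *)
Definition cyclic_super (d a N : nat) (S : C -> Prop) : Prop :=
  exists beta : C,
    [/\ forall z, S z <-> exists (x : C) (k : int), inOrder d a x /\ z = x + k%:~R * beta,
        inOrder d a (N%:R * beta) &
        forall k : nat, (0 < k < N)%N -> ~ inOrder d a (k%:R * beta)].
Definition rK (d a b N : nat) : nat :=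
  num_classes (fun S => cyclic_super d a N S /\ has_conductor d S b)
              (fun S T => forall z, S z <-> T z).

(* The abelian surface A = C^2 / (La x La'), La = zspan w, La' = zspan w'. *)
Definition inLam (w w' : C * C) (v : 'cV[C]_2) : Prop :=
  zspan w (v 0 0) /\ zspan w' (v 1 0).

(* Elliptic curves in A = one-dimensional complex subtori = images of complex
   lines C v (v <> 0) meeting the lattice in a lattice of the line, i.e.
   containing two R-linearly independent lattice vectors. *)
Definition elliptic_line (w w' : C * C) (v : 'cV[C]_2) : Prop :=
  v != 0 /\
  exists lam mu : C, [/\ inLam w w' (lam *: v), inLam w w' (mu *: v) &
                         'Im (lam * (mu^*)%C) != 0].

(* Aut(A): complex-linear M in GL_2(C) with M Lam = Lam. *)
Definition autA (w w' : C * C) (M : 'M[C]_2) : Prop :=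
  M \in unitmx /\
  forall v, inLam w w' v <-> inLam w w' (M *m v).

(* Two elliptic curves C v, C u in A are in the same Aut(A)-orbit. *)
Definition same_orbit (w w' : C * C) (v u : 'cV[C]_2) : Prop :=
  exists M, autA w w' M /\ exists lam : C, lam != 0 /\ M *m v = lam *: u.

Definition N_curves (w w' : C * C) : nat :=
  num_classes (elliptic_line w w') (same_orbit w w').

End Defs.

(* Main.v *)
(** Let [L], [L'] be lattices of conductors [c], [c'] with [A = C^2 / (L + L')], and let [D = L L'],
    a lattice of conductor [f' = gcd c c'].  Elliptic curves in [A] correspond to [K]-lines in
    [K^2]; given such a line, change coordinates by [GL_2 K] so that it becomes [K e_1].  Since
    every additive map between lattices of [K] is the restriction of some [y |-> u conj(y) + t y], a
    unipotent matrix brings [L + L'] to the form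
    [{(x + u conj(y), y) | x in M1, y in M2}], with [M1], [M2] lattices and [u] in [K].

    If [M2 = Z a + Z b], put [v = u (conj(a) b - a conj(b))].  Then orbits of lines become triples
    [(M1, M2, v mod M1 M2)] up to [K^x * K^x].  The determinants of pairs of vectors of the lattice
    generate [M1 M2 + Z v], and its ring of multipliers has conductor [lcm m1 m2 * N], where
    [m1], [m2] are the conductors of [M1], [M2] and [N] is the order of [v] modulo [M1 M2].
    Conversely a lattice of rank two with multiplier ring [O_f] and determinant lattice [D] is
    isomorphic to [O_f + D], so a triple occurs exactly when [lcm m1 m2 * N = f] and
    [M1 M2 + Z v] is homothetic to [D]; as the only units are [1] and [-1], one may take it equal
    to [D], with [v] determined up to sign.

    Fix [l = lcm m1 m2] and [g = gcd m1 m2]: there are [2 ^ omega (l / g)] pairs [(m1, m2)].  The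
    product [I = M1 M2] runs through the sublattices of [D] of conductor [g] with cyclic quotient
    of order [N = f / l], of which there are [r_K(f', g, N)]; given [I], there are [phi_u N]
    generators [v] of [D / I] up to sign; and the pairs [(M1, M2)] with product [I], up to
    [K^x], are in bijection with the classes of lattices [M] of conductor [l] via
    [M1 = M O_m1], [M O_m2 M2 = I0], where [I0] is a fixed lattice of conductor [m2] with
    [I0 O_g = I]. *)

Require Import Defs.
From HB Require Import structures.
From mathcomp Require Import all_boot all_order all_algebra.
From mathcomp Require Import complex reals ring zify.
From Stdlib Require Import Classical ClassicalEpsilon FunctionalExtensionality PropExtensionality.
Set Implicit Arguments. Unset Strict Implicit. Unset Printing Implicit Defensive.
Import Order.TTheory GRing.Theory Num.Theory.
Local Open Scope ring_scope.

(** * Additive subgroups and integers *)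

(** Why [v] and not [u]: a unipotent matrix changes [u] by exactly those [p] for which
    [p conj(y) + s y] maps [M2] into [M1] for some [s]. Eliminating [s] on a basis turns this into
    membership of [p * dlt w] in [M1 M2] ([antilinear_mem]). The sign of [dlt w] depends on the
    basis, but it is absorbed by [-M1 = M1].

    The obstacle is that the orders are not maximal. Two facts replace ideal theory. Every lattice
    of [K] is invertible over its own multiplier ring, its inverse being a multiple of its conjugate
    ([norm_form_mulL]). And every lattice of conductor [m] contains [x O_m] with index prime to any
    prescribed integer ([lat_coprime_elt]), which stands in for localisation.

    The second fact also explains why [r_K], defined with [O_f'], counts lattices around [D]; a
    duality then exchanges overlattices and sublattices.

    The counting functions of the statement are choices with no meaning for infinite sets, so the
    finiteness of the class number and of [r_K] has to be proved, the former by reduction theory.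

    The field enters through the record [quad]: a generator with integral trace and norm that
    generates the maximal order. *)

Lemma set_ext (X : Type) (A B : X -> Prop) : (forall x, A x <-> B x) -> A = B.
Proof.
by move=> h; apply: functional_extensionality => x; apply: propositional_extensionality.
Qed.

Lemma ex_min_nat (P : nat -> Prop) :
  (exists n, P n) -> exists2 n, P n & forall m, P m -> (n <= m)%N.
Proof.
case=> n; elim/ltn_ind: n => n IH Pn.
case: (classic (exists2 m, (m < n)%N & P m)) => [[m lmn Pm]|h]; first exact: IH lmn Pm.
by exists n => // m Pm; rewrite leqNgt; apply/negP => lmn; apply: h; exists m.
Qed.

Definition addgrp (V : zmodType) (G : V -> Prop) :=
  G 0 /\ forall x y, G x -> G y -> G (x - y).

Section Subgroups.
Variables (V : zmodType) (G : V -> Prop).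
Hypothesis sG : addgrp G.

Lemma addgrp0 : G 0. Proof. by case: sG. Qed.
Lemma addgrpB x y : G x -> G y -> G (x - y). Proof. by case: sG => _; apply. Qed.
Lemma addgrpN x : G x -> G (- x).
Proof. by move=> Gx; rewrite -sub0r; apply: addgrpB => //; apply: addgrp0. Qed.
Lemma addgrpD x y : G x -> G y -> G (x + y).
Proof. by move=> Gx Gy; rewrite -[y]opprK; apply: addgrpB => //; apply: addgrpN. Qed.
Lemma addgrpMn x n : G x -> G (x *+ n).
Proof.
by move=> Gx; elim: n => [|n IH]; rewrite ?mulr0n ?mulrS; [apply: addgrp0|apply: addgrpD].
Qed.
Lemma addgrpMz x (n : int) : G x -> G (x *~ n).
Proof. by move=> Gx; case: n => n; rewrite ?NegzE ?mulrNz; [|apply: addgrpN]; apply: addgrpMn. Qed.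
End Subgroups.

Lemma addgrp_int (P : int -> Prop) : addgrp P -> exists g : nat, forall x, P x <-> (g %| x)%Z.
Proof.
move=> sP; case: (classic (exists n : nat, P n.+1)) => [/ex_min_nat[g Pg gmin]|h].
  exists g.+1 => x; split=> [Px|/dvdzP[q ->]]; last first.
    by rewrite mulrC -mulrzz; apply: addgrpMz.
  have Pr : P (x %% g.+1)%Z.
    by rewrite /modz; apply: addgrpB => //; rewrite mulrC -mulrzz; apply: addgrpMz.
  have r0 : (0 <= x %% g.+1)%Z by apply: modz_ge0.
  have rlt : (x %% g.+1)%Z < g.+1 by apply: ltz_pmod.
  case E: (x %% g.+1)%Z r0 rlt Pr => [[|r]|] // _ rlt Pr.
    by apply/dvdz_mod0P.
  by have := gmin _ Pr; lia.
exists 0%N => x; rewrite dvd0z; split=> [Px|/eqP->]; last exact: addgrp0.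
apply/eqP; case: x Px => [[|n]|n] Px //.
  by case: h; exists n.
by case: h; exists n; have := addgrpN sP Px; rewrite NegzE opprK.
Qed.

(** Hermite normal form: [a] generates the intersection with the first axis, [c] the projection to
    the second, and [(b, c)] lifts [c]. The multiples of [N] in the group keep [a] and [c]
    nonzero. *)
Lemma addgrp_int2_basis (H : int -> int -> Prop) (N : nat) :
  (0 < N)%N -> H 0 0 ->
  (forall i j i' j', H i j -> H i' j' -> H (i - i') (j - j')) ->
  H N 0 -> H 0 N ->
  exists a b c : int, [/\ a != 0, c != 0, H a 0, H b c &
    forall i j, H i j -> exists x y : int, i = x * a + y * b /\ j = y * c].
Proof.
move=> N0 H0 HB HN0 H0N.
have HM (n : int) i j : H i j -> H (n * i) (n * j).
  move=> Hij; have Hn (k : nat) : H (k%:Z * i) (k%:Z * j).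
    elim: k => [|k IH]; first by rewrite !mul0r.
    have := HB _ _ _ _ IH (HB _ _ _ _ H0 Hij); rewrite !sub0r !opprK.
    by rewrite -add1n PoszD !mulrDl !mul1r [i + _]addrC [j + _]addrC.
  case: n => n //; rewrite NegzE !mulNr.
  by have := HB _ _ _ _ H0 (Hn n.+1); rewrite !sub0r.
have [a Ha] : exists a : nat, forall i, H i 0 <-> (a %| i)%Z.
  apply: (@addgrp_int (fun i => H i 0)); split=> // i j Hi Hj.
  by have := HB _ _ _ _ Hi Hj; rewrite subrr.
have [c Hc] : exists c : nat, forall j, (exists i, H i j) <-> (c %| j)%Z.
  apply: addgrp_int; split; first by exists 0.
  by move=> x y [i Hi] [j Hj]; exists (i - j); apply: HB.
have [b Hb] := (Hc c).2 (dvdzz c).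
have a0 : a != 0%N.
  apply/eqP => a0; have := (Ha N).1 HN0; rewrite a0 dvd0z; lia.
have c0 : c != 0%N.
  apply/eqP => c0; have := (Hc N).1 (ex_intro _ 0 H0N); rewrite c0 dvd0z; lia.
exists a, b, c; split => //; first by apply/(Ha a).2; apply: dvdzz.
move=> i j Hij; have /dvdzP[y Ey] := (Hc j).1 (ex_intro _ i Hij).
have := HB _ _ _ _ Hij (HM y _ _ Hb); rewrite -Ey subrr => /(Ha _).1/dvdzP[x Ex].
by exists x, y; split=> //; rewrite -Ex subrK.
Qed.

(** Each condition [G p] depends only on the class modulo [p L], so solutions found prime by prime
    combine. It serves to find values of a form prime to a given number and vectors of largest
    conductor. *)
Lemma crt_primes (V : zmodType) (L : V -> Prop) (G : nat -> V -> Prop) (ps : seq nat) :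
  addgrp L -> all prime ps -> uniq ps ->
  (forall p, p \in ps -> exists2 x, L x & G p x) ->
  (forall p x y, p \in ps -> G p x -> L y -> G p (x + y *+ p)) ->
  exists2 x, L x & forall p, p \in ps -> G p x.
Proof.
move=> sL; elim: ps => [|p ps IH] /=; first by exists 0 => //; apply: addgrp0.
move=> /andP[pp aps] /andP[pnps ups] hex hinv.
have [] := IH aps ups.
- by move=> q qps; apply: hex; rewrite inE qps orbT.
- by move=> q x y qps; apply: hinv; rewrite inE qps orbT.
move=> x0 Lx0 Gx0; have [xp Lxp Gxp] := hex p (mem_head _ _).
pose Q := (\prod_(q <- ps) q)%N.
have cQ : coprime p Q.
  rewrite /Q big_seq; apply: (big_ind (fun q => coprime p q)) => //.
  - by rewrite coprimen1.
  - by move=> a b ca cb; rewrite coprimeMr ca.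
  - move=> q qps; rewrite prime_coprime // dvdn_prime2 //; last exact: (allP aps).
    by apply: contra pnps => /eqP->.
have Q0 : (0 < Q)%N.
  rewrite /Q big_seq; apply: (big_ind (fun q => 0 < q)%N) => //; first by move=> *; rewrite muln_gt0; apply/andP.
  by move=> q qps; apply: prime_gt0; apply: (allP aps).
have [k j Ekj _] := egcdnP p Q0.
have g1 : gcdn Q p = 1%N by apply/eqP; rewrite gcdnC.
(* The factor [k * Q] is 1 modulo [p] and 0 modulo every earlier prime, so the sum agrees with [xp]
   at [p] and with [x0] elsewhere. *)
exists (x0 + (xp - x0) *+ (k * Q)).
  by apply: addgrpD => //; apply: addgrpMn => //; apply: addgrpB.
move=> q; rewrite inE => /orP[/eqP->|qps]; last first.
  have -> : (k * Q = (k * (Q %/ q)) * q)%N.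
    by rewrite -mulnA divnK // /Q (big_rem _ qps) dvdn_mulr.
  rewrite mulrnA; apply: hinv; rewrite ?inE ?qps ?orbT //; first exact: Gx0.
  by apply: addgrpMn => //; apply: addgrpB.
rewrite Ekj g1 mulrnDr mulr1n mulrnA addrCA [x0 + _]addrCA subrr addr0 addrC.
apply: hinv => //; first by rewrite inE eqxx.
by apply: addgrpMn => //; apply: addgrpB.
Qed.

(** For [n = l / g], these [x] index the pairs with gcd [g] and lcm [l]: the pair is
    [(g x, g (n / x))]. *)
Definition unitary_divisors (n : nat) : seq nat :=
  [seq x <- divisors n | coprime x (n %/ x)].

Lemma mem_unitary_divisors n x : (0 < n)%N ->
  (x \in unitary_divisors n) = (x %| n)%N && coprime x (n %/ x).
Proof. by move=> n0; rewrite mem_filter andbC -dvdn_divisors. Qed.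

Lemma unitary_divisorsP n x : (0 < n)%N ->
  reflect (exists y, n = (x * y)%N /\ coprime x y) (x \in unitary_divisors n).
Proof.
move=> n0; rewrite mem_unitary_divisors //; apply: (iffP andP).
  by case=> xn cx; exists (n %/ x)%N; rewrite mulnC divnK.
case=> y [E c]; move: n0; rewrite E muln_gt0 => /andP[x0 y0].
by rewrite dvdn_mulr // mulKn.
Qed.

(** Write [n = p ^ k * m] with [m] prime to [p]. A unitary divisor takes all of [p ^ k] or none of
    it, so there are twice as many as for [m]. *)
Lemma size_unitary_divisors n : (0 < n)%N ->
  size (unitary_divisors n) = (2 ^ size (primes n))%N.
Proof.
elim/ltn_ind: n => n IH n0; case: (ltngtP n 1) => [|n1|->]; [by lia| |by []].
have pp := pdiv_prime n1; set p := pdiv n in pp.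
have [m /= cpm En] := pfactor_coprime pp n0; set k := logn p n in En.
have k0 : (0 < k)%N by rewrite logn_gt0 mem_primes pp n0 pdiv_dvd.
have m0 : (0 < m)%N by move: n0; rewrite En muln_gt0 => /andP[].
have pk1 : (1 < p ^ k)%N by rewrite -(exp1n k) ltn_exp2r // prime_gt1.
have pk0 : (0 < p ^ k)%N by exact: ltnW.
have cpkm : coprime (p ^ k) m by exact: coprimeXl.
have lmn : (m < n)%N by rewrite En ltn_Pmulr.
have -> : size (primes n) = (size (primes m)).+1.
  rewrite -[RHS]/(size (p :: primes m)); apply: perm_size; apply: uniq_perm.
  - exact: primes_uniq.
  - by rewrite /= primes_uniq andbT mem_primes pp m0 /= -prime_coprime.
  - move=> q; rewrite [in LHS]En primesM // primesX // (primes_prime pp).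
    by rewrite !inE orbC.
rewrite expnS mul2n -addnn -(IH m) //.
rewrite -{2}(size_map (muln (p ^ k)) (unitary_divisors m)) -size_cat.
apply: perm_size; apply: uniq_perm.
- by rewrite filter_uniq // divisors_uniq.
- rewrite cat_uniq filter_uniq ?divisors_uniq //= map_inj_uniq ?filter_uniq ?divisors_uniq //; last first.
    by move=> x y /eqP; rewrite eqn_pmul2l // => /eqP.
  rewrite andbT; apply/hasPn => _ /mapP[y _ ->] /=.
  apply/negP => /unitary_divisorsP-/(_ m0)[z [Ez _]].
  move: cpkm; rewrite Ez -mulnA coprimeMr /coprime gcdnn => /andP[/eqP h _].
  by rewrite h in pk1.
move=> x; rewrite mem_cat; apply/idP/idP.
  case/unitary_divisorsP => // y [E c].
  case px: (p %| x)%N.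
    have cy : coprime (p ^ k) y by apply: coprimeXl; apply: coprime_dvdl c.
    have /dvdnP[z Ez] : (p ^ k %| x)%N.
      by rewrite -(Gauss_dvdl x cy) -E En dvdn_mull.
    apply/orP; right; apply/mapP; exists z; last by rewrite mulnC.
    apply/unitary_divisorsP => //; exists y; split; last by move: c; rewrite Ez coprimeMl => /andP[].
    by apply/eqP; rewrite -(eqn_pmul2r pk0) -En E Ez; apply/eqP; ring.
  have cx : coprime (p ^ k) x by apply: coprimeXl; rewrite prime_coprime ?px.
  have /dvdnP[z Ez] : (p ^ k %| y)%N.
    by rewrite -(Gauss_dvdr y cx) -E En dvdn_mull.
  apply/orP; left; apply/unitary_divisorsP => //; exists z; split.
    by apply/eqP; rewrite -(eqn_pmul2r pk0) -En E Ez; apply/eqP; ring.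
  by move: c; rewrite Ez coprimeMr => /andP[].
case/orP.
  case/unitary_divisorsP => // y [E c]; apply/unitary_divisorsP => //.
  exists (y * p ^ k)%N; rewrite En E; split; first by ring.
  rewrite coprimeMr c; move: cpkm; rewrite E coprimeMr => /andP[cx _].
  by rewrite coprime_sym.
case/mapP => y /unitary_divisorsP-/(_ m0)[z [E c]] ->; apply/unitary_divisorsP => //.
exists z; rewrite En E; split; first by ring.
by move: cpkm; rewrite E coprimeMr coprimeMl => /andP[_ ->].
Qed.

Lemma coprime_subl n k : (k <= n)%N -> coprime (n - k) n = coprime k n.
Proof.
move=> kn; have E := subnKC kn; rewrite /coprime.
have -> : gcdn (n - k) n = gcdn (n - k) k by rewrite -{2}E addnC gcdnDl.
by rewrite -{2}E gcdnDl gcdnC.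
Qed.

(** The map [k |-> n - k] pairs the units below [n / 2] with those above; [n / 2] itself is not a
    unit once [n > 2]. *)
Lemma half_totient n : (2 < n)%N ->
  totient n = (size [seq k <- iota 1 n./2 | coprime k n]).*2.
Proof.
move=> n2; set s := filter _ _.
have us : uniq s by rewrite filter_uniq // iota_uniq.
have ms k : (k \in s) = [&& 0 < k, k <= n./2 & coprime k n]%N.
  by rewrite mem_filter mem_iota add1n ltnS andbC andbA.
have lt_s k : k \in s -> (k < n - k)%N.
  rewrite ms => /and3P[k0 kn c].
  have [//|] := ltnP k (n - k); move=> h.
  have E : n = k.*2 by lia.
  by move: c; rewrite E -muln2 coprimeMr /coprime gcdnn => /andP[/eqP]; lia.
have -> : totient n = size [seq k <- iota 0 n | coprime k n].
  rewrite totient_count_coprime size_filter -sum1_count [RHS]big_mkcond /index_iota subn0.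
  by apply: eq_bigr => i _; rewrite coprime_sym; case: ifP.
rewrite -addnn -{2}(size_map (subn n) s) -size_cat; apply: perm_size; apply: uniq_perm.
- by rewrite filter_uniq // iota_uniq.
- rewrite cat_uniq us /= map_inj_in_uniq ?us ?andbT.
    by apply/hasPn => _ /mapP[k ks ->] /=; apply/negP => /lt_s; have := lt_s _ ks; lia.
  by move=> x y /lt_s hx /lt_s hy; lia.
move=> k; rewrite mem_filter mem_iota mem_cat /= add0n; apply/idP/idP.
  case/andP=> c kn; have k0 : (0 < k)%N by case: k c {kn} => //; rewrite /coprime gcd0n; lia.
  have [h|h] := leqP k n./2; first by rewrite ms k0 h c.
  apply/orP; right; apply/mapP; exists (n - k)%N; last by lia.
  rewrite ms; apply/and3P; split; [lia|lia|].
  by rewrite coprime_subl // ltnW.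
case/orP => [ks|/mapP[j js ->]].
  by have := lt_s _ ks; move: ks; rewrite ms => /and3P[_ _ ->]; lia.
have := lt_s _ js; move: js; rewrite ms => /and3P[j0 jn c] h.
by apply/andP; split; [rewrite coprime_subl //; lia | lia].
Qed.

(** * Lattices in a quadratic field *)

Section LatticeOperations.
Variable C : numClosedFieldType.
Implicit Types (A B D M : C -> Prop) (w : C * C) (x y z a b : C).

(** Encoded as the least additive subgroup containing the products: no finite sums appear, and an
    inclusion is proved by instantiating [G]. *)
Definition mulL A B z : Prop :=
  forall G : C -> Prop, addgrp G -> (forall x y, A x -> B y -> G (x * y)) -> G z.

Definition scl a M z : Prop := M (a^-1 * z).
Definition cnj M z : Prop := M z^*.
Definition zsp w z : Prop := exists i j : int, z = i%:~R * w.1 + j%:~R * w.2.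
(** This is [2 i] times the signed area of the period parallelogram; a change of basis multiplies it
    by the determinant. *)
Definition dlt w : C := w.1^* * w.2 - w.1 * w.2^*.
Definition addZ A a z : Prop := exists (x : C) (k : int), A x /\ z = x + k%:~R * a.

Lemma addgrp_int_mul M (i : int) z : addgrp M -> M z -> M (i%:~R * z).
Proof. by move=> sM Mz; rewrite mulrzl; exact: (addgrpMz sM). Qed.

Lemma addgrp_nat_mul M (n : nat) z : addgrp M -> M z -> M (n%:R * z).
Proof. by move=> sM Mz; rewrite mulr_natl; exact: (addgrpMn sM). Qed.

Lemma addgrp_mulL A B : addgrp (mulL A B).
Proof.
split=> [G sG _|x y hx hy G sG h]; first exact: addgrp0.
by apply: addgrpB => //; [apply: hx|apply: hy].
Qed.

Lemma mem_mulL A B x y : A x -> B y -> mulL A B (x * y).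
Proof. by move=> Ax By G _; apply. Qed.

Lemma addgrp_colon M a : addgrp M -> addgrp (fun z => M (a * z)).
Proof.
move=> sM; split=> [|x y Mx My]; first by rewrite mulr0; apply: addgrp0.
by rewrite mulrBr; apply: addgrpB.
Qed.

Lemma addgrp_scl a M : addgrp M -> addgrp (scl a M). Proof. exact: addgrp_colon. Qed.

Lemma addgrp_cnj M : addgrp M -> addgrp (cnj M).
Proof.
move=> sM; split=> [|x y Mx My]; rewrite /cnj ?rmorph0 ?rmorphB; first exact: addgrp0.
exact: addgrpB.
Qed.

Lemma addgrp_zsp w : addgrp (zsp w).
Proof.
split; first by exists 0, 0; rewrite !mul0r addr0.
move=> _ _ [i [j ->]] [i' [j' ->]]; exists (i - i'), (j - j').
by rewrite !rmorphB /=; ring.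
Qed.

Lemma addgrp_addZ A a : addgrp A -> addgrp (addZ A a).
Proof.
move=> sA; split; first by exists 0, 0; rewrite mul0r addr0; split=> //; apply: addgrp0.
move=> _ _ [x [k [Ax ->]]] [y [l [Ay ->]]]; exists (x - y), (k - l); split; first exact: addgrpB.
by rewrite rmorphB /=; ring.
Qed.

Lemma mulLC A B : mulL A B = mulL B A.
Proof.
apply: set_ext => z; split=> h; apply: (h _ (addgrp_mulL _ _)) => x y Ax By;
by rewrite mulrC; apply: mem_mulL.
Qed.

Lemma mulLA A B D : mulL A (mulL B D) = mulL (mulL A B) D.
Proof.
apply: set_ext => z; split=> h; apply: (h _ (addgrp_mulL _ _)) => x y Ax Bx.
  apply: (Bx _ (addgrp_colon x (addgrp_mulL _ _))) => u v Bu Dv.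
  by rewrite mulrA; do 2!apply: mem_mulL => //.
rewrite mulrC; apply: (Ax _ (addgrp_colon y (addgrp_mulL _ _))) => u v Bu Dv.
by rewrite mulrC -mulrA; do 2!apply: mem_mulL => //.
Qed.

Lemma mulLCA A B D : mulL A (mulL B D) = mulL B (mulL A D).
Proof. by rewrite mulLA (mulLC A) -mulLA. Qed.

Lemma mulLAC A B D : mulL (mulL A B) D = mulL (mulL A D) B.
Proof. by rewrite -mulLA (mulLC B) mulLA. Qed.

Lemma mem_scl a M z : a != 0 -> M z -> scl a M (a * z).
Proof. by move=> a0; rewrite /scl mulKf. Qed.

Lemma scl1 M : scl 1 M = M.
Proof. by apply: set_ext => z; rewrite /scl invr1 mul1r. Qed.

Lemma scl_scl a b M : scl a (scl b M) = scl (a * b) M.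
Proof. by apply: set_ext => z; rewrite /scl invfM mulrA [b^-1 * _]mulrC. Qed.

Lemma sclK a M : a != 0 -> scl a^-1 (scl a M) = M.
Proof. by move=> a0; rewrite scl_scl mulVf // scl1. Qed.

Lemma sclVK a M : a != 0 -> scl a (scl a^-1 M) = M.
Proof. by move=> a0; rewrite scl_scl mulfV // scl1. Qed.

Lemma sclN a M : addgrp M -> scl (- a) M = scl a M.
Proof.
move=> sM; apply: set_ext => z; rewrite /scl invrN mulNr; split=> [h|]; last exact: addgrpN.
by rewrite -[_ * _]opprK; apply: addgrpN.
Qed.

Lemma scl_mulL a A B : a != 0 -> mulL (scl a A) B = scl a (mulL A B).
Proof.
move=> a0; apply: set_ext => z; split=> [h|h].
  apply: (h _ (addgrp_scl a (addgrp_mulL _ _))) => x y Ax By.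
  by rewrite /scl mulrA; apply: mem_mulL.
have := h _ (addgrp_colon a (addgrp_mulL (scl a A) B)).
rewrite mulVKf //; apply=> x y Ax By; rewrite mulrA; apply: mem_mulL => //.
exact: mem_scl.
Qed.

Lemma mulL_scl a A B : a != 0 -> mulL A (scl a B) = scl a (mulL A B).
Proof. by move=> a0; rewrite mulLC scl_mulL // mulLC. Qed.

Lemma scl_inj a A B : a != 0 -> scl a A = scl a B -> A = B.
Proof. by move=> a0 /(congr1 (scl a^-1)); rewrite !sclK. Qed.

Lemma mulL_zspP A w z : addgrp A ->
  mulL A (zsp w) z <-> exists x y, [/\ A x, A y & z = x * w.1 + y * w.2].
Proof.
move=> sA; split=> [h|[x [y [Ax Ay ->]]]]; last first.
  apply: (addgrpD (addgrp_mulL _ _)); apply: mem_mulL => //.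
    by exists 1, 0; rewrite mul1r mul0r addr0.
  by exists 0, 1; rewrite mul1r mul0r add0r.
apply: (h (fun z => exists x y, [/\ A x, A y & z = x * w.1 + y * w.2])).
  split; first by exists 0, 0; rewrite !mul0r addr0; split=> //; apply: addgrp0.
  move=> _ _ [x [y [Ax Ay ->]]] [x' [y' [Ax' Ay' ->]]].
  exists (x - x'), (y - y'); split; [exact: addgrpB|exact: addgrpB|ring].
move=> x _ Ax [i [j ->]]; exists (i%:~R * x), (j%:~R * x).
split; [exact: addgrp_int_mul|exact: addgrp_int_mul|ring].
Qed.

Lemma zsp_scl a w : a != 0 -> scl a (zsp w) = zsp (a * w.1, a * w.2).
Proof.
move=> a0; apply: set_ext => z; split=> -[i [j /= E]]; exists i, j => /=.
  by rewrite -[z](mulVKf a0) E; ring.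
by rewrite E; field.
Qed.

Lemma addZ_scl a A b : a != 0 -> scl a (addZ A b) = addZ (scl a A) (a * b).
Proof.
move=> a0; apply: set_ext => z; split=> -[x [k [Ax E]]].
  exists (a * x), k; split; first exact: mem_scl.
  by rewrite -[z](mulVKf a0) E; ring.
exists (a^-1 * x), k; split=> //.
by rewrite E; field.
Qed.

End LatticeOperations.

(** * Orders [Z + n Z om] of a quadratic field *)

Section Orders.
Variable C : numClosedFieldType.
Implicit Types (z : C).

(** The field [Q(om)] with denominators cleared, so that only integer coefficients occur. *)
Definition ratspan (om : C) z : Prop :=
  exists (n : nat) (i j : int), (0 < n)%N /\ n%:R * z = i%:~R + j%:~R * om.
Definition order_of (om : C) (n : nat) z : Prop :=
  exists i j : int, z = i%:~R + j%:~R * (n%:R * om).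

(* [qgen_max] expresses that Z[qgen] is the maximal order of Q(qgen). *)
Record quad := Quad {
  qgen : C; qtr : int; qnm : int;
  qgen_tr : qgen + qgen^* = qtr%:~R;
  qgen_nm : qgen * qgen^* = qnm%:~R;
  qgen_imag : qgen != qgen^*;
  qgen_max : forall z, ratspan qgen z ->
    (exists t : int, z + z^* = t%:~R) -> (exists n : int, z * z^* = n%:~R) ->
    order_of qgen 1 z }.

Variable Q : quad.
Local Notation om := (qgen Q).
Local Notation tr := (qtr Q).
Local Notation nm := (qnm Q).
Local Notation inQ := (ratspan om).
Local Notation Ord := (order_of om).
Let om_tr : om + om^* = tr%:~R := qgen_tr Q.
Let om_nm : om * om^* = nm%:~R := qgen_nm Q.
Let om_imag : om != om^* := qgen_imag Q.
Implicit Types (A B D M : C -> Prop) (w : C * C) (x y a b : C).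

Lemma conj_om : om^* = tr%:~R - om. Proof. by rewrite -om_tr; ring. Qed.
Lemma om_sqr : om * om = tr%:~R * om - nm%:~R.
Proof. by rewrite -om_nm conj_om; ring. Qed.

Lemma conj_zint (i : int) : (i%:~R : C)^* = i%:~R. Proof. exact: rmorph_int. Qed.

Lemma om_free (i j : int) : i%:~R + j%:~R * om = 0 -> i = 0 /\ j = 0.
Proof.
move=> E; have E' := congr1 (@Num.conj C) E.
rewrite rmorphD rmorphM /= !conj_zint rmorph0 in E'.
have : j%:~R * (om - om^*) = 0 by rewrite mulrBr -[RHS](subrr 0) -{1}E -E'; ring.
move/eqP; rewrite mulf_eq0 subr_eq0 (negPf om_imag) orbF intr_eq0 => /eqP j0.
split=> //; move: E; rewrite j0 mul0r addr0 => /eqP; by rewrite intr_eq0 => /eqP.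
Qed.

Lemma om_inj (i j i' j' : int) :
  i%:~R + j%:~R * om = i'%:~R + j'%:~R * om -> i = i' /\ j = j'.
Proof.
move=> E; have [] := @om_free (i - i') (j - j').
  have -> : (i - i')%:~R + (j - j')%:~R * om =
    (i%:~R + j%:~R * om) - (i'%:~R + j'%:~R * om) by rewrite !rmorphB /=; ring.
  by rewrite E subrr.
by move=> /eqP; rewrite subr_eq0 => /eqP-> /eqP; rewrite subr_eq0 => /eqP->.
Qed.

Lemma Ord1P z : Ord 1 z <-> exists i j : int, z = i%:~R + j%:~R * om.
Proof. by split=> -[i [j ->]]; exists i, j; rewrite ?mul1r. Qed.

Lemma addgrp_Ord n : addgrp (Ord n).
Proof.
split; first by exists 0, 0; rewrite mul0r addr0.
move=> _ _ [i [j ->]] [i' [j' ->]]; exists (i - i'), (j - j').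
by rewrite !rmorphB /=; ring.
Qed.

Lemma Ord_int n (i : int) : Ord n i%:~R.
Proof. by exists i, 0; rewrite mul0r addr0. Qed.

Lemma Ord_1 n : Ord n 1. Proof. exact: (Ord_int n 1). Qed.

Lemma Ord_om n : Ord n (n%:R * om).
Proof. by exists 0, 1; rewrite add0r mul1r. Qed.

Lemma Ord_mul n x y : Ord n x -> Ord n y -> Ord n (x * y).
Proof.
move=> [i [j ->]] [i' [j' ->]].
exists (i * i' - j * j' * n%:Z * n%:Z * nm), (i * j' + j * i' + j * j' * n%:Z * tr).
rewrite !(rmorphD, rmorphB, rmorphM) /=.
have -> : (i%:~R + j%:~R * (n%:R * om)) * (i'%:~R + j'%:~R * (n%:R * om)) =
  i%:~R * i'%:~R + (i%:~R * j'%:~R + j%:~R * i'%:~R) * (n%:R * om)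
  + j%:~R * j'%:~R * n%:R * n%:R * (om * om) by ring.
by rewrite om_sqr; ring.
Qed.

Lemma Ord_conj n z : Ord n z -> Ord n z^*.
Proof.
move=> [i [j ->]]; exists (i + j * n%:Z * tr), (- j).
rewrite rmorphD !rmorphM /= !conj_zint rmorph_nat conj_om !(rmorphD, rmorphM, rmorphN) /=.
ring.
Qed.

Lemma Ord_coef n (i j : int) : Ord n (i%:~R + j%:~R * om) <-> (n%:Z %| j)%Z.
Proof.
split=> [[i' [j']]|/dvdzP[q ->]]; last by exists i, q; rewrite rmorphM /=; ring.
have -> : i'%:~R + j'%:~R * (n%:R * om) = i'%:~R + (j' * n%:Z)%:~R * om.
  by rewrite rmorphM /=; ring.
by case/om_inj=> _ ->; rewrite dvdz_mull.
Qed.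

Lemma OrdS m n z : (n %| m)%N -> Ord m z -> Ord n z.
Proof.
case/dvdnP=> q -> [i [j ->]]; exists i, (j * q%:Z).
by ring.
Qed.

Lemma OrdP n z : Ord n z <-> exists i j : int, z = i%:~R + j%:~R * om /\ (n%:Z %| j)%Z.
Proof.
split=> [|[i [j [-> nj]]]]; last by apply/Ord_coef.
case=> i [j ->]; exists i, (j * n%:Z); rewrite dvdz_mull // rmorphM /=; split=> //; ring.
Qed.

Lemma Ord_dvd m n : (forall z, Ord m z -> Ord n z) -> (n %| m)%N.
Proof.
move=> /(_ _ (Ord_om m)); have -> : m%:R * om = (0 : int)%:~R + (m%:Z)%:~R * om by rewrite add0r.
by move/Ord_coef.
Qed.

Lemma Ord_inj m n : Ord m = Ord n -> m = n.
Proof.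
by move=> E; apply/eqP; rewrite eqn_dvd; apply/andP; split; apply: Ord_dvd => z; rewrite E.
Qed.

Lemma Ord_cap m n z : Ord m z -> Ord n z -> Ord (lcmn m n) z.
Proof.
move=> /OrdP[i [j [-> mj]]] /Ord_coef nj; apply/Ord_coef.
by move: mj nj; rewrite !dvdzE /= dvdn_lcm => -> ->.
Qed.

Lemma mulL_Ord m n : mulL (Ord m) (Ord n) = Ord (gcdn m n).
Proof.
apply: set_ext => z; split=> [h|].
  apply: (h (Ord (gcdn m n))); first exact: addgrp_Ord.
  by move=> x y /(OrdS (dvdn_gcdl m n)) hx /(OrdS (dvdn_gcdr m n)); apply: Ord_mul.
move=> [i [j ->]]; apply: (addgrpD (addgrp_mulL _ _)).
  by rewrite -[X in mulL _ _ X]mulr1; apply: mem_mulL; [apply: Ord_int|apply: Ord_1].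
apply: (addgrp_int_mul _ (addgrp_mulL _ _)).
have [u [v E]] := Bezoutz m n.
have -> : (gcdn m n)%:R = u%:~R * m%:R + v%:~R * n%:R :> C.
  by have := congr1 (fun k : int => k%:~R : C) E; rewrite rmorphD !rmorphM /= => ->.
rewrite mulrDl -!mulrA; apply: (addgrpD (addgrp_mulL _ _)).
  apply: (addgrp_int_mul _ (addgrp_mulL _ _)).
  by rewrite -[X in mulL _ _ X]mulr1; apply: mem_mulL; [apply: Ord_om|apply: Ord_1].
apply: (addgrp_int_mul _ (addgrp_mulL _ _)).
by rewrite -[X in mulL _ _ X]mul1r; apply: mem_mulL; [apply: Ord_1|apply: Ord_om].
Qed.

Lemma inQ_Ord z : inQ z <-> exists2 n : nat, (0 < n)%N & Ord 1 (n%:R * z).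
Proof.
split=> [[n [i [j [n0 E]]]]|[n n0 /Ord1P[i [j E]]]]; last by exists n, i, j.
by exists n => //; apply/Ord1P; exists i, j.
Qed.

Lemma Ord_inQ n z : Ord n z -> inQ z.
Proof.
by move=> h; apply/inQ_Ord; exists 1%N; rewrite // mul1r; apply: OrdS h; apply: dvd1n.
Qed.

Lemma inQ_int (i : int) : inQ i%:~R. Proof. exact: (Ord_inQ (Ord_int 1 i)). Qed.
Lemma inQ_nat (n : nat) : inQ n%:R. Proof. exact: (inQ_int n). Qed.
Lemma inQ_om : inQ om.
Proof. by apply: (@Ord_inQ 1); have := Ord_om 1; rewrite mul1r. Qed.

Lemma inQ_denom2 x y : inQ x -> inQ y ->
  exists2 n : nat, (0 < n)%N & Ord 1 (n%:R * x) /\ Ord 1 (n%:R * y).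
Proof.
move=> /inQ_Ord[n n0 hn] /inQ_Ord[m m0 hm]; exists (n * m)%N; first by rewrite muln_gt0 n0.
rewrite natrM; split; first by rewrite mulrAC mulrC; apply: addgrp_nat_mul => //; apply: addgrp_Ord.
by rewrite -mulrA; apply: addgrp_nat_mul => //; apply: addgrp_Ord.
Qed.

Lemma inQB x y : inQ x -> inQ y -> inQ (x - y).
Proof.
move=> hx hy; have [n n0 [nx ny]] := inQ_denom2 hx hy; apply/inQ_Ord; exists n => //.
by rewrite mulrBr; apply: addgrpB => //; apply: addgrp_Ord.
Qed.

Lemma inQ_addgrp : addgrp inQ.
Proof. by split; [exact: (inQ_int 0)|exact: inQB]. Qed.

Lemma inQD x y : inQ x -> inQ y -> inQ (x + y). Proof. exact: (addgrpD inQ_addgrp). Qed.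

Lemma inQM x y : inQ x -> inQ y -> inQ (x * y).
Proof.
move=> /inQ_Ord[n n0 nx] /inQ_Ord[m m0 my]; apply/inQ_Ord; exists (n * m)%N.
  by rewrite muln_gt0 n0.
by rewrite natrM mulrACA; apply: Ord_mul.
Qed.

Lemma inQ_conj x : inQ x -> inQ x^*.
Proof.
move=> /inQ_Ord[n n0 nx]; apply/inQ_Ord; exists n => //.
by rewrite -[n%:R](rmorph_nat (@Num.conj C)) -rmorphM; apply: Ord_conj.
Qed.

Lemma inQ_real x : inQ x -> x^* = x ->
  exists (n : nat) (i : int), (0 < n)%N /\ n%:R * x = i%:~R.
Proof.
move=> [n [i [j [n0 E]]]] xr; exists n, i; split=> //.
have E' := congr1 (@Num.conj C) E.
rewrite rmorphM rmorph_nat /= xr E rmorphD rmorphM /= !conj_zint in E'.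
move/addrI: E' => /eqP; rewrite -subr_eq0 -mulrBr mulf_eq0 subr_eq0 (negPf om_imag) orbF intr_eq0.
by move=> /eqP j0; rewrite E j0 mul0r addr0.
Qed.

Lemma inQ_frac x (k : int) : k != 0 -> inQ (k%:~R * x) -> inQ x.
Proof.
move=> k0 /inQ_Ord[n n0 h]; apply/inQ_Ord; exists (n * `|k|)%N.
  by rewrite muln_gt0 n0 absz_gt0.
have -> : (n * `|k|)%:R * x = (sgz k)%:~R * (n%:R * (k%:~R * x)).
  have E : (`|k|%N)%:R = (sgz k)%:~R * k%:~R :> C.
    by rewrite -[RHS](rmorphM (intr : int -> C)) /= -abszEsg.
  by rewrite natrM E; ring.
by apply: addgrp_int_mul => //; apply: addgrp_Ord.
Qed.
End Orders.

(** * Bases of lattices, and operations that preserve lattices *)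

Section Lattices.
Variables (C : numClosedFieldType) (Q : quad C).
Local Notation om := (qgen Q).
Local Notation inQ := (ratspan om).
Local Notation Ord := (order_of om).
Implicit Types (A B D M : C -> Prop) (w : C * C) (x y z a b : C).

Lemma natr_neq0 n : (0 < n)%N -> (n%:R : C) != 0.
Proof. by rewrite pnatr_eq0 -lt0n. Qed.

Lemma inQ_inv x : inQ x -> inQ x^-1.
Proof.
move=> hx; have [->|x0] := eqVneq x 0; first by rewrite invr0; apply: (inQ_int Q 0).
have [] := @inQ_real _ Q (x * x^*); first by apply: inQM => //; apply: inQ_conj.
  by rewrite rmorphM /= conjCK mulrC.
move=> n [i [n0 E]].
have xx0 : x * x^* != 0 by rewrite mul_conjC_eq0.
have i0 : i != 0.
  by rewrite -(intr_eq0 C) -E mulf_neq0 // natr_neq0.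
apply: (inQ_frac i0); rewrite -E.
have -> : n%:R * (x * x^*) * x^-1 = n%:R * x^* by field.
by apply: inQM; [apply: inQ_nat|apply: inQ_conj].
Qed.

Lemma inQ_div x y : inQ x -> inQ y -> inQ (x / y).
Proof. by move=> hx hy; apply: inQM => //; apply: inQ_inv. Qed.

Definition isbas w : Prop := [/\ inQ w.1, inQ w.2 & dlt w != 0].

Lemma conj_dlt w : (dlt w)^* = - dlt w.
Proof. by rewrite /dlt rmorphB !rmorphM /= !conjCK; ring. Qed.

Lemma inQ_dlt w : isbas w -> inQ (dlt w).
Proof. by case=> h1 h2 _; apply: inQB; apply: inQM => //; apply: inQ_conj. Qed.

(** Cramer's rule for the relation and its conjugate, whose determinant is [dlt w]. *)
Lemma zsp_free w (i j : int) : dlt w != 0 ->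
  i%:~R * w.1 + j%:~R * w.2 = 0 -> i = 0 /\ j = 0.
Proof.
move=> d0 E; have E' := congr1 (@Num.conj C) E.
rewrite rmorphD !rmorphM /= !conj_zint rmorph0 in E'.
have Ei : i%:~R * dlt w = 0.
  have -> : i%:~R * dlt w = (i%:~R * w.1^* + j%:~R * w.2^*) * w.2
     - (i%:~R * w.1 + j%:~R * w.2) * w.2^* by rewrite /dlt; ring.
  by rewrite E E' !mul0r subr0.
have Ej : j%:~R * dlt w = 0.
  have -> : j%:~R * dlt w = (i%:~R * w.1 + j%:~R * w.2) * w.1^*
     - (i%:~R * w.1^* + j%:~R * w.2^*) * w.1 by rewrite /dlt; ring.
  by rewrite E E' !mul0r subr0.
move/eqP: Ei; move/eqP: Ej.
by rewrite !mulf_eq0 (negPf d0) !orbF !intr_eq0 => /eqP-> /eqP->.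
Qed.

Lemma zsp_coord w z : isbas w -> inQ z ->
  exists (n : nat) (i j : int), (0 < n)%N /\ n%:R * z = i%:~R * w.1 + j%:~R * w.2.
Proof.
move=> bw hz; have [h1 h2 d0] := bw.
have hd := inQ_dlt bw.
(* Cramer's formulas for the coordinates. Numerators and [dlt w] all change sign under conjugation,
   so [x] and [y] are fixed by it and hence rational. *)
pose x := (z^* * w.2 - z * w.2^*) / dlt w; pose y := (z * w.1^* - z^* * w.1) / dlt w.
have [n [i [n0 Ex]]] : exists (n : nat) (i : int), (0 < n)%N /\ n%:R * x = i%:~R.
  apply: inQ_real; first by apply: inQ_div => //; apply: inQB; apply: inQM => //; apply: inQ_conj.
  by rewrite /x fmorph_div /= conj_dlt rmorphB !rmorphM /= !conjCK invrN; ring.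
have [m [j [m0 Ey]]] : exists (n : nat) (i : int), (0 < n)%N /\ n%:R * y = i%:~R.
  apply: inQ_real; first by apply: inQ_div => //; apply: inQB; apply: inQM => //; apply: inQ_conj.
  by rewrite /y fmorph_div /= conj_dlt rmorphB !rmorphM /= !conjCK invrN; ring.
exists (n * m)%N, (m%:Z * i), (n%:Z * j); split; first by rewrite muln_gt0 n0.
have Ez : z = x * w.1 + y * w.2.
  by rewrite /x /y; rewrite /dlt in d0 *; field.
by rewrite Ez !rmorphM /= -Ex -Ey ?natrM; ring.
Qed.

Lemma isbas_free w : inQ w.1 -> inQ w.2 ->
  (forall i j : int, i%:~R * w.1 + j%:~R * w.2 = 0 -> i = 0 /\ j = 0) -> isbas w.
Proof.
move=> h1 h2 fr; split=> //; apply/negP => /eqP d0.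
have w10 : w.1 != 0.
  apply/eqP => E; have [] := fr 1 0; first by rewrite E mulr0 mul0r addr0.
  by move/eqP; rewrite oner_eq0.
(* If [dlt w] vanishes, [w.2 / w.1] is fixed by conjugation, hence rational, and this yields an
   integral relation. *)
have [n [i [n0 E]]] : exists (n : nat) (i : int), (0 < n)%N /\ n%:R * (w.2 / w.1) = i%:~R.
  apply: inQ_real; first exact: inQ_div.
  have w1c : w.1^* != 0 by rewrite conjC_eq0.
  rewrite fmorph_div /=; move/eqP: d0; rewrite /dlt subr_eq0 => /eqP d0.
  by apply/eqP; rewrite eqr_div // mulrC -d0 mulrC.
have [] := fr (- i) n%:Z.
  by rewrite rmorphN /= -E; field.
by move=> _ [] n0'; move: n0; rewrite n0'.
Qed.

(** Commensurability with [O_1] replaces the choice of a basis: products, intersections and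
    conjugates inherit it directly, and [latt_basis] recovers a basis when one is needed. *)
Definition latt M : Prop := addgrp M /\ exists n : nat, [/\ (0 < n)%N,
  (forall z, Ord 1 z -> M (n%:R * z)) & (forall z, M z -> Ord 1 (n%:R * z))].

Lemma latt_addgrp M : latt M -> addgrp M. Proof. by case. Qed.

Lemma latt_inQ M z : latt M -> M z -> inQ z.
Proof.
by move=> [_ [n [n0 _ h]]] Mz; apply/inQ_Ord; exists n => //; apply: h.
Qed.

Lemma latt_basis M : latt M -> exists2 w, isbas w & M = zsp w.
Proof.
move=> [sM [n [n0 nO nM]]]; have n0C := natr_neq0 n0.
(* These are the coordinates of [n M], which lies between [n^2 O_1] and [O_1]; hence the exponent
   [n * n]. *)
have [] := @addgrp_int2_basis (fun i j => M ((i%:~R + j%:~R * om) / n%:R)) (n * n).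
- by rewrite muln_gt0 n0.
- by rewrite mul0r addr0 mul0r; apply: addgrp0.
- move=> i j i' j' h h'; have := addgrpB sM h h'; congr M.
  by rewrite !rmorphB /=; ring.
- rewrite mul0r addr0.
  have -> : (n * n)%N%:~R / n%:R = n%:R * 1 :> C by rewrite -[_%:~R]/((n * n)%:R) ?natrM; field.
  by apply: nO; apply: Ord_1.
- rewrite add0r.
  have -> : (n * n)%N%:~R * om / n%:R = n%:R * om by rewrite -[_%:~R]/((n * n)%:R) ?natrM; field.
  by apply: nO; have := Ord_om Q 1; rewrite mul1r.
move=> i [b [c [i0 c0 Hi Hbc hb]]].
exists (i%:~R / n%:R, (b%:~R + c%:~R * om) / n%:R).
  split=> /=.
  - by apply: inQ_div; [apply: inQ_int|apply: inQ_nat].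
  - apply: inQ_div; last exact: inQ_nat.
    by apply: inQD; [apply: inQ_int|apply: inQM; [apply: inQ_int|apply: inQ_om]].
  rewrite /dlt /= !(rmorphM, rmorphD, fmorphV) /= !conj_zint !rmorph_nat.
  have -> : i%:~R / n%:R * ((b%:~R + c%:~R * om) / n%:R) -
    i%:~R / n%:R * ((b%:~R + c%:~R * om^*) / n%:R) =
    i%:~R * c%:~R / (n%:R * n%:R) * (om - om^*) by field.
  rewrite mulf_neq0 ?subr_eq0 ?qgen_imag // !mulf_neq0 ?intr_eq0 ?invr_eq0 //.
  by rewrite mulf_neq0.
apply: set_ext => z; split=> [Mz|[x [y ->]] /=].
  have /Ord1P[k [l E]] := nM _ Mz.
  have [] := hb k l; first by rewrite -E mulrC mulKf.
  move=> x [y [Ek El]]; exists x, y => /=.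
  apply: (mulfI n0C); rewrite E Ek El !(rmorphD, rmorphM) /=; field.
  exact: n0C.
apply: (addgrpD sM); apply: (addgrp_int_mul _ sM) => //.
by have := Hi; rewrite mul0r addr0.
Qed.

Lemma latt_zsp w : isbas w -> latt (zsp w).
Proof.
move=> bw; split; first exact: addgrp_zsp.
have [h1 h2 d0] := bw; have [n n0 [n1 n2]] := inQ_denom2 h1 h2.
have [m [i [j [m0 Em]]]] := zsp_coord bw (inQ_int Q 1).
have [k [i' [j' [k0 Ek]]]] := zsp_coord bw (inQ_om Q).
exists (n * (m * k))%N; split; first by rewrite !muln_gt0 n0 m0.
  move=> _ /Ord1P[x [y ->]].
  have -> : (n * (m * k))%:R * (x%:~R + y%:~R * om) =
    (x * n%:Z * k%:Z)%:~R * (m%:R * 1%:~R) + (y * n%:Z * m%:Z)%:~R * (k%:R * om).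
    by rewrite !rmorphM /= ?natrM; ring.
  apply: (addgrpD (addgrp_zsp w)); apply: (addgrp_int_mul _ (addgrp_zsp w)).
    by exists i, j.
  by exists i', j'.
move=> _ [x [y ->]].
have -> : (n * (m * k))%:R * (x%:~R * w.1 + y%:~R * w.2) =
  (m%:Z * k%:Z * x)%:~R * (n%:R * w.1) + (m%:Z * k%:Z * y)%:~R * (n%:R * w.2).
  by rewrite !rmorphM /= ?natrM; ring.
by apply: (addgrpD (addgrp_Ord _ _)); apply: (addgrp_int_mul _ (addgrp_Ord _ _)).
Qed.

Lemma latt_commens A B : latt A -> latt B ->
  exists2 n : nat, (0 < n)%N & forall z, A z -> B (n%:R * z).
Proof.
move=> [_ [n [n0 _ nA]]] [_ [m [m0 mB _]]]; exists (m * n)%N; first by rewrite muln_gt0 m0.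
by move=> z Az; rewrite ?natrM -mulrA; apply: mB; apply: nA.
Qed.

Lemma latt_commens_l A M : latt A -> addgrp M ->
  (exists2 n : nat, (0 < n)%N & forall z, A z -> M (n%:R * z)) ->
  (exists2 n : nat, (0 < n)%N & forall z, M z -> A (n%:R * z)) -> latt M.
Proof.
move=> [sA [n [n0 nA An]]] sM [k k0 AM] [l l0 MA]; split=> //.
exists (k * l * n)%N; split; first by rewrite !muln_gt0 k0 l0.
  move=> z Oz; have -> : (k * l * n)%:R * z = l%:R * (k%:R * (n%:R * z)) by rewrite ?natrM; ring.
  by apply: addgrp_nat_mul => //; apply: AM; apply: nA.
move=> z Mz; have -> : (k * l * n)%:R * z = k%:R * (n%:R * (l%:R * z)) by rewrite ?natrM; ring.
by apply: (addgrp_nat_mul _ (addgrp_Ord _ _)); apply: An; apply: MA.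
Qed.

Lemma latt_Ord n : (0 < n)%N -> latt (Ord n).
Proof.
move=> n0; have := @latt_zsp (1, n%:R * om); rewrite /zsp /=.
have -> : (fun z => exists i j : int, z = i%:~R * 1 + j%:~R * (n%:R * om)) = Ord n.
  by apply: set_ext => z; split=> -[i [j ->]]; exists i, j; rewrite mulr1.
apply; split=> /=; [exact: (inQ_int Q 1)|by apply: inQM; [apply: inQ_nat|apply: inQ_om]|].
rewrite /dlt /= rmorph1 rmorphM rmorph_nat !mul1r -mulrBr.
by rewrite mulf_neq0 ?subr_eq0 ?qgen_imag ?natr_neq0.
Qed.

Lemma latt_cnj M : latt M -> latt (cnj M).
Proof.
move=> [sM [n [n0 nM Mn]]]; split; first exact: addgrp_cnj.
exists n; split=> // z hz; rewrite /cnj.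
  by rewrite rmorphM rmorph_nat; apply: nM; apply: Ord_conj.
by rewrite -[n%:R * z]conjCK; apply: Ord_conj; rewrite rmorphM rmorph_nat; apply: Mn.
Qed.

Lemma latt_scl a M : inQ a -> a != 0 -> latt M -> latt (scl a M).
Proof.
move=> ha a0 /latt_basis[w [h1 h2 d0] ->]; rewrite zsp_scl //; apply: latt_zsp.
split=> /=; [exact: inQM|exact: inQM|].
have -> : dlt (a * w.1, a * w.2) = a * a^* * dlt w by rewrite /dlt /= !rmorphM /=; ring.
by rewrite mulf_neq0 // mul_conjC_eq0.
Qed.

Lemma latt_mulL A B : latt A -> latt B -> latt (mulL A B).
Proof.
move=> [sA [n [n0 nA An]]] [sB [m [m0 mB Bm]]]; split; first exact: addgrp_mulL.
exists (n * m)%N; split; first by rewrite muln_gt0 n0.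
  move=> z Oz; have -> : (n * m)%:R * z = (n%:R * z) * (m%:R * 1) by rewrite ?natrM; ring.
  by apply: mem_mulL; [apply: nA|apply: mB; apply: Ord_1].
move=> z h; apply: (h _ (addgrp_colon _ (addgrp_Ord Q 1))) => x y Ax By.
by rewrite ?natrM mulrACA; apply: Ord_mul; [apply: An|apply: Bm].
Qed.

Lemma latt_cap A B : latt A -> latt B -> latt (fun z => A z /\ B z).
Proof.
move=> lA lB; have [sA _] := lA; have [sB _] := lB; apply: (latt_commens_l lA).
- split; first by split; apply: addgrp0.
  by move=> x y [Ax Bx] [Ay By]; split; apply: addgrpB.
- have [n n0 h] := latt_commens lA lB; exists n => // z Az; split; last exact: h.
  exact: addgrp_nat_mul.
- by exists 1%N => // z [Az _]; rewrite mul1r.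
Qed.

Lemma latt_addZ A v : latt A -> inQ v -> latt (addZ A v).
Proof.
move=> lA hv; have [sA [n [n0 nA An]]] := lA; apply: (latt_commens_l lA).
- exact: addgrp_addZ.
- by exists 1%N => // z Az; exists z, 0; rewrite mul1r mul0r addr0.
- have /inQ_Ord[m m0 hm] := hv; exists (n * m)%N; first by rewrite muln_gt0 n0.
  move=> _ [x [k [Ax ->]]].
  have -> : (n * m)%:R * (x + k%:~R * v) = (n * m)%:R * x + k%:~R * (n%:R * (m%:R * v)).
    by rewrite ?natrM; ring.
  apply: (addgrpD sA); first exact: addgrp_nat_mul.
  by apply: addgrp_int_mul => //; apply: nA.
Qed.

Lemma latt_neq0 M : latt M -> exists2 x, M x & x != 0.
Proof.
case/latt_basis=> w [_ _ d0] ->; exists w.1; first by exists 1, 0; rewrite mul1r mul0r addr0.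
by apply: contraNneq d0 => E; rewrite /dlt E rmorph0 !mul0r subr0.
Qed.

Lemma latt_scl_inQ a M M' : latt M -> latt M' -> a != 0 -> M' = scl a M -> inQ a.
Proof.
move=> lM lM' a0 E; have [x Mx x0] := latt_neq0 lM.
have : M' (a * x) by rewrite E; apply: mem_scl.
by move=> /(latt_inQ lM') h; rewrite -[a](mulfK x0); apply: inQ_div => //; apply: latt_inQ Mx.
Qed.

End Lattices.

(** * Conductors *)

Section Conductors.
Variables (C : numClosedFieldType) (Q : quad C).
Local Notation om := (qgen Q).
Local Notation tr := (qtr Q).
Local Notation nm := (qnm Q).
Local Notation inQ := (ratspan om).
Local Notation Ord := (order_of om).
Local Notation isbas := (isbas Q).
Local Notation latt := (latt Q).
Implicit Types (A B D M : C -> Prop) (w : C * C) (x y z : C).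

(* The norm form of the basis w is q (a X^2 + b X Y + c Y^2) with (a, b, c) primitive; m is
   then the conductor of the lattice spanned by w, and e is a sign. *)
Record norm_form w (q : C) (a b c k e : int) (m : nat) : Prop := NormForm {
  nf_q : inQ q;
  nf_q0 : 0 < q;
  nf_a : w.1 * w.1^* = q * a%:~R;
  nf_b : w.1 * w.2^* + w.1^* * w.2 = q * b%:~R;
  nf_c : w.2 * w.2^* = q * c%:~R;
  nf_prim : exists x y z : int, x * a + y * b + z * c = 1;
  nf_m : (0 < m)%N;
  nf_e : e * e = 1;
  nf_th : w.1 * w.2^* = q * (k%:~R + (e * m%:Z)%:~R * om) }.

(** Take [q] to be the content of the rational norm form. Then [w.1 conj(w.2) / q] has integral
    trace [b] and norm [a c], so it lies in [O_1] by maximality; its coefficient at [om] is nonzero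
    because [dlt w] is, and it is written as sign times absolute value. *)
Lemma norm_form_exists w : isbas w -> exists q a b c k e m, norm_form w q a b c k e m.
Proof.
move=> bw; have [h1 h2 d0] := bw.
have w10 : w.1 != 0 by apply: contraNneq d0 => E; rewrite /dlt E rmorph0 !mul0r subr0.
have [n1 [A1 [n10 EA]]] : exists (n : nat) (i : int), (0 < n)%N /\ n%:R * (w.1 * w.1^*) = i%:~R.
  apply: (@inQ_real _ Q); first by apply: inQM => //; apply: inQ_conj.
  by rewrite rmorphM /= conjCK mulrC.
have [n2 [B1 [n20 EB]]] : exists (n : nat) (i : int),
    (0 < n)%N /\ n%:R * (w.1 * w.2^* + w.1^* * w.2) = i%:~R.
  apply: (@inQ_real _ Q); first by apply: inQD; apply: inQM => //; apply: inQ_conj.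
  by rewrite rmorphD !rmorphM /= !conjCK; ring.
have [n3 [D1 [n30 ED]]] : exists (n : nat) (i : int), (0 < n)%N /\ n%:R * (w.2 * w.2^*) = i%:~R.
  apply: (@inQ_real _ Q); first by apply: inQM => //; apply: inQ_conj.
  by rewrite rmorphM /= conjCK mulrC.
have n10C := natr_neq0 C n10; have n20C := natr_neq0 C n20; have n30C := natr_neq0 C n30.
pose n := (n1 * n2 * n3)%N.
have n0 : (0 < n)%N by rewrite !muln_gt0 n10 n20.
have n0C := natr_neq0 C n0.
pose A := A1 * n2%:Z * n3%:Z; pose B := B1 * n1%:Z * n3%:Z; pose D := D1 * n1%:Z * n2%:Z.
have EnA : n%:R * (w.1 * w.1^*) = A%:~R by rewrite /n /A !rmorphM /= -EA ?natrM; ring.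
have EnB : n%:R * (w.1 * w.2^* + w.1^* * w.2) = B%:~R.
  by rewrite /n /B !rmorphM /= -EB ?natrM; ring.
have EnD : n%:R * (w.2 * w.2^*) = D%:~R by rewrite /n /D !rmorphM /= -ED ?natrM; ring.
have A0 : A != 0.
  by rewrite -(intr_eq0 C) -EnA mulf_neq0 // mul_conjC_eq0.
pose g := gcdz A (gcdz B D).
have g0 : g != 0 by rewrite gcdz_eq0 (negPf A0).
have gpos : 0 < g by rewrite lt_def g0.
have [a Ea] : exists a, A = g * a.
  by have /dvdzP[a ->] := dvdz_gcdl A (gcdz B D); exists a; rewrite mulrC.
have [b Eb] : exists b, B = g * b.
  have /dvdzP[b ->] : (g %| B)%Z by apply: dvdz_trans (dvdz_gcdr _ _) (dvdz_gcdl _ _).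
  by exists b; rewrite mulrC.
have [c Ec] : exists c, D = g * c.
  have /dvdzP[c ->] : (g %| D)%Z by apply: dvdz_trans (dvdz_gcdr _ _) (dvdz_gcdr _ _).
  by exists c; rewrite mulrC.
have [u [v Euv]] := Bezoutz A (gcdz B D); have [s [t Est]] := Bezoutz B D.
pose q : C := g%:~R / n%:R.
have gC : (g%:~R : C) != 0 by rewrite intr_eq0.
have q0 : 0 < q by rewrite divr_gt0 ?ltr0z ?ltr0n.
have q0' : q != 0 by rewrite gt_eqF.
have qr : q^* = q by rewrite fmorph_div /= conj_zint rmorph_nat.
have qa : w.1 * w.1^* = q * a%:~R.
  by apply: (mulfI n0C); rewrite EnA Ea rmorphM /= /q; field.
have qb : w.1 * w.2^* + w.1^* * w.2 = q * b%:~R.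
  by apply: (mulfI n0C); rewrite EnB Eb rmorphM /= /q; field.
have qc : w.2 * w.2^* = q * c%:~R.
  by apply: (mulfI n0C); rewrite EnD Ec rmorphM /= /q; field.
have hq : inQ q by apply: inQ_div; [apply: inQ_int|apply: inQ_nat].
pose th := w.1 * w.2^* / q.
have thc : th^* = w.1^* * w.2 / q by rewrite /th fmorph_div rmorphM /= conjCK qr.
have /Ord1P[k [j Ej]] : Ord 1 th.
  apply: qgen_max; first by apply: inQ_div => //; apply: inQM => //; apply: inQ_conj.
    by exists b; rewrite thc /th -mulrDl qb mulrC mulKf.
  exists (a * c); rewrite thc /th rmorphM /=.
  have -> : w.1 * w.2^* / q * (w.1^* * w.2 / q) = (w.1 * w.1^*) * (w.2 * w.2^*) / q / q by ring.
  by rewrite qa qc; field.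
have j0 : j != 0.
  apply: contraNneq d0 => j0.
  have : th^* = th by rewrite Ej j0 mul0r addr0 conj_zint.
  rewrite thc /th => /(mulIf (invr_neq0 q0')) E; by rewrite /dlt E subrr.
exists q, a, b, c, k, (sgz j), `|j|%N; split=> //.
- exists u, (v * s), (v * t); apply: (mulfI g0).
  rewrite mulr1 -{2}[g]/(gcdz A (gcdz B D)) -Euv -Est Ea Eb Ec; ring.
- by rewrite absz_gt0.
- by case: sgzP j0 => // ->; rewrite eqxx.
- by rewrite -intEsg -Ej /th mulrCA mulfV // mulr1.
Qed.

Definition lat M (m : nat) : Prop := [/\ latt M, (0 < m)%N &
  forall x, (forall z, M z -> M (x * z)) <-> Ord m x].

Lemma lat_latt M m : lat M m -> latt M. Proof. by case. Qed.
Lemma lat_gt0 M m : lat M m -> (0 < m)%N. Proof. by case. Qed.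
Lemma lat_addgrp M m : lat M m -> addgrp M. Proof. by case=> [[]]. Qed.

Lemma lat_inj M m n : lat M m -> lat M n -> m = n.
Proof.
move=> [_ _ hm] [_ _ hn]; apply: (@Ord_inj _ Q); apply: set_ext => x.
by split=> [/(hm x).2/hn|/(hn x).2/hm].
Qed.

(** A lattice times its conjugate is its norm times its order. Primitivity writes [q] as an integral
    combination of [w.1 conj(w.1)], the trace of [w.1 conj(w.2)] and [w.2 conj(w.2)]; then
    [w.1 conj(w.2)] supplies [q m om]. *)
Lemma norm_form_mulL w q a b c k e m : norm_form w q a b c k e m ->
  mulL (zsp w) (cnj (zsp w)) = scl q (Ord m).
Proof.
move=> [hq q0 qa qb qc [x [y [z E]]] m0 Ee th].
have q0' : q != 0 by rewrite gt_eqF.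
have Eth : w.1^* * w.2 = q * (b%:~R - (k%:~R + (e * m%:Z)%:~R * om)).
  by rewrite mulrBr -th -qb; ring.
have zc (i j : int) : cnj (zsp w) (i%:~R * w.1^* + j%:~R * w.2^*).
  by exists i, j; rewrite rmorphD !rmorphM /= !conjCK !conj_zint.
have zz (i j : int) : zsp w (i%:~R * w.1 + j%:~R * w.2) by exists i, j.
apply: set_ext => t; split=> [h|].
  apply: (h _ (addgrp_scl q (addgrp_Ord Q m))) => u v [i [j Eu]] [i' [j' Ev]].
  rewrite /scl; exists (i * i' * a + j * j' * c + i * j' * k + j * i' * (b - k)), (i * j' * e - j * i' * e).
  have -> : v = i'%:~R * w.1^* + j'%:~R * w.2^*.
    by rewrite -[v]conjCK Ev rmorphD !rmorphM /= !conj_zint.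
  rewrite Eu; apply: (mulfI q0'); rewrite mulVKf //.
  have -> : (i%:~R * w.1 + j%:~R * w.2) * (i'%:~R * w.1^* + j'%:~R * w.2^*) =
     i%:~R * i'%:~R * (w.1 * w.1^*) + j%:~R * j'%:~R * (w.2 * w.2^*)
     + i%:~R * j'%:~R * (w.1 * w.2^*) + j%:~R * i'%:~R * (w.1^* * w.2) by ring.
  by rewrite qa qc th Eth !(rmorphD, rmorphB, rmorphM) /=; ring.
rewrite /scl => -[i [j Et]].
have -> : t = i%:~R * q + j%:~R * (q * (m%:R * om)).
  by rewrite -[t](mulVKf q0') Et; ring.
have zw1 : zsp w w.1 by exists 1, 0; rewrite mul1r mul0r addr0.
have zw2 : zsp w w.2 by exists 0, 1; rewrite mul1r mul0r add0r.
have cw1 : cnj (zsp w) w.1^* by rewrite /cnj conjCK.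
have cw2 : cnj (zsp w) w.2^* by rewrite /cnj conjCK.
have sg := addgrp_mulL (zsp w) (cnj (zsp w)).
have hq1 : mulL (zsp w) (cnj (zsp w)) q.
  have -> : q = x%:~R * (w.1 * w.1^*) + y%:~R * (w.1 * w.2^* + w.2 * w.1^*) + z%:~R * (w.2 * w.2^*).
    rewrite [w.2 * w.1^*]mulrC qa qb qc.
    transitivity (q * (x * a + y * b + z * c)%:~R); first by rewrite E mulr1.
    by rewrite !(rmorphD, rmorphM) /=; ring.
  apply: (addgrpD sg); first apply: (addgrpD sg); apply: (addgrp_int_mul _ sg).
  - exact: mem_mulL.
  - by apply: (addgrpD sg); apply: mem_mulL.
  - exact: mem_mulL.
apply: (addgrpD sg); apply: (addgrp_int_mul _ sg) => //.
have -> : q * (m%:R * om) = e%:~R * (w.1 * w.2^* - k%:~R * q).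
  have E1 : e%:~R * e%:~R = 1 :> C by rewrite -rmorphM /= Ee.
  rewrite th rmorphM /=.
  by transitivity (e%:~R * e%:~R * (q * (m%:R * om))); [rewrite E1 mul1r|ring].
apply: (addgrp_int_mul _ sg); apply: (addgrpB sg); first exact: mem_mulL.
exact: (addgrp_int_mul _ sg).
Qed.

(** A multiplier [x] also stabilises [M conj(M) = q O_m], so [x q] lies in [q O_m]. Conversely
    [m om] acts on the basis by the integral matrix of [o1] and [o2]. *)
Lemma norm_form_lat w q a b c k e m : isbas w -> norm_form w q a b c k e m -> lat (zsp w) m.
Proof.
move=> bw nf; have [hq q0 qa qb qc _ m0 Ee th] := nf.
have q0' : q != 0 by rewrite gt_eqF.
split=> //; first exact: latt_zsp.
move=> x; split=> [h|].
  suff : scl q (Ord m) (x * q) by rewrite /scl mulrC mulfK.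
  rewrite -(norm_form_mulL nf).
  have : mulL (zsp w) (cnj (zsp w)) q.
    by rewrite (norm_form_mulL nf) /scl mulVf //; apply: Ord_1.
  move=> hh; apply: (hh _ (addgrp_colon x (addgrp_mulL _ _))) => u v hu hv.
  by rewrite mulrA; apply: mem_mulL => //; apply: h.
have Eth : w.1^* * w.2 = q * (b%:~R - (k%:~R + (e * m%:Z)%:~R * om)).
  by rewrite mulrBr -th -qb; ring.
have E1 : e%:~R * e%:~R = 1 :> C by rewrite -rmorphM /= Ee.
have o1 : m%:R * om * w.1 = e%:~R * ((b - k)%:~R * w.1 - a%:~R * w.2).
  apply: (mulfI q0').
  have -> : q * (e%:~R * ((b - k)%:~R * w.1 - a%:~R * w.2)) =
    e%:~R * ((q * b%:~R - q * k%:~R) * w.1 - (q * a%:~R) * w.2) by rewrite rmorphB /=; ring.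
  rewrite -qa -qb th rmorphM /=.
  have -> : (q * (k%:~R + e%:~R * m%:~R * om) + w.1^* * w.2 - q * k%:~R) * w.1 - w.1 * w.1^* * w.2
    = q * (e%:~R * m%:~R * om) * w.1 by ring.
  by transitivity (e%:~R * e%:~R * (q * (m%:R * om * w.1))); [rewrite E1 mul1r|ring].
have o2 : m%:R * om * w.2 = e%:~R * (c%:~R * w.1 - k%:~R * w.2).
  apply: (mulfI q0').
  have -> : q * (e%:~R * (c%:~R * w.1 - k%:~R * w.2)) =
    e%:~R * ((q * c%:~R) * w.1 - q * k%:~R * w.2) by ring.
  rewrite -qc; have -> : w.2 * w.2^* * w.1 = (w.1 * w.2^*) * w.2 by ring.
  rewrite th rmorphM /=.
  by transitivity (e%:~R * e%:~R * (q * (m%:R * om * w.2))); [rewrite E1 mul1r|ring].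
have sz := addgrp_zsp w.
have zw1 : zsp w w.1 by exists 1, 0; rewrite mul1r mul0r addr0.
have zw2 : zsp w w.2 by exists 0, 1; rewrite mul1r mul0r add0r.
move=> [i [j ->]] _ [i' [j' ->]].
have -> : (i%:~R + j%:~R * (m%:R * om)) * (i'%:~R * w.1 + j'%:~R * w.2) =
  i%:~R * (i'%:~R * w.1 + j'%:~R * w.2) + j%:~R * (i'%:~R * (m%:R * om * w.1) + j'%:~R * (m%:R * om * w.2)).
  by ring.
rewrite o1 o2.
apply: (addgrpD sz); apply: (addgrp_int_mul _ sz); apply: (addgrpD sz); do !apply: (addgrp_int_mul _ sz) => //.
  by apply: (addgrpB sz); apply: (addgrp_int_mul _ sz).
by apply: (addgrpB sz); apply: (addgrp_int_mul _ sz).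
Qed.

Lemma latt_lat M : latt M -> exists m, lat M m.
Proof.
case/latt_basis=> w bw ->; have [q [a [b [c [k [e [m nf]]]]]]] := norm_form_exists bw.
by exists m; apply: norm_form_lat nf.
Qed.

Lemma lat_norm_form M m : lat M m ->
  exists w q a b c k e, [/\ isbas w, M = zsp w & norm_form w q a b c k e m].
Proof.
move=> lM; have [w bw E] := latt_basis (lat_latt lM).
have [q [a [b [c [k [e [n nf]]]]]]] := norm_form_exists bw.
exists w, q, a, b, c, k, e; split=> //.
by rewrite (@lat_inj M m n) // E; apply: norm_form_lat nf.
Qed.

Lemma lat_Ord n : (0 < n)%N -> lat (Ord n) n.
Proof.
move=> n0; split=> //; first exact: latt_Ord.
move=> x; split=> [/(_ _ (Ord_1 Q n))|hx z]; first by rewrite mulr1.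
exact: Ord_mul.
Qed.

Lemma lat_cnj M m : lat M m -> lat (cnj M) m.
Proof.
move=> [lM m0 hM]; split=> //; first exact: latt_cnj.
move=> x; split=> [h|hx z Mz]; last first.
  by rewrite /cnj rmorphM /=; apply: (hM x^*).2 => //; apply: Ord_conj.
rewrite -[x]conjCK; apply: Ord_conj; apply/hM => z Mz.
by rewrite -[z]conjCK -rmorphM; apply: h; rewrite /cnj conjCK.
Qed.

Lemma lat_scl a M m : inQ a -> a != 0 -> lat M m -> lat (scl a M) m.
Proof.
move=> ha a0 [lM m0 hM]; split=> //; first exact: latt_scl.
move=> x; rewrite -hM /scl; split=> h z.
  by move=> Mz; have := h (a * z); rewrite mulKf // mulrCA mulKf //; apply.
by rewrite mulrCA; apply: h.
Qed.

Lemma lat_mul_Ord M m : lat M m -> mulL (Ord m) M = M.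
Proof.
move=> [[sM _] m0 hM]; apply: set_ext => z; split=> [h|Mz].
  by apply: h => // x y /hM; apply.
by rewrite -[z]mul1r; apply: mem_mulL => //; apply: Ord_1.
Qed.

Lemma lat_Ord_dvd M m n : lat M m -> (m %| n)%N -> mulL (Ord n) M = M.
Proof.
by move=> lM /gcdn_idPr E; rewrite -(lat_mul_Ord lM) mulLA mulL_Ord E.
Qed.

(** The inverse is [q^-1 conj(M)], by [norm_form_mulL]. *)
Lemma lat_inv M m : lat M m -> exists2 M', lat M' m & mulL M M' = Ord m.
Proof.
move=> lM; have [w [q [a [b [c [k [e [bw E nf]]]]]]]] := lat_norm_form lM.
have q0' : q != 0 by rewrite gt_eqF // (nf_q0 nf).
exists (scl q^-1 (cnj M)).
  by apply: lat_scl; [apply: inQ_inv; apply: nf_q nf|rewrite invr_eq0|apply: lat_cnj].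
by rewrite mulL_scl ?invr_eq0 // E (norm_form_mulL nf) sclK.
Qed.

(** Multiplication by the two inverses turns [A B] into [O_m O_n = O_gcd], so a multiplier of [A B]
    lies in [O_gcd]. *)
Lemma lat_mul A B m n : lat A m -> lat B n -> lat (mulL A B) (gcdn m n).
Proof.
move=> lA lB; have [A' lA' EA] := lat_inv lA; have [B' lB' EB] := lat_inv lB.
split; first by apply: latt_mulL; [apply: lat_latt lA|apply: lat_latt lB].
  by rewrite gcdn_gt0 (lat_gt0 lA).
move=> x; split=> [h|hx].
  have : mulL (mulL A B) (mulL A' B') 1.
    by rewrite -mulLA [mulL B _]mulLCA EB mulLA EA mulL_Ord; apply: Ord_1.
  move=> hh; rewrite -[x]mulr1 -mulL_Ord -EA -EB.
  have -> : mulL (mulL A A') (mulL B B') = mulL (mulL A B) (mulL A' B').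
    by rewrite -!mulLA [mulL A' _]mulLCA.
  apply: (hh _ (addgrp_colon x (addgrp_mulL _ _))) => u v hu hv.
  by rewrite mulrA; apply: mem_mulL => //; apply: h.
have -> : mulL A B = mulL (Ord (gcdn m n)) (mulL A B).
  by rewrite -mulL_Ord -mulLA [mulL (Ord n) _]mulLCA (lat_mul_Ord lB) mulLA (lat_mul_Ord lA).
move=> z hz; apply: (hz _ (addgrp_colon x (addgrp_mulL _ _))) => u v hu hv.
by rewrite mulrA; apply: mem_mulL => //; apply: Ord_mul.
Qed.

Lemma lat_mul_Ordr A m n : lat A m -> (0 < n)%N -> lat (mulL A (Ord n)) (gcdn m n).
Proof. by move=> lA n0; apply: lat_mul => //; apply: lat_Ord. Qed.

(** The conductor of [O_m] in [O_g] is [(m / g) O_g]: testing [x] against 1 makes its [om]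
    coefficient divisible by [m], and testing against [g om] then makes its rational part divisible
    by [m / g]. *)
Lemma Ord_colon m g x : (g %| m)%N -> (0 < g)%N ->
  (forall y, Ord g y -> Ord m (x * y)) -> scl (m %/ g)%:R (Ord g) x.
Proof.
move=> /dvdnP[t ->] g0 h; rewrite mulnK //.
have /OrdP[i [j [Ex mj]]] : Ord (t * g) x by rewrite -[x]mulr1; apply: h; apply: Ord_1.
have := h _ (Ord_om Q g); rewrite Ex.
have -> : (i%:~R + j%:~R * om) * (g%:R * om) =
  (- (j * g%:Z * nm))%:~R + (i * g%:Z + j * g%:Z * tr)%:~R * om.
  rewrite !(rmorphN, rmorphD, rmorphM) /=.
  have -> : (i%:~R + j%:~R * om) * (g%:R * om) = i%:~R * g%:R * om + j%:~R * g%:R * (om * om) by ring.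
  by rewrite om_sqr; ring.
case/Ord_coef/dvdzP=> X EX; case/dvdzP: mj => j' Ej.
have [i' Ei] : exists i' : int, i = i' * t%:Z.
  exists (X - j' * g%:Z * tr).
  have g0' : g%:Z != 0 by case: g g0 {h EX Ej}.
  apply: (mulIf g0'); apply: (addIr (j * g%:Z * tr)); rewrite EX Ej PoszM; ring.
(* The case [m = 0] is allowed: the inverse of 0 is 0 by convention, and the claim becomes
   membership of 0. *)
rewrite /scl Ei Ej; have [t0|t0] := posnP t.
  by rewrite t0 mul0n !mulr0 mul0r addr0 mulr0; apply: addgrp0; apply: addgrp_Ord.
exists i', j'; rewrite PoszM !rmorphM /=.
by have tC := natr_neq0 C t0; field.
Qed.

End Conductors.

(** The values at [(1, 0)], [(0, 1)] and [(1, 1)] are [a], [c] and [a + b + c]; a prime dividing all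
    three would divide the content. *)
Lemma prim_form_coprime (a b c : int) (n : nat) : (0 < n)%N ->
  (exists x y z : int, x * a + y * b + z * c = 1) ->
  exists X Y : int, coprime `|a * X ^+ 2 + b * X * Y + c * Y ^+ 2| n /\
    a * X ^+ 2 + b * X * Y + c * Y ^+ 2 != 0.
Proof.
move=> n0 [x [y [z E]]]; pose F (v : int * int) := a * v.1 ^+ 2 + b * v.1 * v.2 + c * v.2 ^+ 2.
(* The extra prime 2 makes the list of primes nonempty, so the value found is nonzero even when
   [n = 1]. *)
have n20 : (0 < 2 * n)%N by rewrite muln_gt0.
have [] := @crt_primes (int * int)%type (fun _ => True) (fun p v => ~~ (p %| F v)%Z) (primes (2 * n)).
- by [].
- by apply/allP => p; rewrite mem_primes => /andP[].
- exact: primes_uniq.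
- move=> p; rewrite mem_primes => /andP[pp _].
  case: (boolP (p %| a)%Z) => pa; last by exists (1, 0) => //; rewrite (_ : F _ = a) //; rewrite /F /=; ring.
  case: (boolP (p %| c)%Z) => pc; last by exists (0, 1) => //; rewrite (_ : F _ = c) //; rewrite /F /=; ring.
  exists (1, 1) => //; rewrite /F /= expr1n !mulr1.
  apply/negP => h; have pb : (p %| b)%Z.
    have -> : b = (a + b + c) - a - c by ring.
    by rewrite !rpredB.
  have : (p %| (x * a + y * b + z * c)%R)%Z by rewrite !rpredD // dvdz_mull.
  by rewrite E dvdzE /= dvdn1 => /eqP p1; rewrite p1 in pp.
- move=> p v u _ h _; apply: contra h => h.
  have -> : F v = F (v + u *+ p) - p%:Z *
     (a * (v.1 * u.1 *+ 2 + p%:Z * u.1 ^+ 2) + b * (v.1 * u.2 + u.1 * v.2 + p%:Z * u.1 * u.2)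
      + c * (v.2 * u.2 *+ 2 + p%:Z * u.2 ^+ 2)).
    have E1 k : (u *+ k).1 = k%:Z * u.1.
      by elim: k => [|k IH]; rewrite ?mulr0n ?mul0r // mulrS /= IH intS; ring.
    have E2 k : (u *+ k).2 = k%:Z * u.2.
      by elim: k => [|k IH]; rewrite ?mulr0n ?mul0r // mulrS /= IH intS; ring.
    by rewrite /F /= E1 E2; ring.
  by rewrite rpredB // dvdz_mulr.
move=> [X Y] _ h; exists X, Y; split; last first.
  by apply/eqP => E0; have := h 2%N; rewrite mem_primes n20 dvdn_mulr // /F /= E0 dvdz0 => /(_ isT).
rewrite coprime_sym /coprime; apply/negPn/negP => g1.
have g0 : (0 < gcdn n `|F (X, Y)|)%N by rewrite gcdn_gt0 n0.
have pp : prime (pdiv (gcdn n `|F (X, Y)|)) by apply: pdiv_prime; rewrite ltn_neqAle eq_sym g1.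
have pd := pdiv_dvd (gcdn n `|F (X, Y)|).
have := h (pdiv (gcdn n `|F (X, Y)|)); rewrite mem_primes pp n20 /=.
rewrite (dvdn_mull 2 (dvdn_trans pd (dvdn_gcdl _ _))) dvdzE /=.
by rewrite (dvdn_trans pd (dvdn_gcdr _ _)) => /(_ isT).
Qed.

(** * Change of conductor: restriction, extension and gluing of lattices *)

Section LatticeArithmetic.
Variables (C : numClosedFieldType) (Q : quad C).
Local Notation om := (qgen Q).
Local Notation inQ := (ratspan om).
Local Notation Ord := (order_of om).
Local Notation latt := (latt Q).
Local Notation lat := (lat Q).
Local Notation norm_form := (norm_form Q).
Implicit Types (A B D M : C -> Prop) (w : C * C) (x y z : C).

Lemma coprime_mem M (n n' : nat) z : addgrp M -> coprime n n' -> (0 < n)%N ->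
  M (n%:R * z) -> M (n'%:R * z) -> M z.
Proof.
move=> sM c n0 Mn Mn'; have [u v E _] := egcdnP n' n0.
have -> : z = u%:R * (n%:R * z) - v%:R * (n'%:R * z).
  rewrite !mulrA -!natrM E (eqP c) natrD mulrDl mul1r; ring.
by apply: addgrpB => //; apply: addgrp_nat_mul.
Qed.

(** Since [n = x conj(x) / q], the element in question is [z conj(x) / q], which lies in
    [q^-1 M conj(M) = O_m]. *)
Lemma norm_form_div w q a b c k e m x (n : int) : norm_form w q a b c k e m ->
  zsp w x -> x * x^* = q * n%:~R -> forall z, zsp w z -> Ord m (n%:~R * (z / x)).
Proof.
move=> nf wx En z wz; have q0' : q != 0 by rewrite gt_eqF // (nf_q0 nf).
have [->|x0] := eqVneq x 0.
  by rewrite invr0 !mulr0; apply: addgrp0; apply: addgrp_Ord.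
have xc0 : x^* != 0 by rewrite conjC_eq0.
have : scl q (Ord m) (z * x^*).
  by rewrite -(norm_form_mulL nf); apply: mem_mulL => //; rewrite /cnj conjCK.
rewrite /scl; congr (Ord m _).
have -> : n%:~R = x * x^* / q by rewrite En mulrC mulKf.
by field; rewrite x0 q0'.
Qed.

(** Lattices are locally principal: the norm form takes a value prime to [n] at some [x], and then
    [x O_m] has index prime to [n] in [M]. *)
Lemma lat_coprime_elt M m (n : nat) : lat M m -> (0 < n)%N ->
  exists x (n' : nat), [/\ M x, x != 0, coprime n' n, (0 < n')%N &
    forall z, M z -> Ord m (n'%:R * (z / x))].
Proof.
move=> lM n0; have [w [q [a [b [c [k [e [bw -> nf]]]]]]]] := lat_norm_form lM.
have [X [Y [cop F0]]] := prim_form_coprime n0 (nf_prim nf).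
set F := a * X ^+ 2 + _ + _ in cop F0.
pose x := X%:~R * w.1 + Y%:~R * w.2.
have wx : zsp w x by exists X, Y.
have Ex : x * x^* = q * F%:~R.
  rewrite /x rmorphD !rmorphM /= !conj_zint.
  have -> : (X%:~R * w.1 + Y%:~R * w.2) * (X%:~R * w.1^* + Y%:~R * w.2^*) =
    X%:~R ^+ 2 * (w.1 * w.1^*) + X%:~R * Y%:~R * (w.1 * w.2^* + w.1^* * w.2)
    + Y%:~R ^+ 2 * (w.2 * w.2^*) by ring.
  by rewrite (nf_a nf) (nf_b nf) (nf_c nf) /F !(rmorphD, rmorphM, rmorphXn) /=; ring.
have x0 : x != 0.
  by rewrite -mul_conjC_eq0 Ex mulf_neq0 ?intr_eq0 // gt_eqF // (nf_q0 nf).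
exists x, `|F|%N; split=> //; first by rewrite absz_gt0.
move=> z wz.
have -> : (`|F|%N)%:R = (sgz F)%:~R * F%:~R :> C.
  by rewrite -[RHS](rmorphM (intr : int -> C)) /= -abszEsg.
rewrite -mulrA; apply: (addgrp_int_mul _ (addgrp_Ord _ _)).
exact: norm_form_div nf wx Ex _ wz.
Qed.

Lemma Ord_nat_om m (n : nat) : Ord m (n%:R * om) <-> (m %| n)%N.
Proof.
have -> : n%:R * om = (0 : int)%:~R + (n%:Z)%:~R * om by rewrite add0r.
by rewrite Ord_coef.
Qed.

Lemma lat_dvd M m (n : nat) : lat M m -> (forall z, M z -> M (n%:R * om * z)) -> (m %| n)%N.
Proof. by move=> [_ _ hM] /hM/Ord_nat_om. Qed.

Lemma lat_om M m z : lat M m -> M z -> M (m%:R * om * z).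
Proof. by move=> [_ _ hM]; apply: (hM _).2; apply: Ord_om. Qed.

Lemma lat_stable M m x z : lat M m -> Ord m x -> M z -> M (x * z).
Proof. by move=> [_ _ hM] /hM; apply. Qed.

(** Choose [x] with [x O_g] of index prime to [m] in [I], the quotient being killed by [n], and
    intersect [I] with [(x / n) O_m]. At primes dividing [m] this is [x O_m]; at the others [O_m]
    and [O_g] agree and nothing is lost. *)
Lemma lat_lift I g m : lat I g -> (g %| m)%N -> (0 < m)%N ->
  exists2 I0, lat I0 m & mulL I0 (Ord g) = I.
Proof.
move=> lI gm m0; have [x [n [Ix x0 cop n0 hn]]] := lat_coprime_elt lI m0.
have g0 := lat_gt0 lI; have sI := lat_addgrp lI; have nC := natr_neq0 C n0.
have sOm := addgrp_Ord Q m.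
pose I0 z := I z /\ Ord m (n%:R * (z / x)).
have hx : inQ x by apply: latt_inQ (lat_latt lI) Ix.
have E0 : I0 = (fun z => I z /\ scl (x / n%:R) (Ord m) z).
  by apply: set_ext => z; rewrite /I0 /scl invfM invrK [x^-1 * _]mulrC -mulrA [x^-1 * _]mulrC.
have lI0 : latt I0.
  rewrite E0; apply: latt_cap; first exact: lat_latt lI.
  apply: latt_scl; last exact: latt_Ord.
    by apply: inQ_div => //; apply: inQ_nat.
  by rewrite mulf_neq0 // invr_eq0.
have sI0 := latt_addgrp lI0.
have I0x : I0 x by split=> //; rewrite divff // mulr1; apply: (Ord_int Q m n).
have I0m z : I z -> I0 ((m %/ g)%:R * z).
  move=> Iz; split; first exact: addgrp_nat_mul.
  have /OrdP[i [j [E gj]]] := hn z Iz.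
  have -> : n%:R * ((m %/ g)%:R * z / x) = (m %/ g)%:R * (n%:R * (z / x)) by ring.
  rewrite E; have -> : (m %/ g)%:R * (i%:~R + j%:~R * om) =
    ((m %/ g)%:Z * i)%:~R + ((m %/ g)%:Z * j)%:~R * om by rewrite !rmorphM /=; ring.
  apply/Ord_coef; case/dvdzP: gj => j' ->.
  by rewrite mulrCA -PoszM divnK // dvdz_mull.
have E1 : mulL I0 (Ord g) = I.
  apply: set_ext => z; split=> [h|Iz].
    by apply: h => // u v [Iu _] gv; rewrite mulrC; apply: lat_stable lI gv Iu.
  have cop' : coprime n (m %/ g).
    by move: cop; rewrite -{1}(divnK gm) coprimeMr => /andP[].
  have sg := addgrp_mulL I0 (Ord g).
  apply: (coprime_mem sg cop' n0).
    have -> : n%:R * z = x * (n%:R * (z / x)) by field.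
    by apply: mem_mulL => //; apply: hn.
  by rewrite -[X in mulL _ _ X]mulr1; apply: mem_mulL; [apply: I0m|apply: Ord_1].
exists I0 => //; have [c lc] := latt_lat lI0.
suff -> : m = c by [].
apply/eqP; rewrite eqn_dvd; apply/andP; split; last first.
  apply: (lat_dvd lc) => z [Iz Oz]; split.
    by apply: (lat_stable lI) => //; apply: (OrdS gm); apply: Ord_om.
  have -> : n%:R * (m%:R * om * z / x) = (m%:R * om) * (n%:R * (z / x)) by ring.
  by apply: Ord_mul => //; apply: Ord_om.
have := lat_om lc I0x => -[_]; rewrite mulfK //.
rewrite mulrA -natrM => /Ord_nat_om; rewrite Gauss_dvdr //.
by rewrite coprime_sym.
Qed.

Lemma latt_capC A B : (fun z => A z /\ B z) = (fun z : C => B z /\ A z).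
Proof. by apply: set_ext => z; split=> -[]. Qed.

(** With [g] the gcd, [(k / g) O_g] lies in [O_k] for [k = m, n]. Hence [(n / g) A] lies in the
    intersection. Likewise [(m / g) B] does, and as [A] lies in [B O_g = B O_m], this puts
    [(m / g) A] in the extended intersection. The two factors are coprime. *)
Lemma glue_mul A B m n : lat A m -> lat B n ->
  mulL A (Ord (gcdn m n)) = mulL B (Ord (gcdn m n)) ->
  mulL (fun z => A z /\ B z) (Ord m) = A.
Proof.
move=> lA lB E; have sA := lat_addgrp lA; have sB := lat_addgrp lB.
have m0 := lat_gt0 lA; have n0 := lat_gt0 lB.
set g := gcdn m n in E; have g0 : (0 < g)%N by rewrite gcdn_gt0 m0.
have aux M k z : lat M k -> (g %| k)%N -> mulL M (Ord g) z -> M ((k %/ g)%:R * z).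
  move=> lM gk h; apply: (h _ (addgrp_colon _ (lat_addgrp lM))) => u v Mu.
  case/OrdP=> i [j [-> /dvdzP[j' ->]]].
  rewrite mulrCA; rewrite mulrC; apply: (lat_stable lM) => //.
  have -> : (k %/ g)%:R * (i%:~R + (j' * g%:Z)%:~R * om) =
    ((k %/ g)%:Z * i)%:~R + (j' * k%:Z)%:~R * om.
    have -> : j' * k%:Z = j' * ((k %/ g)%:Z * g%:Z) by rewrite -PoszM divnK.
    by rewrite !rmorphM /=; ring.
  by apply/Ord_coef; rewrite dvdz_mull.
have gm : (g %| m)%N := dvdn_gcdl m n; have gn : (g %| n)%N := dvdn_gcdr m n.
have inA z : A z -> mulL A (Ord g) z.
  by move=> Az; rewrite -[z]mulr1; apply: mem_mulL => //; apply: Ord_1.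
have inB z : B z -> mulL B (Ord g) z.
  by move=> Az; rewrite -[z]mulr1; apply: mem_mulL => //; apply: Ord_1.
have cop : coprime (m %/ g) (n %/ g).
  rewrite /coprime -(eqn_pmul2r g0) muln_gcdl !divnK //; by rewrite mul1n.
have mg0 : (0 < m %/ g)%N by rewrite divn_gt0 // dvdn_leq.
apply: set_ext => z; split=> [h|Az].
  by apply: h => // u v [Au _] mv; rewrite mulrC; apply: lat_stable lA mv Au.
have sg := addgrp_mulL (fun z => A z /\ B z) (Ord m).
apply: (coprime_mem sg cop mg0); last first.
  rewrite -[X in mulL _ _ X]mulr1; apply: mem_mulL; last exact: Ord_1.
  split; first exact: addgrp_nat_mul.
  by apply: (aux B n) => //; rewrite -E; apply: inA.
have EB : mulL B (Ord g) = mulL B (Ord m).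
  by rewrite -[in RHS](lat_mul_Ord lB) mulLAC mulL_Ord gcdnC mulLC.
have : mulL B (Ord m) z by rewrite -EB -E; apply: inA.
move=> h; apply: (h _ (addgrp_colon _ sg)) => u v Bu mv.
rewrite mulrA; apply: mem_mulL => //; split; last exact: addgrp_nat_mul.
by apply: (aux A m) => //; rewrite E; apply: inB.
Qed.

(** A fibre square: [M |-> (M O_m, M O_n)] identifies the lattices of conductor [lcmn m n] with the
    pairs having the same extension to [O_gcd]. Intersection is the inverse; [unglue] is the other
    composite. *)
Lemma glue_lat A B m n : lat A m -> lat B n ->
  mulL A (Ord (gcdn m n)) = mulL B (Ord (gcdn m n)) ->
  [/\ lat (fun z => A z /\ B z) (lcmn m n),
      mulL (fun z => A z /\ B z) (Ord m) = A & mulL (fun z => A z /\ B z) (Ord n) = B].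
Proof.
move=> lA lB E; have EA := glue_mul lA lB E.
have EB : mulL (fun z => A z /\ B z) (Ord n) = B.
  by rewrite latt_capC; apply: (glue_mul lB lA); rewrite gcdnC.
split=> //; have m0 := lat_gt0 lA; have n0 := lat_gt0 lB.
have [c lc] := latt_lat (latt_cap (lat_latt lA) (lat_latt lB)).
suff -> : lcmn m n = c by [].
apply/eqP; rewrite eqn_dvd dvdn_lcm; apply/andP; split; last first.
  apply: (lat_dvd lc) => z [Az Bz].
  by split; [apply: (lat_stable lA) => //; apply: (OrdS (dvdn_lcml m n))
           | apply: (lat_stable lB) => //; apply: (OrdS (dvdn_lcmr m n))]; apply: Ord_om.
have := lat_mul_Ordr lc m0; rewrite EA => /(lat_inj lA) ->.
have := lat_mul_Ordr lc n0; rewrite EB => /(lat_inj lB) {1}->.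
by rewrite !dvdn_gcdl.
Qed.

Lemma unglue M m n : (0 < m)%N -> (0 < n)%N -> lat M (lcmn m n) ->
  (fun z => mulL M (Ord m) z /\ mulL M (Ord n) z) = M.
Proof.
move=> m0 n0 lM; have [M' lM' E] := lat_inv lM.
apply: set_ext => z; split=> [[h1 h2]|Mz]; last first.
  by split; rewrite -[z]mulr1; apply: mem_mulL => //; apply: Ord_1.
have h y : M' y -> Ord (lcmn m n) (z * y).
  move=> My; apply: Ord_cap.
    have <- : mulL (mulL M (Ord m)) M' = Ord m.
      by rewrite mulLAC E mulL_Ord gcdnC (gcdn_idPl (dvdn_lcml m n)).
    exact: mem_mulL.
  have <- : mulL (mulL M (Ord n)) M' = Ord n.
    by rewrite mulLAC E mulL_Ord gcdnC (gcdn_idPl (dvdn_lcmr m n)).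
  exact: mem_mulL.
have : mulL M M' 1 by rewrite E; apply: Ord_1.
rewrite mulLC => hh; rewrite -[z]mulr1.
apply: (hh _ (addgrp_colon _ (lat_addgrp lM))) => u v M'u Mv.
by rewrite mulrA; apply: lat_stable lM (h _ M'u) Mv.
Qed.

End LatticeArithmetic.

(** * Cyclic quotients *)

Section CyclicQuotients.
Variables (C : numClosedFieldType) (Q : quad C).
Local Notation om := (qgen Q).
Local Notation tr := (qtr Q).
Local Notation nm := (qnm Q).
Local Notation inQ := (ratspan om).
Local Notation Ord := (order_of om).
Local Notation latt := (latt Q).
Implicit Types (A B D M I : C -> Prop) (w : C * C) (x y z : C).

Lemma Ord_tr_nm z : Ord 1 z ->
  (exists t : int, z + z^* = t%:~R) /\ (exists n : int, z * z^* = n%:~R).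
Proof.
case/Ord1P=> i [j ->]; rewrite rmorphD rmorphM /= !conj_zint; split.
  exists (i *+ 2 + j * tr); rewrite rmorphD rmorphM rmorphMn /= -qgen_tr; ring.
exists (i ^+ 2 + i * j * tr + j ^+ 2 * nm).
by rewrite !(rmorphD, rmorphM, rmorphXn) /= -qgen_tr -qgen_nm; ring.
Qed.

(** The hypothesis on roots of unity enters here. Both [x] and its inverse are integral, so [x] has
    norm 1 and is a root of unity. *)
Lemma scl_unit D x :
  (forall z, inQ z -> forall n : nat, (0 < n)%N -> z ^+ n = 1 -> z = 1 \/ z = -1) ->
  latt D -> x != 0 -> scl x D = D -> x = 1 \/ x = -1.
Proof.
move=> roots lD x0 E; have hx : inQ x := latt_scl_inQ lD lD x0 (esym E).
have [m lm] := latt_lat lD; have [_ _ hD] := lm.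
have Ox : Ord 1 x.
  by apply: (OrdS (dvd1n m)); apply/hD => z Dz; rewrite -E; apply: mem_scl.
have Oxv : Ord 1 x^-1.
  apply: (OrdS (dvd1n m)); apply/hD => z Dz.
  by rewrite -(sclK D x0) E; apply: mem_scl; rewrite // invr_eq0.
have [[t Et] [n En]] := Ord_tr_nm Ox; have [_ [n' En']] := Ord_tr_nm Oxv.
have npos : 0 < n by rewrite -(ltr0z C) -En mul_conjC_gt0.
have nn' : n * n' = 1.
  apply: (@intr_inj C); rewrite rmorphM /= -En -En' fmorphV mulrACA divff // divff ?mulr1 //.
  by rewrite conjC_eq0.
have n1 : n = 1.
  have /eqP := congr1 absz nn'; rewrite abszM muln_eq1 => /andP[/eqP n1 _].
  by rewrite -(gtz0_abs npos) n1.
rewrite n1 in En.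
have xc : x^* = t%:~R - x by rewrite -Et; ring.
have x2 : x * x = t%:~R * x - 1 by transitivity (t%:~R * x - x * x^*); [rewrite xc; ring|rewrite En].
(* [4 - t^2] is the norm of [x - conj(x)]. *)
have t4 : t * t <= 4.
  rewrite -(ler_int C) rmorphM /= -subr_ge0.
  have -> : 4%:~R - t%:~R * t%:~R = (x - x^*) * (x - x^*)^*.
    rewrite rmorphB /= conjCK -Et.
    transitivity (4%:~R * (x * x^*) - (x + x^*) * (x + x^*)); last by ring.
    by rewrite En mulr1.
  exact: mul_conjC_ge0.
(* Traces 0, 1 and -1 belong to roots of unity of orders 4, 6 and 3, and 12 is a common exponent;
   traces 2 and -2 give [(x - 1)^2 = 0] and [(x + 1)^2 = 0]. *)
have root12 : x ^+ 12 = 1 -> x = 1 \/ x = -1 by apply: roots.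
have x3 : x ^+ 12 = (x * x * (x * x) * (x * x)) ^+ 2 by ring.
have [t0|[t1|[t1|[t2|t2]]]] : t = 0 \/ t = 1 \/ t = -1 \/ t = 2 \/ t = -2 by nia.
- by apply: root12; rewrite x3 x2 t0; ring.
- apply: root12; rewrite x3 x2 t1.
  have -> : (1%:~R * x - 1) * (1%:~R * x - 1) * (1%:~R * x - 1) = x * (x * x) - 3 * (x * x) + 3 * x - 1 by ring.
  rewrite x2 t1.
  have -> : x * (1%:~R * x - 1) - 3 * (1%:~R * x - 1) + 3 * x - 1 = x * x - x + 2 by ring.
  by rewrite x2 t1; ring.
- apply: root12; rewrite x3 x2 t1.
  have -> : ((-1)%:~R * x - 1) * ((-1)%:~R * x - 1) * ((-1)%:~R * x - 1) = - (x * (x * x) + 3 * (x * x) + 3 * x + 1).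
    by rewrite rmorphN /=; ring.
  rewrite x2 t1.
  have -> : - (x * ((-1)%:~R * x - 1) + 3 * ((-1)%:~R * x - 1) + 3 * x + 1) = x * x + x + 2.
    by rewrite rmorphN /=; ring.
  by rewrite x2 t1 rmorphN /=; ring.
- left; apply/eqP; rewrite -subr_eq0 -sqrf_eq0.
  have -> : (x - 1) ^+ 2 = x * x - 2 * x + 1 by ring.
  by rewrite x2 t2; apply/eqP; ring.
- right; apply/eqP; rewrite -subr_eq0 -sqrf_eq0.
  have -> : (x - - 1) ^+ 2 = x * x + 2 * x + 1 by ring.
  by rewrite x2 t2 rmorphN /=; apply/eqP; ring.
Qed.

(** The order of [v] modulo [I], stated through its annihilator in [Z]; infinite order would be
    [N = 0]. *)
Definition ordmod I v (N : nat) : Prop := forall k : int, I (k%:~R * v) <-> (N%:Z %| k)%Z.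

Lemma latt_ordmod I v : latt I -> inQ v -> exists2 N : nat, (0 < N)%N & ordmod I v N.
Proof.
move=> [sI [n [n0 nI In]]] /inQ_Ord[m m0 hv].
have [N hN] : exists N : nat, ordmod I v N.
  apply: addgrp_int; split; first by rewrite mul0r; apply: addgrp0.
  by move=> i j hi hj; rewrite rmorphB mulrBl; apply: addgrpB.
exists N => //; rewrite lt0n; apply/eqP => N0.
have : I ((n * m)%:Z%:~R * v).
  by have := nI _ hv; rewrite mulrA -natrM.
by move/hN; rewrite N0 dvd0z; move: n0 m0; rewrite !lt0n; lia.
Qed.

Lemma ordmod_inQ I v N : latt I -> (0 < N)%N -> ordmod I v N -> inQ v.
Proof.
move=> lI N0 /(_ N)[_ h].
have := latt_inQ lI (h (dvdzz _)); apply: inQ_frac; lia.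
Qed.

Lemma ordmod_addZ_eq I v v' N : addgrp I -> ordmod I v N -> I (v' - v) ->
  ordmod I v' N /\ addZ I v' = addZ I v.
Proof.
move=> sI hN hv; split=> [k|].
  rewrite -hN; have hk := addgrp_int_mul k sI hv; rewrite mulrBr in hk; split=> h.
    by have := addgrpB sI h hk; rewrite opprB addrCA subrr addr0.
  by have := addgrpD sI hk h; rewrite subrK.
apply: set_ext => z; split=> -[x [k [Ix ->]]]; have hk := addgrp_int_mul k sI hv.
  exists (x + k%:~R * (v' - v)), k; split; [exact: addgrpD|ring].
exists (x - k%:~R * (v' - v)), k; split; [exact: addgrpB|ring].
Qed.

Lemma addZ_self I z : I z -> forall v, addZ I v z.
Proof. by move=> Iz v; exists z, 0; rewrite mul0r addr0. Qed.

Lemma addZ_gen I v : addgrp I -> addZ I v v.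
Proof. by move=> sI; exists 0, 1; rewrite mul1r add0r; split=> //; apply: addgrp0. Qed.

(* Subgroups with cyclic quotient of order N and supergroups with cyclic quotient of
   order N are exchanged by I |-> N^-1 I. *)
Lemma dual_cyclic D I v N : latt D -> addgrp I -> (0 < N)%N -> D = addZ I v -> ordmod I v N ->
  exists2 be, scl N%:R^-1 I = addZ D be & ordmod D be N.
Proof.
move=> lD sI N0 ED hN; have NC := natr_neq0 C N0.
have [w [h1 h2 d0] EDw] := latt_basis lD; have sD := latt_addgrp lD.
have [i1 [s [Ii1 E1]]] : addZ I v w.1.
  by rewrite -ED EDw; exists 1, 0; rewrite mul1r mul0r addr0.
have [i2 [t [Ii2 E2]]] : addZ I v w.2.
  by rewrite -ED EDw; exists 0, 1; rewrite mul1r mul0r add0r.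
have [p [q Ev]] : zsp w v by rewrite -EDw ED; apply: addZ_gen.
(* Modulo [I] the basis vectors are [s v] and [t v], while [v = p w.1 + q w.2]; so [p s + q t] is 1
   modulo [N]. *)
have /hN/dvdzP[c Ec] : I ((1 - (p * s + q * t))%:~R * v).
  have -> : (1 - (p * s + q * t))%:~R * v = p%:~R * i1 + q%:~R * i2.
    rewrite !(rmorphB, rmorphD, rmorphM) /=.
    have -> : i1 = w.1 - s%:~R * v by rewrite E1; ring.
    have -> : i2 = w.2 - t%:~R * v by rewrite E2; ring.
    transitivity (v - (p%:~R * s%:~R + q%:~R * t%:~R) * v); first by ring.
    by rewrite {1}Ev; ring.
  by apply: (addgrpD sI); apply: addgrp_int_mul.
have Eu : 1 = p * s + q * t + c * N%:Z by rewrite -Ec; ring.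
(* The obvious relation between [s v] and [t v]. Together with [N D] it generates [I], so [z / N]
   generates the dual quotient. *)
pose z := t%:~R * w.1 - s%:~R * w.2.
have Iz : I z.
  have -> : z = t%:~R * i1 - s%:~R * i2 by rewrite /z E1 E2; ring.
  by apply: (addgrpB sI); apply: addgrp_int_mul.
have Dz : D z by rewrite EDw; exists t, (- s); rewrite /z rmorphN /=; ring.
have ND y : D y -> I (N%:R * y).
  rewrite ED => -[x [k [Ix ->]]].
  have -> : N%:R * (x + k%:~R * v) = N%:R * x + k%:~R * (N%:Z%:~R * v) by ring.
  apply: (addgrpD sI); first exact: addgrp_nat_mul.
  by apply: addgrp_int_mul => //; apply/hN; apply: dvdzz.
exists (z / N%:R).
  apply: set_ext => y; rewrite /scl invrK; split=> [Iy|[x [k [Dx ->]]]]; last first.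
    have -> : N%:R * (x + k%:~R * (z / N%:R)) = N%:R * x + k%:~R * z by field.
    by apply: (addgrpD sI); [apply: ND|apply: addgrp_int_mul].
  have [x1 [x2 Ex]] : zsp w (N%:R * y) by rewrite -EDw ED; apply: addZ_self.
  have /hN/dvdzP[r Er] : I ((x1 * s + x2 * t)%:~R * v).
    have -> : (x1 * s + x2 * t)%:~R * v = N%:R * y - (x1%:~R * i1 + x2%:~R * i2).
      by rewrite Ex E1 E2 !(rmorphD, rmorphM) /=; ring.
    by apply: (addgrpB sI) => //; apply: (addgrpD sI); apply: addgrp_int_mul.
  (* As [x1 s + x2 t] is 0 and [p s + q t] is 1 modulo [N], the vector [(x1, x2)] is [k (t, -s)]
     modulo [N]. *)
  pose k := x1 * q - x2 * p.
  have e1 : x1 = k * t + N%:Z * (p * r + c * x1).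
    transitivity (k * t + (p * (r * N%:Z) + c * N%:Z * x1)); last by ring.
    rewrite -Er; have -> : c * N%:Z = 1 - (p * s + q * t) by rewrite {1}Eu; ring.
    by rewrite /k; ring.
  have e2 : x2 = - k * s + N%:Z * (q * r + c * x2).
    transitivity (- k * s + (q * (r * N%:Z) + c * N%:Z * x2)); last by ring.
    rewrite -Er; have -> : c * N%:Z = 1 - (p * s + q * t) by rewrite {1}Eu; ring.
    by rewrite /k; ring.
  exists ((p * r + c * x1)%:~R * w.1 + (q * r + c * x2)%:~R * w.2), k; split.
    by rewrite EDw; exists (p * r + c * x1), (q * r + c * x2).
  apply: (mulfI NC); rewrite Ex {1}e1 {1}e2 /z.
  set X := p * r + _; set Y := q * r + _.
  by rewrite !(rmorphD, rmorphM, rmorphN) /=; field.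
move=> k; split=> [|/dvdzP[k' ->]]; last first.
  have -> : (k' * N%:Z)%:~R * (z / N%:R) = k'%:~R * z by rewrite rmorphM /=; field.
  exact: addgrp_int_mul.
rewrite EDw => -[d1 [d2 Ed]].
have Ed' : k%:~R * z = N%:R * (d1%:~R * w.1 + d2%:~R * w.2) by rewrite -Ed; field.
have [f1 f2] : k * t - N%:Z * d1 = 0 /\ - k * s - N%:Z * d2 = 0.
  apply: (zsp_free d0); rewrite !(rmorphB, rmorphM, rmorphN) /=.
  transitivity (k%:~R * z - N%:R * (d1%:~R * w.1 + d2%:~R * w.2)); first by rewrite /z; ring.
  by rewrite Ed' subrr.
apply/dvdzP; exists (- p * d2 + q * d1 + k * c).
transitivity (k * (p * s + q * t + c * N%:Z)); first by rewrite -Eu mulr1.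
have g1 : k * t = N%:Z * d1 by rewrite -[LHS]subr0 -f1; ring.
have g2 : k * s = - (N%:Z * d2) by rewrite -[RHS]subr0 -f2; ring.
transitivity (p * (k * s) + q * (k * t) + k * c * N%:Z); first by ring.
by rewrite g1 g2; ring.
Qed.

Lemma dual_cyclicV D S be N : latt D -> addgrp D -> latt S -> (0 < N)%N -> S = addZ D be ->
  ordmod D be N ->
  exists2 v, D = addZ (scl N%:R S) v & ordmod (scl N%:R S) v N.
Proof.
move=> lD sD lS N0 ES hN; have NC := natr_neq0 C N0.
have [ga E h] := dual_cyclic lS sD N0 ES hN.
exists (N%:R * ga).
  by rewrite -(sclVK D NC) E addZ_scl.
move=> k; rewrite -h /scl.
by have -> : N%:R^-1 * (k%:~R * (N%:R * ga)) = k%:~R * ga by field.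
Qed.

End CyclicQuotients.

Section SuperLattices.
Variables (C : numClosedFieldType) (Q : quad C).
Local Notation om := (qgen Q).
Local Notation tr := (qtr Q).
Local Notation nm := (qnm Q).
Local Notation Ord := (order_of om).
Local Notation isbas := (isbas Q).
Local Notation latt := (latt Q).
Local Notation lat := (lat Q).
Local Notation norm_form := (norm_form Q).
Implicit Types (A B D M I : C -> Prop) (w : C * C) (x y z : C).

(** * Cyclic overlattices under an inclusion of exponent prime to [N] *)

Section Transport.
Variables (A B : C -> Prop) (f n N : nat).
Hypothesis lA : lat A f.
Hypothesis lB : lat B f.
Hypothesis AB : forall z, A z -> B z.
Hypothesis nBA : forall z, B z -> A (n%:R * z).
Hypothesis cop : coprime n N.
Hypothesis n0 : (0 < n)%N.
Hypothesis N0 : (0 < N)%N.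
Let sA := lat_addgrp lA.
Let sB := lat_addgrp lB.

Lemma transport_ordmod be : ordmod A be N -> ordmod B be N.
Proof.
move=> h k; rewrite -h; split=> [Bk|]; last exact: AB.
apply: (coprime_mem sA cop n0); first exact: nBA.
have -> : N%:R * (k%:~R * be) = k%:~R * (N%:Z%:~R * be) by ring.
by apply: addgrp_int_mul => //; apply/h; apply: dvdzz.
Qed.

(** It recovers an overlattice of [A] from the corresponding one of [B], as the part that [N] sends
    into [A]; injectivity of the transport follows. *)
Lemma transport_super be z : ordmod A be N ->
  addZ A be z <-> addZ B be z /\ A (N%:R * z).
Proof.
move=> h; have hN : A (N%:Z%:~R * be) by apply/h; apply: dvdzz.
split=> [[x [k [Ax ->]]]|[[x [k [Bx ->]]] hz]].
  split; first by exists x, k; split=> //; apply: AB.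
  have -> : N%:R * (x + k%:~R * be) = N%:R * x + k%:~R * (N%:Z%:~R * be) by ring.
  by apply: (addgrpD sA); [apply: addgrp_nat_mul|apply: addgrp_int_mul].
exists x, k; split=> //; apply: (coprime_mem sA cop n0); first exact: nBA.
have -> : N%:R * x = N%:R * (x + k%:~R * be) - k%:~R * (N%:Z%:~R * be) by ring.
by apply: (addgrpB sA) => //; apply: addgrp_int_mul.
Qed.

Lemma transport_inj be ga : ordmod A be N -> ordmod A ga N ->
  addZ B be = addZ B ga -> addZ A be = addZ A ga.
Proof.
move=> hb hg E; apply: set_ext => z.
by rewrite (transport_super z hb) (transport_super z hg) E.
Qed.

(** Replace [be] by [u n be] with [u n] equal to 1 modulo [N]: it is congruent to [be] modulo [B],
    and [N] times it lies in [n B], hence in [A]. *)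
Lemma transport_surj be : ordmod B be N ->
  exists2 ga, ordmod A ga N & addZ B ga = addZ B be.
Proof.
move=> h; have [u v E _] := egcdnP N n0; rewrite (eqP cop) in E.
have hN : B (N%:Z%:~R * be) by apply/h; apply: dvdzz.
have hd : B (u%:R * n%:R * be - be).
  rewrite -natrM E natrD mulrDl mul1r addrK natrM -mulrA.
  by apply: addgrp_nat_mul.
have [hg Eg] := ordmod_addZ_eq sB h hd.
exists (u%:R * n%:R * be) => // k; split=> [/AB/hg//|/dvdzP[j ->]].
have -> : (j * N%:Z)%:~R * (u%:R * n%:R * be) = (j * u%:Z)%:~R * (n%:R * (N%:Z%:~R * be)).
  by rewrite !rmorphM /=; ring.
by apply: addgrp_int_mul => //; apply: nBA.
Qed.

Let dvd_aux b b' : (b' %| n * b)%N -> (b' %| N * f)%N -> (f %| N * b)%N -> (b' %| b)%N.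
Proof.
move=> h1 h2 h3; have : (b' %| gcdn (n * b) (N * (N * b)))%N.
  by rewrite dvdn_gcd h1; apply: dvdn_trans h2 _; rewrite dvdn_mul.
rewrite mulnA -muln_gcdl.
have /eqP-> : coprime n (N * N) by rewrite coprimeMr cop.
by rewrite mul1n.
Qed.

(** The two conductors divide each other up to the factor [n], and both are tied to [f] by
    divisibilities up to the factor [N]. As [n] is prime to [N], [dvd_aux] gives equality. *)
Lemma transport_lat be b : ordmod A be N -> lat (addZ A be) b <-> lat (addZ B be) b.
Proof.
move=> h; have hbe := ordmod_inQ (lat_latt lA) N0 h; have hB := transport_ordmod h.
set S := addZ A be; set S' := addZ B be.
have lS : latt S := latt_addZ (lat_latt lA) hbe.
have lS' : latt S' := latt_addZ (lat_latt lB) hbe.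
have sS := latt_addgrp lS; have sS' := latt_addgrp lS'.
have SS' z : S z -> S' z by move=> [x [k [Ax ->]]]; exists x, k; split=> //; apply: AB.
have nS' z : S' z -> S (n%:R * z).
  move=> [x [k [Bx ->]]]; exists (n%:R * x), (n%:Z * k); split; first exact: nBA.
  by rewrite rmorphM /=; ring.
have AS z : A z -> S z by move=> Az; apply: addZ_self.
have BS z : B z -> S' z by move=> Az; apply: addZ_self.
have NS z : S z -> A (N%:R * z) by move/(transport_super _ h) => [].
have NS' z : S' z -> B (N%:R * z).
  move=> [x [k [Bx ->]]].
  have -> : N%:R * (x + k%:~R * be) = N%:R * x + k%:~R * (N%:Z%:~R * be) by ring.
  apply: (addgrpD sB); first exact: addgrp_nat_mul.
  by apply: addgrp_int_mul => //; apply/hB; apply: dvdzz.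
have [c lc] := latt_lat lS; have [c' lc'] := latt_lat lS'.
have fc : (f %| N * c)%N.
  apply: (lat_dvd lA) => z Az; rewrite natrM -!mulrA; apply: NS.
  by rewrite mulrA; apply: (lat_om lc); apply: AS.
have fc' : (f %| N * c')%N.
  apply: (lat_dvd lB) => z Az; rewrite natrM -!mulrA; apply: NS'.
  by rewrite mulrA; apply: (lat_om lc'); apply: BS.
have cN : (c %| N * f)%N.
  apply: (lat_dvd lc) => z Sz; apply: AS.
  have -> : (N * f)%:R * om * z = f%:R * om * (N%:R * z) by rewrite natrM; ring.
  by apply: (lat_om lA); apply: NS.
have cN' : (c' %| N * f)%N.
  apply: (lat_dvd lc') => z Sz; apply: BS.
  have -> : (N * f)%:R * om * z = f%:R * om * (N%:R * z) by rewrite natrM; ring.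
  by apply: (lat_om lB); apply: NS'.
have cn : (c %| n * c')%N.
  apply: (lat_dvd lc) => z Sz; rewrite natrM -!mulrA; apply: nS'.
  by rewrite mulrA; apply: (lat_om lc'); apply: SS'.
have cn' : (c' %| n * c)%N.
  apply: (lat_dvd lc') => z Sz; apply: SS'.
  have -> : (n * c)%:R * om * z = c%:R * om * (n%:R * z) by rewrite natrM; ring.
  by apply: (lat_om lc); apply: nS'.
have E : c = c'.
  by apply/eqP; rewrite eqn_dvd; apply/andP; split; [apply: (@dvd_aux c' c)|apply: (@dvd_aux c c')].
split=> hb; [rewrite (lat_inj hb lc) E|rewrite (lat_inj hb lc') -E] => //.
Qed.

End Transport.

(* Reduction theory: a basis whose first norm a is minimal has 3 a^2 <= 4 a c - b^2, and
   4 a c - b^2 only depends on the conductor. *)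
Lemma lat_short m : (0 < m)%N -> exists2 n : nat, (0 < n)%N &
  forall M, lat M m -> exists x, [/\ M x, x != 0 & forall z, M z -> Ord m (n%:R * (z / x))].
Proof.
move=> m0; set De := (m%:Z ^+ 2 * (4 * nm - tr ^+ 2)).
exists (`|De|`!)%N; first exact: fact_gt0.
move=> M lM.
pose P (n : nat) := exists w q (a b c k e : int),
  [/\ isbas w, M = zsp w, norm_form w q a b c k e m & a = n].
have Ppos w q a b c k e : isbas w -> norm_form w q a b c k e m -> 0 < a.
  move=> [_ _ d0] nf; have q0 := nf_q0 nf.
  have w10 : w.1 != 0 by apply: contraNneq d0 => E; rewrite /dlt E rmorph0 !mul0r subr0.
  by rewrite -(ltr0z C) -(pmulr_rgt0 _ q0) -(nf_a nf) mul_conjC_gt0.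
have [|a [w [q [a' [b [c [k [e [bw E nf Ea]]]]]]]] amin] := @ex_min_nat P.
  have [w [q [a [b [c [k [e [bw E nf]]]]]]]] := lat_norm_form lM.
  by exists `|a|%N, w, q, a, b, c, k, e; split=> //; rewrite gtz0_abs //; apply: Ppos nf.
subst a'; have apos : 0 < a%:Z := Ppos _ _ _ _ _ _ _ bw nf.
have [hq q0 qa qb qc prim _ Ee th] := nf.
have q0' : q != 0 by rewrite gt_eqF.
have thc : w.1^* * w.2 = q * (k%:~R + (e * m%:Z)%:~R * om^*).
  have := congr1 (@Num.conj C) th.
  rewrite !rmorphM rmorphD !rmorphM /= conjCK !conj_zint => ->.
  by congr (_ * _); apply: conj_Creal; apply: gtr0_real.
have Eb : b = k *+ 2 + e * m%:Z * tr.
  apply: (@intr_inj C); apply: (mulfI q0'); rewrite -qb th thc.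
  by rewrite !(rmorphD, rmorphM, rmorphMn) /= -qgen_tr; ring.
have Eac : a%:Z * c = k ^+ 2 + k * (e * m%:Z) * tr + m%:Z ^+ 2 * nm.
  apply: (@intr_inj C); apply: (mulfI q0'); apply: (mulfI q0').
  have -> : q * (q * (a%:Z * c)%:~R) = (q * a%:~R) * (q * c%:~R) by rewrite rmorphM /=; ring.
  rewrite -qa -qc; have -> : w.1 * w.1^* * (w.2 * w.2^*) = (w.1 * w.2^*) * (w.1^* * w.2) by ring.
  rewrite th thc; have -> : m%:Z ^+ 2 * nm = (e * e) * m%:Z ^+ 2 * nm by rewrite Ee mul1r.
  by rewrite !(rmorphD, rmorphM, rmorphXn) /= -qgen_tr -qgen_nm; ring.
have EDe : 4 * (a%:Z * c) - b ^+ 2 = De.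
  rewrite Eac Eb /De.
  have -> : m%:Z ^+ 2 * (4 * nm - tr ^+ 2) = 4 * m%:Z ^+ 2 * nm - (e * e) * m%:Z ^+ 2 * tr ^+ 2.
    by rewrite Ee; ring.
  by ring.
(* The value on the right is the first norm of the basis [(w.2 + t w.1, w.1)]; reversing the
   orientation changes the sign [e]. *)
have amin' (t : int) : a%:Z <= c + b * t + a%:Z * t ^+ 2.
  pose w' := (w.2 + t%:~R * w.1, w.1).
  have Ew' : zsp w' = zsp w.
    apply: set_ext => z; split=> -[i [j ->]] /=.
      by exists (i * t + j), i; rewrite rmorphD rmorphM /=; ring.
    by exists j, (i - j * t); rewrite rmorphB rmorphM /=; ring.
  have [h1 h2 d0] := bw.
  have bw' : isbas w'.
    split=> //=; first by apply: inQD => //; apply: inQM => //; apply: inQ_int.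
    have -> : dlt w' = - dlt w by rewrite /dlt /= rmorphD rmorphM /= conj_zint; ring.
    by rewrite oppr_eq0.
  have nf' : norm_form w' q (c + b * t + a%:Z * t ^+ 2) (b + 2 * a%:Z * t) a%:Z
      (k + e * m%:Z * tr + t * a%:Z) (- e) m.
    split=> //=.
    - rewrite rmorphD rmorphM /= conj_zint.
      have -> : (w.2 + t%:~R * w.1) * (w.2^* + t%:~R * w.1^*) = w.2 * w.2^* +
        t%:~R * (w.1 * w.2^* + w.1^* * w.2) + t%:~R ^+ 2 * (w.1 * w.1^*) by ring.
      by rewrite qa qb qc !(rmorphD, rmorphM, rmorphXn) /=; ring.
    - rewrite rmorphD rmorphM /= conj_zint.
      have -> : (w.2 + t%:~R * w.1) * w.1^* + (w.2^* + t%:~R * w.1^*) * w.1 =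
        (w.1 * w.2^* + w.1^* * w.2) + 2 * t%:~R * (w.1 * w.1^*) by ring.
      by rewrite qa qb !(rmorphD, rmorphM) /=; ring.
    - case: prim => x [y [z Exyz]].
      exists z, (y - z * t), (x - 2 * t * y + z * t ^+ 2).
      by transitivity (x * a%:Z + y * b + z * c); [ring|].
    - by rewrite mulrNN.
    - have -> : (w.2 + t%:~R * w.1) * w.1^* = w.1^* * w.2 + t%:~R * (w.1 * w.1^*) by ring.
      by rewrite thc qa !(rmorphD, rmorphM, rmorphN) /= -qgen_tr; ring.
  have pos' := Ppos _ _ _ _ _ _ _ bw' nf'.
  have : P (absz (c + b * t + a%:Z * t ^+ 2)).
    exists w', q, (c + b * t + a%:Z * t ^+ 2), (b + 2 * a%:Z * t), a%:Z, (k + e * m%:Z * tr + t * a%:Z), (- e).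
    by split=> //; [rewrite Ew'|rewrite gtz0_abs].
  by move/amin => le; rewrite -(gtz0_abs pos') lez_nat.
have aDe : (a <= `|De|)%N.
  have a20 : 2 * a%:Z != 0 by lia.
  (* With [t] this rounded quotient, [b - 2 a t = r - a] lies between [-a] and [a]. Minimality then
     gives [4 a^2 <= a^2 + De]. *)
  have := amin' (- ((b + a%:Z) %/ (2 * a%:Z))%Z).
  have := divz_eq (b + a%:Z) (2 * a%:Z); set t := ((b + a%:Z) %/ (2 * a%:Z))%Z.
  have := modz_ge0 (b + a%:Z) a20; have : ((b + a%:Z) %% (2 * a%:Z))%Z < 2 * a%:Z.
    by apply: ltz_pmod; lia.
  set r := (_ %% _)%Z => rlt r0 Er ht.
  have h4 : 4 * a%:Z * (c + b * - t + a%:Z * (- t) ^+ 2) = (r - a%:Z) ^+ 2 + De.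
    have -> : r = b + a%:Z - t * (2 * a%:Z) by rewrite Er; ring.
    by rewrite -EDe; ring.
  have h5 : 4 * a%:Z * a%:Z <= (r - a%:Z) ^+ 2 + De.
    by rewrite -h4; apply: ler_pM => //; lia.
  have h6 : (r - a%:Z) ^+ 2 <= a%:Z * a%:Z.
    rewrite -subr_le0; have -> : (r - a%:Z) ^+ 2 - a%:Z * a%:Z = r * (r - 2 * a%:Z) by ring.
    by apply: mulr_ge0_le0 => //; rewrite subr_le0 ltW.
  have h7 : a%:Z <= a%:Z * a%:Z by rewrite -[X in X <= _]mulr1; apply: ler_pM => //; lia.
  have h8 := le_trans h5 (lerD h6 (lexx De)).
  move: apos h7 h8; clear; move: De; rewrite -mulrA; set s := a%:Z * a%:Z; lia.
have Mw1 : M w.1 by rewrite E; exists 1, 0; rewrite mul1r mul0r addr0.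
exists w.1; split=> //.
  by rewrite -mul_conjC_eq0 qa mulf_neq0 // intr_eq0 gt_eqF.
move=> z Mz; have /dvdnP[t ->] : (a %| `|De|`!)%N by apply: dvdn_fact; rewrite aDe andbT; lia.
rewrite natrM -mulrA; apply: (addgrp_nat_mul _ (addgrp_Ord _ _)).
by apply: (norm_form_div nf _ qa); rewrite -E.
Qed.

End SuperLattices.

(** * Lattices of rank two *)

Section Matrices2.
Variable F : fieldType.
Implicit Types (v : 'cV[F]_2) (g : 'M[F]_2).

Definition cv2 (x y : F) : 'cV[F]_2 := \col_i (if i == 0 then x else y).
Definition mx2 (a b c d : F) : 'M[F]_2 :=
  \matrix_(i, j) (if i == 0 then if j == 0 then a else b else if j == 0 then c else d).

Lemma cv2_0 x y : cv2 x y 0 0 = x. Proof. by rewrite mxE. Qed.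
Lemma cv2_1 x y : cv2 x y 1 0 = y. Proof. by rewrite mxE. Qed.

Lemma cvB v v' i : (v - v') i 0 = v i 0 - v' i 0. Proof. by rewrite !mxE. Qed.
Lemma cvZ a v i : (a *: v) i 0 = a * v i 0. Proof. by rewrite mxE. Qed.

Lemma cv2_ext v v' : v 0 0 = v' 0 0 -> v 1 0 = v' 1 0 -> v = v'.
Proof.
move=> h0 h1; apply/matrixP => i j; rewrite (ord1 j).
by case: i => -[|[|]] // hi; [move: h0|move: h1]; congr (v _ _ = v' _ _); apply: val_inj.
Qed.

Lemma mulmx_cv2 g v i : (g *m v) i 0 = g i 0 * v 0 0 + g i 1 * v 1 0.
Proof.
rewrite mxE !big_ord_recl big_ord0 addr0.
by congr (_ * _ + g i _ * v _ 0); apply: val_inj.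
Qed.

Lemma mx2E a b c d :
  (mx2 a b c d 0 0 = a) * (mx2 a b c d 0 1 = b) * (mx2 a b c d 1 0 = c) * (mx2 a b c d 1 1 = d).
Proof. by rewrite !mxE. Qed.

Lemma det2 g : \det g = g 0 0 * g 1 1 - g 0 1 * g 1 0.
Proof.
rewrite (expand_det_row g 0) !big_ord_recl big_ord0 addr0 /cofactor !det_mx11 !mxE /=.
have -> : lift 0 0 = 1 :> 'I_2 by apply: val_inj.
have -> : lift 1 0 = 0 :> 'I_2 by apply: val_inj.
by rewrite /= !addn0 expr0 addn1 expr1; ring.
Qed.

Lemma mx2_unit a b c d : a * d - b * c != 0 -> mx2 a b c d \in unitmx.
Proof. by rewrite unitmxE det2 !mx2E unitfE. Qed.

Definition det_pair v v' : F := v 0 0 * v' 1 0 - v 1 0 * v' 0 0.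

Lemma det_pair_mul g v v' : det_pair (g *m v) (g *m v') = \det g * det_pair v v'.
Proof. by rewrite /det_pair !mulmx_cv2 det2; ring. Qed.

Definition isoL g (L L' : 'cV[F]_2 -> Prop) : Prop :=
  g \in unitmx /\ forall v, L v <-> L' (g *m v).

Lemma isoL_id L : isoL 1%:M L L.
Proof. by split=> [|v]; rewrite ?unitmx1 ?mul1mx. Qed.

Lemma isoL_comp g g' L L' L'' : isoL g L L' -> isoL g' L' L'' -> isoL (g' *m g) L L''.
Proof.
move=> [ug h] [ug' h']; split; first by rewrite unitmx_mul ug'.
by move=> v; rewrite h h' mulmxA.
Qed.

Lemma isoL_inv g L L' : isoL g L L' -> isoL (invmx g) L' L.
Proof.
by move=> [ug h]; split=> [|v]; rewrite ?unitmx_inv // h mulmxA mulmxV // mul1mx.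
Qed.

End Matrices2.

(** * Extensions of one lattice of [K] by another *)

Section RankTwo.
Variables (C : numClosedFieldType) (Q : quad C).
Local Notation om := (qgen Q).
Local Notation inQ := (ratspan om).
Local Notation Ord := (order_of om).
Local Notation latt := (latt Q).
Local Notation cV2 := ('cV[C]_2).
Implicit Types (A B D M I : C -> Prop) (w : C * C) (x y z : C) (L : cV2 -> Prop).

Definition twist M1 M2 u (v : cV2) : Prop := M2 (v 1 0) /\ M1 (v 0 0 - u * (v 1 0)^*).

Definition latt2 L : Prop := addgrp L /\ exists n : nat, [/\ (0 < n)%N,
  (forall v : cV2, Ord 1 (v 0 0) -> Ord 1 (v 1 0) -> L (n%:R *: v)) &
  (forall v : cV2, L v -> Ord 1 (n%:R * v 0 0) /\ Ord 1 (n%:R * v 1 0))].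

Lemma addgrp_twist M1 M2 u : addgrp M1 -> addgrp M2 -> addgrp (twist M1 M2 u).
Proof.
move=> s1 s2; split; first by rewrite /twist !mxE rmorph0 mulr0 subr0; split; apply: addgrp0.
move=> v v' [h2 h1] [h2' h1']; rewrite /twist !mxE; split; first exact: addgrpB.
have -> : v 0 0 - v' 0 0 - u * (v 1 0 - v' 1 0)^* =
  (v 0 0 - u * (v 1 0)^*) - (v' 0 0 - u * (v' 1 0)^*) by rewrite rmorphB /=; ring.
exact: addgrpB.
Qed.

Lemma latt2_twist M1 M2 u : latt M1 -> latt M2 -> inQ u -> latt2 (twist M1 M2 u).
Proof.
move=> [s1 [n1 [n10 nM1 Mn1]]] [s2 [n2 [n20 nM2 Mn2]]] /inQ_Ord[m m0 hu].
split; first exact: addgrp_twist.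
have sO := addgrp_Ord Q 1.
exists (n1 * n2 * m)%N; split; first by rewrite !muln_gt0 n10 n20.
  move=> v h0 h1; rewrite /twist !mxE; split.
    have -> : (n1 * n2 * m)%:R * v 1 0 = (n1 * m)%:R * (n2%:R * v 1 0) by rewrite !natrM; ring.
    by apply: addgrp_nat_mul => //; apply: nM2.
  have -> : (n1 * n2 * m)%:R * v 0 0 - u * ((n1 * n2 * m)%:R * v 1 0)^* =
     n1%:R * ((n2 * m)%:R * v 0 0 - n2%:R * (m%:R * u * (v 1 0)^*)).
    by rewrite !natrM !rmorphM /= !rmorph_nat; ring.
  apply: nM1; apply: (addgrpB sO); apply: (addgrp_nat_mul _ sO) => //.
  by apply: Ord_mul => //; apply: Ord_conj.
move=> v [h2 h1]; split; last first.
  have -> : (n1 * n2 * m)%:R * v 1 0 = (n1 * m)%:R * (n2%:R * v 1 0) by rewrite !natrM; ring.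
  by apply: (addgrp_nat_mul _ sO); apply: Mn2.
have -> : (n1 * n2 * m)%:R * v 0 0 = (n2 * m)%:R * (n1%:R * (v 0 0 - u * (v 1 0)^*))
   + n1%:R * ((m%:R * u) * (n2%:R * v 1 0)^*).
  by rewrite !natrM !rmorphM /= !rmorph_nat; ring.
apply: (addgrpD sO); apply: (addgrp_nat_mul _ sO); first exact: Mn1.
by apply: Ord_mul => //; apply: Ord_conj; apply: Mn2.
Qed.

Lemma latt_line L (x : cV2) : latt2 L -> inQ (x 0 0) -> inQ (x 1 0) -> x != 0 ->
  latt (fun a => L (a *: x)).
Proof.
move=> [sL [n [n0 nL Ln]]] h0 h1 x0.
have sM : addgrp (fun a => L (a *: x)).
  split; first by rewrite scale0r; apply: addgrp0.
  by move=> a b ha hb; rewrite scalerBl; apply: addgrpB.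
have [m m0 [hm0 hm1]] := inQ_denom2 h0 h1.
have lO := latt_Ord Q (ltn0Sn 0).
apply: (latt_commens_l lO) => //.
  exists (n * m)%N; first by rewrite muln_gt0 n0.
  move=> z Oz; have -> : (n * m)%:R * z *: x = n%:R *: ((m%:R * z) *: x).
    by rewrite scalerA natrM mulrA.
  by apply: nL; rewrite !mxE mulrAC; apply: Ord_mul.
have [y [hy y0 Ly]] : exists y, [/\ inQ y, y != 0 & forall a, L (a *: x) -> Ord 1 (n%:R * (a * y))].
  have [E|y0] := eqVneq (x 0 0) 0; last by exists (x 0 0); split=> // a /Ln[+ _]; rewrite !mxE.
  exists (x 1 0); split=> //; last by move=> a /Ln[_]; rewrite !mxE.
  by apply: contraNneq x0 => E1; apply/eqP; apply: cv2_ext; rewrite ?E ?E1 !mxE.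
have [k k0 hk] : exists2 k : nat, (0 < k)%N & Ord 1 (k%:R * y^-1).
  by apply/inQ_Ord; apply: inQ_inv.
exists (n * k)%N; first by rewrite muln_gt0 n0.
move=> a /Ly h; have := Ord_mul h hk; congr (Ord 1 _).
by rewrite natrM; field.
Qed.

(* Solving u a^* + t a = xa and u b^* + t b = xb for a basis (a, b) of the projection M2
   makes the lattice antilinear over M2 after a unipotent change of coordinates. *)
Lemma line_normal L (x : cV2) : latt2 L -> inQ (x 0 0) -> inQ (x 1 0) -> x != 0 ->
  exists g M2 u, [/\ latt M2, inQ u, g *m x = cv2 1 0 &
    isoL g L (twist (fun a => L (a *: x)) M2 u)].
Proof.
move=> lL h0 h1 x0; have [sL [n [n0 nL Ln]]] := lL.
have [r [s [hr hs Ers]]] : exists r s, [/\ inQ r, inQ s & r * x 0 0 + s * x 1 0 = 1].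
  have [E|y0] := eqVneq (x 0 0) 0; last first.
    exists (x 0 0)^-1, 0; split; [exact: inQ_inv|exact: (inQ_int Q 0)|].
    by rewrite mulVf // mul0r addr0.
  exists 0, (x 1 0)^-1; split; [exact: (inQ_int Q 0)|exact: inQ_inv|].
  rewrite mulVf ?mul0r ?add0r //.
  by apply: contraNneq x0 => E1; apply/eqP; apply: cv2_ext; rewrite ?E ?E1 !mxE.
set p := x 0 0 in h0 Ers *; set q := x 1 0 in h1 Ers *.
(* The image of [L] under the linear form whose kernel is the line of [x]. *)
pose M2 y := exists2 v, L v & y = - q * v 0 0 + p * v 1 0.
have lM2 : latt M2.
  have lO := latt_Ord Q (ltn0Sn 0); have sO := addgrp_Ord Q 1.
  apply: (latt_commens_l lO).
  - split; first by exists 0; [apply: addgrp0|rewrite !mxE !mulr0 addr0].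
    move=> _ _ [v Lv ->] [v' Lv' ->]; exists (v - v'); first exact: addgrpB.
    by rewrite !mxE; ring.
  - have [m m0 [hm0 hm1]] := inQ_denom2 hr hs; exists (n * m)%N; first by rewrite muln_gt0 n0.
    move=> z Oz; exists (n%:R *: cv2 (- (m%:R * s * z)) (m%:R * r * z)).
      apply: nL; rewrite ?cv2_0 ?cv2_1; first by apply: (addgrpN sO); apply: Ord_mul.
      exact: Ord_mul.
    rewrite !mxE /=.
    transitivity ((n * m)%:R * z * (r * p + s * q)); first by rewrite Ers mulr1.
    by rewrite natrM; ring.
  - have [m m0 [hm0 hm1]] := inQ_denom2 h0 h1; exists (n * m)%N; first by rewrite muln_gt0 n0.
    move=> _ [v /Ln[L0 L1] ->].
    have -> : (n * m)%:R * (- q * v 0 0 + p * v 1 0) =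
      - ((m%:R * q) * (n%:R * v 0 0)) + (m%:R * p) * (n%:R * v 1 0) by rewrite natrM; ring.
    by apply: (addgrpD sO); first apply: (addgrpN sO); apply: Ord_mul.
have [w bw EM2] := latt_basis lM2; have [hw1 hw2 d0] := bw.
have [va La Ea] : M2 w.1 by rewrite EM2; exists 1, 0; rewrite mul1r mul0r addr0.
have [vb Lb Eb] : M2 w.2 by rewrite EM2; exists 0, 1; rewrite mul1r mul0r add0r.
have Lin v i : L v -> inQ (v i 0).
  move=> /Ln[L0 L1]; have : i = 0 \/ i = 1.
    by case: i => -[|[|]] // hi; [left|right]; apply: val_inj.
  by case=> ->; apply/inQ_Ord; exists n.
pose xa := r * va 0 0 + s * va 1 0; pose xb := r * vb 0 0 + s * vb 1 0.
have hxa : inQ xa by apply: inQD; apply: inQM => //; apply: Lin.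
have hxb : inQ xb by apply: inQD; apply: inQM => //; apply: Lin.
pose u := (xa * w.2 - xb * w.1) / dlt w; pose t := (xb * w.1^* - xa * w.2^*) / dlt w.
have hd := inQ_dlt bw.
have hu : inQ u by apply: inQ_div => //; apply: inQB; apply: inQM.
have Eua : xa - t * w.1 = u * w.1^* by rewrite /u /t; rewrite /dlt in d0 *; field.
have Eub : xb - t * w.2 = u * w.2^* by rewrite /u /t; rewrite /dlt in d0 *; field.
pose g := mx2 (r + t * q) (s - t * p) (- q) p.
have dg : (r + t * q) * p - (s - t * p) * (- q) = 1.
  by transitivity (r * p + s * q); [ring|].
have gx : g *m x = cv2 1 0.
  apply: cv2_ext; rewrite mulmx_cv2 !mx2E ?cv2_0 ?cv2_1; last by rewrite -/p -/q; ring.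
  by rewrite -[RHS]Ers -/p -/q; ring.
have ug : g \in unitmx by apply: mx2_unit; rewrite dg oner_eq0.
exists g, M2, u; split=> //; split=> // v.
have g0 (v' : cV2) : (g *m v') 0 0 = (r * v' 0 0 + s * v' 1 0) - t * (- q * v' 0 0 + p * v' 1 0).
  by rewrite mulmx_cv2 !mx2E; ring.
have g1 (v' : cV2) : (g *m v') 1 0 = - q * v' 0 0 + p * v' 1 0.
  by rewrite mulmx_cv2 !mx2E; ring.
(* Subtracting lifts of its image in [M2] brings [v] onto the line of [x]. By the choice of [u] and
   [t], the coefficient left there is the one tested in [twist]. *)
have key (i j : int) : (g *m v) 1 0 = i%:~R * w.1 + j%:~R * w.2 ->
    v - i%:~R *: va - j%:~R *: vb = ((g *m v) 0 0 - u * ((g *m v) 1 0)^*) *: x.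
  move=> Ey; apply: (can_inj (mulKmx ug)); rewrite -scalemxAr gx.
  rewrite !mulmxBr -!scalemxAr; apply: cv2_ext; rewrite !cvB !cvZ ?cv2_0 ?cv2_1 ?mulr1 ?mulr0.
    rewrite Ey rmorphD !rmorphM /= !conj_zint !g0 -Ea -Eb -/xa -/xb Eua Eub; ring.
  rewrite Ey !g1 -Ea -Eb; ring.
have sub (i j : int) : L v <-> L (v - i%:~R *: va - j%:~R *: vb).
  have Lab : L (i%:~R *: va + j%:~R *: vb).
    by rewrite !scaler_int; apply: (addgrpD sL); apply: addgrpMz.
  rewrite -addrA -opprD; split=> h; first exact: addgrpB.
  by rewrite -[v](subrK (i%:~R *: va + j%:~R *: vb)); apply: addgrpD.
split=> [Lv|[]].
  have M2v : M2 ((g *m v) 1 0) by exists v.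
  split=> //; move: M2v; rewrite EM2 => -[i [j Ey]].
  by rewrite -(key _ _ Ey); apply/sub.
rewrite EM2 => -[i [j Ey]]; by rewrite -(key _ _ Ey) => /sub.
Qed.

(** If [X] and [Y] are the values at [w.1] and [w.2], then [X w.2 - Y w.1 = p * dlt w] for every
    [s]. Conversely a decomposition of [p * dlt w] prescribes both values, and the first one
    determines [s]. *)
Lemma antilinear_mem M w p : addgrp M -> dlt w != 0 ->
  (exists s, forall y, zsp w y -> M (p * y^* + s * y)) <-> mulL M (zsp w) (p * dlt w).
Proof.
move=> sM d0; rewrite mulL_zspP //; split=> [[s h]|[x [y [Mx My E]]]].
  exists (- (p * w.2^* + s * w.2)), (p * w.1^* + s * w.1); split.
  - by apply: addgrpN => //; apply: h; exists 0, 1; rewrite mul1r mul0r add0r.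
  - by apply: h; exists 1, 0; rewrite mul1r mul0r addr0.
  - by rewrite /dlt; ring.
have w10 : w.1 != 0 by apply: contraNneq d0 => E1; rewrite /dlt E1 rmorph0 !mul0r subr0.
pose s := (y - p * w.1^*) / w.1.
have E1 : p * w.1^* + s * w.1 = y by rewrite /s; field.
have E2 : p * w.2^* + s * w.2 = - x.
  apply: (mulfI w10); rewrite /s.
  have -> : w.1 * (p * w.2^* + (y - p * w.1^*) / w.1 * w.2) = y * w.2 - p * dlt w.
    by rewrite /dlt; field.
  by rewrite E; ring.
exists s => _ [i [j ->]].
have -> : p * (i%:~R * w.1 + j%:~R * w.2)^* + s * (i%:~R * w.1 + j%:~R * w.2) =
  i%:~R * (p * w.1^* + s * w.1) + j%:~R * (p * w.2^* + s * w.2).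
  by rewrite rmorphD !rmorphM /= !conj_zint; ring.
rewrite E1 E2; apply: (addgrpD sM); apply: addgrp_int_mul => //; exact: addgrpN.
Qed.

Lemma dlt_sign w w' : dlt w != 0 -> zsp w = zsp w' ->
  exists2 e : C, e = 1 \/ e = -1 & dlt w' = e * dlt w.
Proof.
move=> d0 E.
have [a [b E1]] : zsp w w'.1 by rewrite E; exists 1, 0; rewrite mul1r mul0r addr0.
have [c [d E2]] : zsp w w'.2 by rewrite E; exists 0, 1; rewrite mul1r mul0r add0r.
have [a' [b' E1']] : zsp w' w.1 by rewrite -E; exists 1, 0; rewrite mul1r mul0r addr0.
have [c' [d' E2']] : zsp w' w.2 by rewrite -E; exists 0, 1; rewrite mul1r mul0r add0r.
have D : dlt w' = (a * d - b * c)%:~R * dlt w.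
  by rewrite /dlt E1 E2 !(rmorphD, rmorphM, rmorphB) /= !conj_zint; ring.
have D' : dlt w = (a' * d' - b' * c')%:~R * dlt w'.
  by rewrite /dlt E1' E2' !(rmorphD, rmorphM, rmorphB) /= !conj_zint; ring.
have : (a' * d' - b' * c') * (a * d - b * c) = 1.
  by apply: (@intr_inj C); apply: (mulIf d0); rewrite mul1r rmorphM /= -mulrA -D -D'.
set e' := a' * d' - _; set e := a * d - _ => ee; exists e%:~R => //.
have /eqP := congr1 absz ee; rewrite abszM muln_eq1 => /andP[_ /eqP].
by case: (e) => n /= En; [left; rewrite En|right; case: En => ->; rewrite NegzE rmorphN].
Qed.

Lemma twist_line M1 M2 u z : addgrp M2 -> twist M1 M2 u (cv2 z 0) <-> M1 z.
Proof.
by move=> s2; rewrite /twist cv2_0 cv2_1 rmorph0 mulr0 subr0; split=> [[]|]; first done; split=> //; apply: addgrp0.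
Qed.

Lemma twist_lift M1 M2 u y : addgrp M1 -> twist M1 M2 u (cv2 (u * y^*) y) <-> M2 y.
Proof.
by move=> s1; rewrite /twist cv2_0 cv2_1 subrr; split=> [[]|] //; split=> //; apply: addgrp0.
Qed.

(** A matrix preserving the first axis is upper triangular. Its diagonal scales [M1] and [M2], and a
    suitable corner entry [s] exists exactly when [antilinear_mem] applies. The two bases differ by
    a determinant [e = 1] or [-1], which is moved into [al] because [-M1 = M1]. *)
Lemma twist_equiv M1 M2 M1' M2' w w' v v' :
  addgrp M1 -> addgrp M1' -> dlt w != 0 -> dlt w' != 0 -> M2 = zsp w -> M2' = zsp w' ->
  (exists g lam, [/\ lam != 0, g *m cv2 1 0 = lam *: cv2 1 0 &
     isoL g (twist M1 M2 (v / dlt w)) (twist M1' M2' (v' / dlt w'))]) <->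
  (exists al be, [/\ al != 0, be != 0, M1' = scl al M1, M2' = scl be M2 &
     mulL M1' M2' (v' - al * be * v)]).
Proof.
move=> s1 s1' d0 d0' EM2 EM2'.
have s2 : addgrp M2 by rewrite EM2; apply: addgrp_zsp.
have s2' : addgrp M2' by rewrite EM2'; apply: addgrp_zsp.
set u := v / dlt w; set u' := v' / dlt w'.
have sign be : be != 0 -> M2' = scl be M2 ->
    exists2 e : C, e = 1 \/ e = -1 & dlt w' = e * (be * be^* * dlt w).
  move=> b0 E; have d0b : dlt (be * w.1, be * w.2) != 0.
    have -> : dlt (be * w.1, be * w.2) = be * be^* * dlt w by rewrite /dlt /= !rmorphM /=; ring.
    by rewrite mulf_neq0 // mul_conjC_eq0.
  have [|e he Ee] := @dlt_sign _ w' d0b; first by rewrite -zsp_scl // -EM2 -EM2'.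
  by exists e => //; rewrite Ee /dlt /= !rmorphM /=; ring.
have pE al be e : be != 0 -> e = 1 \/ e = -1 -> dlt w' = e * (be * be^* * dlt w) ->
    be * ((al * u - u' * be^*) * dlt w) = al * be * v - e * v'.
  move=> b0 he Ed; have e0 : e != 0 by case: he => ->; rewrite ?oppr_eq0 oner_eq0.
  have ee : e^-1 = e by case: he => ->; rewrite ?invrN invr1.
  have bc0 : be^* != 0 by rewrite conjC_eq0.
  by rewrite -[in RHS]ee /u /u' Ed; field; rewrite e0 b0 bc0 d0.
split=> [[g [lam [l0 ge [ug iso]]]]|[al [be [a0 b0 E1 E2 hv]]]].
  have E00 : g 0 0 = lam.
    have := congr1 (fun z : cV2 => z 0 0) ge.
    by rewrite mulmx_cv2 !mxE /= !mulr1 mulr0 addr0.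
  have E10 : g 1 0 = 0.
    have := congr1 (fun z : cV2 => z 1 0) ge.
    by rewrite mulmx_cv2 !mxE /= !mulr1 mulr0 addr0 mulr0.
  set be := g 1 1; set s := g 0 1.
  have b0 : be != 0.
    by move: ug; rewrite unitmxE det2 E10 mulr0 subr0 E00 unitfE mulf_eq0 negb_or => /andP[].
  have gcv x y : g *m cv2 x y = cv2 (lam * x + s * y) (be * y).
    by apply: cv2_ext; rewrite mulmx_cv2 ?cv2_0 ?cv2_1 ?E00 ?E10 ?mul0r ?add0r.
  have E1 : M1' = scl lam M1.
    apply: set_ext => z; rewrite /scl -(twist_line M1 u _ s2) iso gcv mulr0 addr0 mulr0.
    by rewrite mulVKf // twist_line.
  have fwd y : M2 y -> M2' (be * y) /\ M1' (lam * (u * y^*) + s * y - u' * (be * y)^*).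
    move=> My; have /iso := (twist_lift M2 u y s1).2 My.
    by rewrite gcv => -[]; rewrite cv2_0 cv2_1.
  have E2 : M2' = scl be M2.
    apply: set_ext => y; split=> [My|/fwd[+ _]]; last by rewrite mulVKf.
    have : twist M1' M2' u' (cv2 (u' * y^*) y) by apply/twist_lift.
    have -> : cv2 (u' * y^*) y = g *m cv2 (lam^-1 * (u' * y^* - s * (be^-1 * y))) (be^-1 * y).
      by rewrite gcv; congr cv2; field; rewrite ?l0 ?b0.
    by move/iso => -[]; rewrite cv2_1.
  have [e he Ee] := sign be b0 E2.
  have hJ : mulL M1' (zsp w) ((lam * u - u' * be^*) * dlt w).
    apply/antilinear_mem => //; exists s => y; rewrite -EM2 => /fwd[_].
    by rewrite rmorphM /=; congr M1'; ring.
  have hJ' : mulL M1' M2' (lam * be * v - e * v').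
    rewrite -(pE _ _ _ b0 he Ee) E2 mulL_scl // EM2; exact: (mem_scl b0 hJ).
  have sg := addgrp_mulL M1' M2'.
  case: he => Ee1; rewrite Ee1 in hJ'.
    exists lam, be; split=> //.
    by have := addgrpN sg hJ'; rewrite mul1r opprB.
  exists (- lam), be; split=> //; rewrite ?oppr_eq0 //; first by rewrite sclN.
  by move: hJ'; congr (mulL _ _ _); ring.
have [e he Ee] := sign be b0 E2.
have e0 : e != 0 by case: he => ->; rewrite ?oppr_eq0 oner_eq0.
have ee : e * e = 1 by case: he => ->; rewrite ?mulrNN mulr1.
pose al' := e * al; have a0' : al' != 0 by rewrite mulf_neq0.
have E1' : M1' = scl al' M1.
  by rewrite E1 /al'; case: he => ->; rewrite ?mulN1r ?mul1r ?sclN.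
have sg := addgrp_mulL M1' M2'.
have hJ : mulL M1' M2' (be * ((al' * u - u' * be^*) * dlt w)).
  rewrite (pE _ _ _ b0 he Ee).
  have -> : al' * be * v - e * v' = - (e * (v' - al * be * v)) by rewrite /al'; ring.
  apply: (addgrpN sg); case: he => ->; first by rewrite mul1r.
  by rewrite mulN1r; apply: (addgrpN sg).
have /(antilinear_mem _ s1' d0)[s hs] : mulL M1' (zsp w) ((al' * u - u' * be^*) * dlt w).
  by move: hJ; rewrite E2 mulL_scl // /scl mulKf // EM2.
exists (mx2 al' s 0 be), al'; split=> //.
  by apply: cv2_ext; rewrite mulmx_cv2 !mxE /= ?mulr1 ?mulr0 ?addr0.
split; first by apply: mx2_unit; rewrite mulr0 subr0 mulf_neq0.
move=> x; rewrite /twist !mulmx_cv2 !mx2E mul0r add0r.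
have M2E : M2' (be * x 1 0) <-> M2 (x 1 0) by rewrite E2 /scl mulKf.
split=> -[h2 h1]; (split; first by apply/M2E).
  have -> : al' * x 0 0 + s * x 1 0 - u' * (be * x 1 0)^* =
    al' * (x 0 0 - u * (x 1 0)^*) + ((al' * u - u' * be^*) * (x 1 0)^* + s * x 1 0).
    by rewrite rmorphM /=; ring.
  apply: (addgrpD s1'); first by rewrite {1}E1'; apply: mem_scl.
  by apply: hs; rewrite -EM2.
have {}h2 : M2 (x 1 0) by apply/M2E.
have : M1' (al' * (x 0 0 - u * (x 1 0)^*)).
  have -> : al' * (x 0 0 - u * (x 1 0)^*) = (al' * x 0 0 + s * x 1 0 - u' * (be * x 1 0)^*) -
    ((al' * u - u' * be^*) * (x 1 0)^* + s * x 1 0) by rewrite rmorphM /=; ring.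
  by apply: (addgrpB s1') => //; apply: hs; rewrite -EM2.
by rewrite E1' /scl mulKf.
Qed.

End RankTwo.

(** * Multiplier rings and determinant lattices classify lattices of rank two *)

Section Classification.
Variables (C : numClosedFieldType) (Q : quad C).
Local Notation om := (qgen Q).
Local Notation inQ := (ratspan om).
Local Notation Ord := (order_of om).
Local Notation isbas := (isbas Q).
Local Notation latt2 := (latt2 Q).
Local Notation lat := (lat Q).
Local Notation cV2 := ('cV[C]_2).
Implicit Types (A B D M I : C -> Prop) (w : C * C) (y z : C) (L : cV2 -> Prop).

(** Multiplying the left side by the inverse of [M1] says that [(m1 / g) X] sends the [O_g]-lattice
    of products of the two inverses into [O_m1]. By [Ord_colon], [X] sends it into [O_g], which
    means that [X] lies in [M1 M2]. *)
Lemma colon_mulL M1 M2 M2' m1 m2 X : lat M1 m1 -> lat M2 m2 -> lat M2' m2 ->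
  mulL M2 M2' = Ord m2 ->
  (forall y, M2' y -> M1 ((m1 %/ gcdn m1 m2)%:R * X * y)) <-> mulL M1 M2 X.
Proof.
move=> l1 l2 l2' E2; set g := gcdn m1 m2; have gm : (g %| m1)%N := dvdn_gcdl _ _.
have m10 := lat_gt0 l1; have g0 : (0 < g)%N by rewrite gcdn_gt0 m10.
have s1 := lat_addgrp l1.
split=> [h|hX y My]; last first.
  have : mulL M1 (Ord m2) (X * y) by rewrite -E2 mulLA; apply: mem_mulL.
  move=> hh; rewrite -mulrA; apply: (hh _ (addgrp_colon _ s1)) => a o Ma [i [j ->]].
  rewrite mulrCA mulrC; apply: (lat_stable l1) => //.
  have gn : (g %| m2)%N := dvdn_gcdr _ _.
  have -> : (m1 %/ g)%:R * (i%:~R + j%:~R * (m2%:R * om)) =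
     ((m1 %/ g)%:Z * i)%:~R + (j * (m2 %/ g)%:Z * m1%:Z)%:~R * om.
    have e1 : (m1%:R : C) = (m1 %/ g)%:R * g%:R by rewrite -natrM divnK.
    have e2 : (m2%:R : C) = (m2 %/ g)%:R * g%:R by rewrite -natrM divnK.
    by rewrite !rmorphM /= -[m1%:~R]/(m1%:R) e1 e2; ring.
  by apply/Ord_coef; rewrite dvdz_mull.
have [M1' l1' E1] := lat_inv l1.
have hg := lat_mul l1' l2'; have hgM := lat_mul l1 l2; rewrite -/g in hg hgM.
have hO t : mulL M1' M2' t -> Ord g (X * t).
  move=> ht; suff : scl (m1 %/ g)%:R (Ord g) ((m1 %/ g)%:R * X * t).
    by rewrite /scl -mulrA mulKf // natr_neq0 // divn_gt0 // dvdn_leq.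
  apply: Ord_colon => // s gs.
  have : mulL M1' M2' (t * s) by rewrite mulrC; apply: (lat_stable hg).
  rewrite -mulrA => hts; apply: (hts _ (addgrp_colon _ (addgrp_Ord Q m1))) => a b Ma Mb.
  have -> : (m1 %/ g)%:R * X * (a * b) = (m1 %/ g)%:R * X * b * a by ring.
  by rewrite -E1; apply: mem_mulL => //; apply: h.
have : mulL (mulL M1' M2') (mulL M1 M2) 1.
  rewrite -mulLA [mulL M2' _]mulLCA [mulL M2' _]mulLC E2 mulLA [mulL M1' _]mulLC E1 mulL_Ord.
  exact: Ord_1.
move=> h1; rewrite -[X]mulr1; apply: (h1 _ (addgrp_colon _ (addgrp_mulL _ _))) => a b ha hb.
by rewrite mulrA; apply: (lat_stable hgM) => //; apply: hO.
Qed.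

Definition cond2 L (f : nat) : Prop := forall a, (forall x, L x -> L (a *: x)) <-> Ord f a.

Lemma cond2_inj L f f' : cond2 L f -> cond2 L f' -> f = f'.
Proof.
by move=> h h'; apply: (@Ord_inj _ Q); apply: set_ext => a; rewrite -h -h'.
Qed.

Lemma cond2_iso g L L' f : isoL g L L' -> cond2 L f -> cond2 L' f.
Proof.
move=> iso h a; rewrite -h; have [ug E] := iso; have [_ E'] := isoL_inv iso; split=> hh x.
  by move=> /E/hh; rewrite scalemxAr => /E.
by move=> /E'/hh; rewrite scalemxAr => /E'.
Qed.

(** A multiplier [al] must preserve [M1] and [M2], so it is [i + j' l om] with [l] the lcm. The
    remaining condition is that [(al - conj(al)) u] sends [conj(M2)] into [M1]. This scalar is, up
    to sign, [(l / m2) j' v / q], and [q^-1 conj(M2)] is the inverse of [M2]; so [colon_mulL] reads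
    the condition as [j' v] in [M1 M2]. *)
Lemma twist_cond M1 M2 m1 m2 w v N : lat M1 m1 -> lat M2 m2 -> isbas w -> M2 = zsp w ->
  ordmod (mulL M1 M2) v N -> cond2 (twist M1 M2 (v / dlt w)) (lcmn m1 m2 * N).
Proof.
move=> l1 l2 bw EM2 hN; have s1 := lat_addgrp l1; have s2 := lat_addgrp l2.
have [q [a [b [c [k [e [m nf]]]]]]] := norm_form_exists bw.
have Em : m = m2.
  have := norm_form_lat bw nf; rewrite -EM2 => l2'; exact: lat_inj l2' l2.
rewrite Em {m Em} in nf.
have [hq q0 _ _ _ _ _ Ee th] := nf; have q0' : q != 0 by rewrite gt_eqF.
have m20 := lat_gt0 l2; have m2C := natr_neq0 C m20; have [_ _ d0] := bw.
have m10 := lat_gt0 l1; have g0 : (0 < gcdn m1 m2)%N by rewrite gcdn_gt0 m10.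
have thc : w.1^* * w.2 = q * (k%:~R + (e * m2%:Z)%:~R * om^*).
  have := congr1 (@Num.conj C) th.
  rewrite !rmorphM rmorphD !rmorphM /= conjCK !conj_zint => ->.
  by congr (_ * _); apply: conj_Creal; apply: gtr0_real.
have Ed : dlt w = - (q * e%:~R * m2%:R * (om - om^*)).
  by rewrite /dlt thc th !rmorphM /=; ring.
have e1 : e%:~R * e%:~R = 1 :> C by rewrite -rmorphM /= Ee.
have e0 : (e%:~R : C) != 0 by apply/eqP => e0; move: e1; rewrite e0 mul0r => /esym/eqP; rewrite oner_eq0.
have oo : om - om^* != 0 by rewrite subr_eq0 qgen_imag.
have e2 : - e%:~R^-1 = - e%:~R :> C by congr (- _); apply: (mulfI e0); rewrite e1 mulfV.
set l := lcmn m1 m2; set t := (m1 %/ gcdn m1 m2)%N.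
have El : l = (t * m2)%N.
  apply/eqP; rewrite -(eqn_pmul2r g0) muln_lcm_gcd mulnAC divnK //; exact: dvdn_gcdl.
pose M2' := scl q^-1 (cnj M2).
have l2' : lat M2' m2 by apply: lat_scl; [apply: inQ_inv|rewrite invr_eq0|apply: lat_cnj].
have EM2' : mulL M2 M2' = Ord m2.
  by rewrite mulL_scl ?invr_eq0 // {1 2}EM2 (norm_form_mulL nf) sclK.
set u := v / dlt w.
have key (i j' : int) y :
    let al := i%:~R + (j' * l%:Z)%:~R * om in
    (al - al^*) * u * y = - e%:~R * (t%:R * (j'%:~R * v) * (q^-1 * y)).
  move=> al; have -> : al - al^* = j'%:~R * (t%:R * m2%:R) * (om - om^*).
    rewrite /al rmorphD rmorphM /= !conj_zint El PoszM !rmorphM /=; ring.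
  rewrite -e2 /u Ed; move: (om - om^*) oo => W W0.
  by field; rewrite q0' e0 m2C W0.
move=> al; split=> [h|/OrdP[i [j [-> /dvdzP[j2 Ej]]]]].
  have o1 : Ord m1 al.
    have [_ _ h1] := l1; apply/h1 => z /(twist_line M1 u z s2).2/h.
    have -> : al *: cv2 z 0 = cv2 (al * z) 0 by apply: cv2_ext; rewrite cvZ ?cv2_0 ?cv2_1 ?mulr0.
    by move/twist_line; apply.
  have fwd y : M2 y -> M2 (al * y) /\ M1 ((al - al^*) * u * y^*).
    move=> /(twist_lift M2 u y s1).2/h []; rewrite !cvZ cv2_0 cv2_1 => h2 h1; split=> //.
    by move: h1; congr M1; rewrite rmorphM /=; ring.
  have o2 : Ord m2 al by have [_ _ h2] := l2; apply/h2 => y /fwd[].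
  have /OrdP[i [j [Eal /dvdzP[j' Ej]]]] := Ord_cap o1 o2.
  rewrite -/l in Ej.
  have hX : mulL M1 M2 (j'%:~R * v).
    apply/(colon_mulL _ l1 l2 l2' EM2') => y; rewrite /M2' /scl invrK /cnj rmorphM => /fwd[_].
    rewrite rmorphM /= !conjCK Eal Ej key mulKf // => hM.
    have := addgrp_int_mul (- e) s1 hM; congr M1.
    transitivity ((e%:~R * e%:~R) * (t%:R * (j'%:~R * v) * y)); first by rewrite rmorphN /=; ring.
    by rewrite e1 mul1r.
  have /dvdzP[r Er] := (hN j').1 hX.
  apply/OrdP; exists i, j; split=> //; rewrite Ej Er PoszM.
  by apply/dvdzP; exists r; ring.
have Ej2 : j = (j2 * N%:Z) * l%:Z by rewrite Ej PoszM; ring.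
have hX : mulL M1 M2 ((j2 * N%:Z)%:~R * v) by apply/hN; rewrite dvdz_mull.
move=> x [h2 h1]; rewrite /twist !cvZ.
have oal n : (n %| l)%N -> Ord n (i%:~R + j%:~R * om).
  move=> nl; apply/Ord_coef; rewrite Ej2; apply: dvdz_mull; exact: nl.
split; first by apply: (lat_stable l2) => //; apply: oal; apply: dvdn_lcmr.
set al' := i%:~R + _.
have -> : al' * x 0 0 - u * (al' * x 1 0)^* = al' * (x 0 0 - u * (x 1 0)^*) + (al' - al'^*) * u * (x 1 0)^*.
  by rewrite rmorphM /=; ring.
apply: (addgrpD s1); first by apply: (lat_stable l1) => //; apply: oal; apply: dvdn_lcml.
rewrite /al' Ej2 key -rmorphN; apply: (addgrp_int_mul _ s1).
apply: ((colon_mulL _ l1 l2 l2' EM2').2 hX).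
by rewrite /M2' /scl invrK mulVKf // /cnj conjCK.
Qed.

Definition detspan L z : Prop := forall G : C -> Prop, addgrp G ->
  (forall v v', L v -> L v' -> G (det_pair v v')) -> G z.

Lemma addgrp_detspan L : addgrp (detspan L).
Proof.
split=> [G sG _|x y hx hy G sG h]; first exact: addgrp0.
by apply: addgrpB => //; [apply: hx|apply: hy].
Qed.

Lemma mem_detspan L v v' : L v -> L v' -> detspan L (det_pair v v').
Proof. by move=> Lv Lv' G _; apply. Qed.

Lemma detspan_iso g L L' : isoL g L L' -> detspan L' = scl (\det g) (detspan L).
Proof.
move=> iso; have [ug h] := iso; have [_ h'] := isoL_inv iso.
have d0 : \det g != 0 by move: ug; rewrite unitmxE unitfE.
apply: set_ext => z; split=> hz.
  apply: (hz _ (addgrp_scl _ (addgrp_detspan L))) => v v' /h' Lv /h' Lv'.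
  rewrite -[v](mulKVmx ug) -[v'](mulKVmx ug) det_pair_mul.
  exact: (mem_scl d0 (mem_detspan Lv Lv')).
rewrite -[z](mulVKf d0); apply: (hz _ (addgrp_colon _ (addgrp_detspan L'))) => v v' /h Lv /h Lv'.
by rewrite -det_pair_mul; apply: mem_detspan.
Qed.

(** The antilinear parts of two vectors contribute [u (conj(y) y' - y conj(y'))], an integral
    multiple of [u * dlt w = v]. *)
Lemma detspan_twist M1 M2 w v : addgrp M1 -> dlt w != 0 -> M2 = zsp w ->
  detspan (twist M1 M2 (v / dlt w)) = addZ (mulL M1 M2) v.
Proof.
move=> s1 d0 EM2; set u := v / dlt w.
have s2 : addgrp M2 by rewrite EM2; apply: addgrp_zsp.
have sg := addgrp_mulL M1 M2; have sd := addgrp_detspan (twist M1 M2 u).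
apply: set_ext => z; split=> [h|[x [k [hx ->]]]].
  apply: (h _ (addgrp_addZ v sg)) => a b [a2 a1] [b2 b1].
  have [i [j Ea]] : zsp w (a 1 0) by rewrite -EM2.
  have [i' [j' Eb]] : zsp w (b 1 0) by rewrite -EM2.
  exists ((a 0 0 - u * (a 1 0)^*) * b 1 0 - (b 0 0 - u * (b 1 0)^*) * a 1 0), (i * j' - j * i').
  split; first by apply: (addgrpB sg); apply: mem_mulL.
  have -> : (i * j' - j * i')%:~R * v = u * ((a 1 0)^* * b 1 0 - a 1 0 * (b 1 0)^*).
    rewrite Ea Eb !(rmorphD, rmorphB, rmorphM) /= !conj_zint -[v in LHS](divfK d0) -/u /dlt; ring.
  by rewrite /det_pair; ring.
have lift y : M2 y -> twist M1 M2 u (cv2 (u * y^*) y) by move=> My; apply/twist_lift.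
apply: (addgrpD sd).
  apply: (hx _ sd) => p y Mp My.
  have -> : p * y = det_pair (cv2 p 0) (cv2 (u * y^*) y).
    by rewrite /det_pair !cv2_0 !cv2_1 mul0r subr0.
  by apply: mem_detspan; [apply/twist_line|apply: lift].
apply: (addgrp_int_mul _ sd).
have -> : v = det_pair (cv2 (u * w.1^*) w.1) (cv2 (u * w.2^*) w.2).
  by rewrite /det_pair !cv2_0 !cv2_1 -[LHS](divfK d0) -/u /dlt; ring.
by apply: mem_detspan; apply: lift; rewrite EM2; [exists 1, 0|exists 0, 1];
  rewrite mul1r mul0r ?addr0 ?add0r.
Qed.

(** When the line already has the full conductor, [twist_cond] reads [lcmn f m2 * N = f]. This
    forces [N = 1], so [v] lies in [M1 M2] and the twist can be removed. *)
Lemma line_split L (x : cV2) f : latt2 L -> inQ (x 0 0) -> inQ (x 1 0) -> x != 0 ->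
  (0 < f)%N -> cond2 L f -> lat (fun a => L (a *: x)) f ->
  exists g M2 m2, [/\ lat M2 m2, (m2 %| f)%N & isoL g L (twist (fun a => L (a *: x)) M2 0)].
Proof.
move=> lL h0 h1 x0 f0 cf; set M1 := (fun a => _); move=> l1.
have [g [M2 [u [lM2 hu gx iso]]]] := line_normal lL h0 h1 x0.
have [w bw EM2] := latt_basis lM2; have [_ _ d0] := bw; have hd := inQ_dlt bw.
have [m2 l2] := latt_lat lM2.
have lI := latt_mulL (lat_latt l1) lM2.
have [N N0 hN] := latt_ordmod lI (inQM hu hd).
have := twist_cond l1 l2 bw EM2 hN; rewrite mulfK // => c2.
have El : (lcmn f m2 * N = f)%N by apply: cond2_inj c2 (cond2_iso iso cf).
have m2f : (m2 %| f)%N.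
  by rewrite -El; apply: dvdn_mulr; apply: dvdn_lcmr.
have N1 : N = 1%N.
  have : (lcmn f m2 = f)%N by apply/lcmn_idPl.
  by move=> E; move: El; rewrite E => /eqP; rewrite -{2}[f]muln1 eqn_pmul2l // => /eqP.
have [_ ] := @twist_equiv _ M1 M2 M1 M2 w w (u * dlt w) 0 (lat_addgrp l1) (lat_addgrp l1) d0 d0 EM2 EM2.
case.
  exists 1, 1; rewrite !scl1 oner_eq0; split=> //.
  rewrite !mul1r sub0r -mulN1r; apply/(hN (-1)); rewrite N1; exact: dvd1z.
rewrite mul0r mulfK // => g' [lam [_ _ iso']].
by exists (g' *m g), M2, m2; split=> //; apply: isoL_comp iso iso'.
Qed.

Lemma latt2_inQ L v i : latt2 L -> L v -> inQ (v i 0).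
Proof.
move=> [_ [n [n0 _ Ln]]] /Ln[L0 L1]; have : i = 0 \/ i = 1.
  by case: i => -[|[|]] // hi; [left|right]; apply: val_inj.
by case=> ->; apply/inQ_Ord; exists n.
Qed.

Lemma latt2_neq0 L : latt2 L -> exists2 v, L v & v != 0.
Proof.
move=> [_ [n [n0 nL _]]]; exists (n%:R *: cv2 1 0).
  by apply: nL; rewrite ?cv2_0 ?cv2_1; [apply: Ord_1|apply: (Ord_int Q 1 0)].
apply/eqP => /(congr1 (fun z : cV2 => z 0 0)); rewrite cvZ cv2_0 mulr1 mxE => /eqP.
by rewrite (negPf (natr_neq0 C n0)).
Qed.

(** For each prime [p] of [f] some [x] has [(f / p) om x] outside [L], since otherwise [f] would
    divide [f / p]. The condition depends on [x] modulo [p L] only, so one [x] serves all [p]. A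
    smaller conductor on its line would divide some [f / p], contradicting the choice. *)
Lemma latt2_elt_cond L f : latt2 L -> (0 < f)%N -> cond2 L f ->
  exists x, [/\ L x, x != 0 & lat (fun a => L (a *: x)) f].
Proof.
move=> lL f0 cf; have sL : addgrp L by case: lL.
pose G p (x : cV2) := ~ L (((f %/ p)%:R * om) *: x).
have fom (y : cV2) : L y -> L ((f%:R * om) *: y) by apply: (cf _).2; apply: Ord_om.
have [x [Lx x0 Gx]] : exists x, [/\ L x, x != 0 & forall p, p \in primes f -> G p x].
  have [||||x Lx Gx] := @crt_primes _ L G (primes f) sL.
  - by apply/allP => p; rewrite mem_primes => /andP[].
  - exact: primes_uniq.
  - move=> p; rewrite mem_primes => /and3P[pp _ pf]; apply: NNPP => hn.
    have /cf/Ord_nat_om : forall x, L x -> L (((f %/ p)%:R * om) *: x).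
      by move=> x Lx; apply: NNPP => hx; apply: hn; exists x.
    have fp0 : (0 < f %/ p)%N by rewrite divn_gt0 ?prime_gt0 // dvdn_leq.
    move/dvdn_leq => /(_ fp0); rewrite leqNgt ltn_Pdiv // prime_gt1 //.
  - move=> p x y; rewrite mem_primes => /and3P[pp _ pf] Gx Ly; apply: contra_not Gx => h.
    have := addgrpB sL h (fom _ Ly); congr L.
    rewrite scalerDr -scaler_nat scalerA mulrAC -natrM divnK //.
    by rewrite addrK.
  (* The value 0 can occur only if [f] has no prime factor; then any nonzero vector will do. *)
  have [E0|x0] := eqVneq x 0; last by exists x.
  have [v Lv v0] := latt2_neq0 lL; exists v; split=> // p /Gx; rewrite /G E0 scaler0.
  by case; apply: addgrp0.
exists x; split=> //.
have [m lm] : exists m, lat (fun a => L (a *: x)) m.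
  by apply: latt_lat; apply: latt_line => //; exact: (latt2_inQ _ lL Lx).
suff -> : f = m by [].
have mf : (m %| f)%N.
  by apply: (lat_dvd lm) => z Lz; rewrite -scalerA; apply: fom.
apply/eqP; apply/negPn/negP => fm.
have m0 := lat_gt0 lm.
have q1 : (1 < f %/ m)%N.
  rewrite ltn_neqAle divn_gt0 // dvdn_leq // andbT eq_sym; apply: contra fm => /eqP E.
  by rewrite -(divnK mf) E mul1n.
have pp := pdiv_prime q1; set p := pdiv _ in pp.
have pd : (p %| f %/ m)%N := pdiv_dvd _.
have pf : (p %| f)%N by rewrite -(divnK mf) dvdn_mulr.
apply: (Gx p); first by rewrite mem_primes pp f0.
have mfp : (m %| f %/ p)%N.
  by rewrite dvdn_divRL // mulnC -dvdn_divRL.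
have := @lat_stable _ _ _ _ _ 1 lm ((Ord_nat_om Q m _).2 mfp); rewrite mulr1; apply.
by rewrite scale1r.
Qed.

(** Splitting off a line of conductor [f] gives [A + B] with [A] perhaps not principal. On the line
    through [(x1, x2)] one finds [A / x1] intersected with [B / x2], which [n'] and [n] respectively
    send into [O_f]. As these are coprime, the line meets the lattice in [O_f] exactly and splits
    off in turn. *)
Lemma latt2_normal L f : latt2 L -> (0 < f)%N -> cond2 L f ->
  exists g D m, [/\ lat D m, (m %| f)%N & isoL g L (twist (Ord f) D 0)].
Proof.
move=> lL f0 cf; have [x [Lx x0 lA]] := latt2_elt_cond lL f0 cf.
set A := (fun a => _) in lA.
have [g [B [m2 [lB m2f iso]]]] := line_split lL (latt2_inQ 0 lL Lx) (latt2_inQ 1 lL Lx) x0 f0 cf lA.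
rewrite -/A in iso; have lL' : latt2 (twist A B 0).
  by apply: latt2_twist; [apply: lat_latt lA|apply: lat_latt lB|apply: (inQ_int Q 0)].
have [x2 Bx2 x20] := latt_neq0 (lat_latt lB).
have hx2 := latt_inQ (lat_latt lB) Bx2.
have [n n0 hn] : exists2 n : nat, (0 < n)%N & forall z, scl x2^-1 B z -> Ord f (n%:R * z).
  apply: (@latt_commens _ Q); last exact: latt_Ord.
  by apply: latt_scl; [apply: inQ_inv|rewrite invr_eq0|apply: lat_latt lB].
have [x1 [n' [Ax1 x10 cop n'0 hn']]] := lat_coprime_elt lA n0.
have EO : (fun a => twist A B 0 (a *: cv2 x1 x2)) = Ord f.
  apply: set_ext => a; rewrite /twist !cvZ cv2_0 cv2_1 mul0r subr0; split=> [[h2 h1]|oa].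
    apply: (coprime_mem (addgrp_Ord Q f) cop n'0).
      by have := hn' _ h1; rewrite mulfK.
    by apply: hn; rewrite /scl invrK mulrC.
  split; first by apply: (lat_stable lB) => //; apply: OrdS m2f oa.
  exact: (lat_stable lA).
have [] := @line_split (twist A B 0) (cv2 x1 x2) f lL' _ _ _ f0 (cond2_iso iso cf) _.
- by rewrite cv2_0; apply: latt_inQ (lat_latt lA) Ax1.
- by rewrite cv2_1.
- by apply/eqP => /(congr1 (fun z : cV2 => z 0 0)); rewrite cv2_0 mxE => /eqP; rewrite (negPf x10).
- by rewrite EO; apply: lat_Ord.
rewrite EO => g' [D [m [lD mf iso']]].
by exists (g' *m g), D, m; split=> //; apply: isoL_comp iso iso'.
Qed.

Lemma detspan_normal D m f : lat D m -> (m %| f)%N -> detspan (twist (Ord f) D 0) = D.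
Proof.
move=> lD mf; have [w [_ _ d0] ED] := latt_basis (lat_latt lD).
have := detspan_twist 0 (addgrp_Ord Q f) d0 ED; rewrite mul0r (lat_Ord_dvd lD mf) => ->.
apply: set_ext => z; split=> [[x [k [Dx ->]]]|Dz]; first by rewrite mulr0 addr0.
exact: addZ_self.
Qed.

Lemma latt2_classify L L' f lam : latt2 L -> latt2 L' -> (0 < f)%N -> cond2 L f -> cond2 L' f ->
  lam != 0 -> detspan L' = scl lam (detspan L) -> exists g, isoL g L L'.
Proof.
move=> lL lL' f0 cf cf' l0 E.
have [g [D [m [lD mf iso]]]] := latt2_normal lL f0 cf.
have [g' [D' [m' [lD' mf' iso']]]] := latt2_normal lL' f0 cf'.
have dg0 : \det g != 0 by have [ug _] := iso; move: ug; rewrite unitmxE unitfE.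
have dg0' : \det g' != 0 by have [ug _] := iso'; move: ug; rewrite unitmxE unitfE.
have ED := detspan_iso iso; rewrite (detspan_normal lD mf) in ED.
have ED' := detspan_iso iso'; rewrite (detspan_normal lD' mf') in ED'.
pose mu := \det g' * lam / \det g.
have mu0 : mu != 0 by rewrite !mulf_neq0 ?invr_eq0.
have EDD : D' = scl mu D.
  by rewrite ED' E ED !scl_scl /mu divfK.
have iso0 : isoL (mx2 1 0 0 mu) (twist (Ord f) D 0) (twist (Ord f) D' 0).
  split; first by apply: mx2_unit; rewrite mul1r mul0r subr0.
  move=> v; rewrite /twist !mulmx_cv2 !mx2E !mul0r mul1r add0r addr0 !subr0.
  by rewrite EDD /scl mulKf.
have := isoL_comp (isoL_comp iso iso0) (isoL_inv iso') => h.
by exists (invmx g' *m (mx2 1 0 0 mu *m g)).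
Qed.

End Classification.

(** * The ring of integers *)

(** Gauss's lemma: an integral multiple of [X - q] divides the monic polynomial over [Z], so its
    leading coefficient is a unit. *)
Lemma integral_rat_int (F : numFieldType) (q : rat) :
  integralOver (intr : int -> F) (ratr q) -> exists n : int, q = n%:~R.
Proof.
case=> p mp /rootP; rewrite -[map_poly _ p]/(map_poly intr p) => hp.
have hq : root (map_poly (intr : int -> rat) p) q.
  apply/rootP; apply: (fmorph_inj (ratr : rat -> F)); rewrite rmorph0 -horner_map -map_poly_comp -[RHS]hp.
  by congr (_.[_]); apply: eq_map_poly => x /=; rewrite ratr_int.
have : 'X - q%:P %| map_poly intr p by rewrite dvdp_XsubCl.
case/dvdpP_rat_int=> p1 [a a0 Ep1] [r Er].
have sz : size p1 = 2%N.
  by have := size_XsubC q; rewrite Ep1 size_scale // size_map_inj_poly //; apply: intr_inj.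
have lr : lead_coef p1 * lead_coef r = 1 by rewrite -lead_coefM -Er (monicP mp).
have l1 : p1`_1 * lead_coef r = 1 by rewrite -lr /lead_coef sz.
have c1 := congr1 (fun s : {poly rat} => s`_1) Ep1.
have c0 := congr1 (fun s : {poly rat} => s`_0) Ep1.
rewrite /= !coefE /= subr0 in c1; rewrite /= !coefE /= sub0r in c0.
exists (- (lead_coef r * p1`_0)).
rewrite sz /= in c0 c1.
have -> : q = - (a * (p1`_0)%:~R) by rewrite -c0 opprK.
have -> : a = (lead_coef r)%:~R.
  transitivity (a * (p1`_1 * lead_coef r)%:~R); first by rewrite l1 mulr1.
  by rewrite rmorphM /= mulrA -c1 mul1r.
by rewrite rmorphN rmorphM.
Qed.

Section ImaginaryQuadratic.
Variables (R : realType) (d : nat).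
Hypothesis d0 : (0 < d)%N.
Local Notation C := (R[i]).
Local Notation s := (sqrtmd R d).
Implicit Types (z w : C).
Local Notation int_over := (integralOver (intr : int -> C)).

Let s_sqr : s * s = - d%:R.
Proof.
apply/eqP; rewrite eq_complex; apply/andP; rewrite /sqrtmd /=; split; apply/eqP.
  rewrite mul0r sub0r -expr2 sqr_sqrtr ?ler0n //.
  by elim: (d) => [|n IH]; rewrite ?mulr0n ?oppr0 // !mulrSr !opprD raddfD /= -IH.
rewrite !(mul0r, mulr0) addr0.
by elim: (d) => [|n IH]; rewrite ?mulr0n ?oppr0 // !mulrSr !opprD raddfD /= -IH ?oppr0 ?addr0.
Qed.

Let s_conj : s^* = - s.
Proof. by apply/eqP; rewrite eq_complex /= oppr0 !eqxx. Qed.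

Let s_neq0 : s != 0.
Proof.
have : s * s != 0 by rewrite s_sqr oppr_eq0 pnatr_eq0 -lt0n.
by rewrite mulf_eq0 negb_or => /andP[].
Qed.

Let conj_K (a b : rat) : (ratr a + ratr b * s : C)^* = ratr a - ratr b * s.
Proof. by rewrite rmorphD [X in _ + X]rmorphM !fmorph_rat -mulrN -s_conj. Qed.

Lemma inKB z w : inK d z -> inK d w -> inK d (z - w).
Proof.
move=> [a [b ->]] [a' [b' ->]]; exists (a - a'), (b - b').
by rewrite !rmorphB /=; ring.
Qed.

Lemma inK_int_mul (n : int) z : inK d z -> inK d (n%:~R * z).
Proof.
move=> [a [b ->]]; exists (n%:~R * a), (n%:~R * b).
by rewrite !rmorphM /= !ratr_int; ring.
Qed.

Lemma inK_int (n : int) : inK d (n%:~R : C).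
Proof. by exists n%:~R, 0; rewrite ratr_int rmorph0 mul0r addr0. Qed.

Lemma inOKP z : inOK d z <-> inK d z /\ int_over z.
Proof.
split=> -[hz [p]]; first by move=> [mp E]; split=> //; exists p => //; apply/rootP.
by move=> mp /rootP E; split=> //; exists p; split.
Qed.

Lemma int_over_int (n : int) : int_over n%:~R.
Proof. exact: (@integral_id _ _ (intr : {rmorphism int -> C})). Qed.

Lemma inOKB z w : inOK d z -> inOK d w -> inOK d (z - w).
Proof.
move=> /inOKP[hz iz] /inOKP[hw iw]; apply/inOKP; split; first exact: inKB.
exact: (@integral_sub _ _ (intr : {rmorphism int -> C})).
Qed.

Lemma inOK_int_mul (n : int) z : inOK d z -> inOK d (n%:~R * z).
Proof.
move=> /inOKP[hz iz]; apply/inOKP; split; first exact: inK_int_mul.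
by apply: (@integral_mul _ _ (intr : {rmorphism int -> C})) => //; apply: int_over_int.
Qed.

Lemma inOK_int (n : int) : inOK d (n%:~R : C).
Proof. by apply/inOKP; split; [apply: inK_int|apply: int_over_int]. Qed.

Lemma inOK_addgrp : addgrp (@inOK R d).
Proof. by split; [exact: (inOK_int 0)|exact: inOKB]. Qed.

Lemma inOK_trnm a b : inOK d (ratr a + ratr b * s) ->
  exists t n : int, a *+ 2 = t%:~R /\ a ^+ 2 + d%:R * b ^+ 2 = n%:~R.
Proof.
move=> /inOKP[_ iz]; set z := _ + _ in iz.
have zc : z^* = ratr a - ratr b * s by rewrite /z conj_K.
have izc : int_over z^*.
  have := @integral_rmorph _ _ _ (intr : {rmorphism int -> C}) (Num.conj : {rmorphism C -> C}) z iz.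
  by case=> p mp hp; exists p => //; move: hp; rewrite (@eq_map_poly _ _ _ intr) // => x; rewrite /= rmorph_int.
have [t Et] : exists t : int, a *+ 2 = t%:~R.
  apply: (@integral_rat_int C).
  have -> : ratr (a *+ 2) = z + z^* by rewrite zc /z rmorphMn /=; ring.
  exact: (@integral_add _ _ (intr : {rmorphism int -> C})).
have [n En] : exists n : int, a ^+ 2 + d%:R * b ^+ 2 = n%:~R.
  apply: (@integral_rat_int C).
  have -> : ratr (a ^+ 2 + d%:R * b ^+ 2) = z * z^*.
    rewrite zc /z rmorphD rmorphM !rmorphXn /= ratr_nat.
    have -> : (ratr a + ratr b * s) * (ratr a - ratr b * s) = ratr a ^+ 2 - ratr b ^+ 2 * (s * s) by ring.
    by rewrite s_sqr; ring.
  exact: (@integral_mul _ _ (intr : {rmorphism int -> C})).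
by exists t, n.
Qed.

Lemma inOK_of_trnm z (t n : int) : inK d z -> z + z^* = t%:~R -> z * z^* = n%:~R -> inOK d z.
Proof.
move=> hz Et En; split=> //; exists ('X^2 - t *: 'X + n%:P); split.
  have sz : (size (n%:P - t *: 'X)%R <= 2)%N.
    apply: leq_trans (size_polyD _ _) _; rewrite geq_max size_polyN (leq_trans (size_polyC_leq1 _)) //.
    by apply: leq_trans (size_scale_leq _ _) _; rewrite size_polyX.
  by rewrite -addrA addrC [_ + n%:P]addrC monicE lead_coefDr ?size_polyXn ?lead_coefXn // ltnS.
rewrite -mul_polyC rmorphD rmorphB !rmorphM /= !map_polyX !map_polyC !hornerE /=.
have -> : z * z = (z + z^*) * z - z * z^* by ring.
by rewrite Et En; ring.
Qed.

Lemma inOK_s : inOK d s.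
Proof.
apply: (@inOK_of_trnm s 0 d%:Z).
- by exists 0, 1; rewrite rmorph0 rmorph1 add0r mul1r.
- by rewrite s_conj subrr.
- by rewrite s_conj mulrN s_sqr opprK.
Qed.

Lemma inOK_rat (a : rat) : inOK d (ratr a : C) -> exists n : int, a = n%:~R.
Proof. by move=> /inOKP[_]; apply: integral_rat_int. Qed.

Lemma inOK_denom a b : inOK d (ratr a + ratr b * s) -> exists k : int, b = k%:~R / (2 * d)%:R.
Proof.
move=> /inOK_trnm[t [n [Et En]]].
have [k Ek] : exists k : int, b * (2 * d)%:R = k%:~R.
  apply: (@integral_rat_int C).
  (* [(2 d b)^2 = d (4 n - t^2)], because [t = 2 a] and [n = a^2 + d b^2]. *)
  exists ('X^2 - (d%:Z * (4 * n - t ^+ 2))%:P); first by rewrite monicXnsubC.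
  apply/rootP; rewrite rmorphB /= map_polyXn map_polyC !hornerE /=.
  apply/eqP; rewrite subr_eq0 -rmorphXn /= -[X in _ == X]ratr_int; apply/eqP; congr ratr.
  rewrite !(rmorphM, rmorphB, rmorphXn) /= -En -Et -[d%:~R]/(d%:R) natrM; ring.
exists k; rewrite -Ek mulfK // pnatr_eq0 muln_eq0 /= -lt0n //.
Qed.

(** The coefficients of [sqrtmd d] in elements of [O_K], multiplied by [2 d], form a subgroup [g Z]
    of [Z]. An element realising [g], together with 1, is a basis of [O_K], as rational integral
    elements are integers. This avoids cases modulo 4 and the squarefree part of [d]. *)
Lemma quad_exists : exists Q : quad C,
  (forall z, inK d z <-> ratspan (qgen Q) z) /\
  (forall n z, inOrder d n z <-> order_of (qgen Q) n z).
Proof.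
have d20 : ((2 * d)%:R : rat) != 0 by rewrite pnatr_eq0 muln_eq0 /= -lt0n.
pose H (k : int) := exists a : rat, inOK d (ratr a + ratr (k%:~R / (2 * d)%:R) * s).
have [g hg] : exists g : nat, forall k, H k <-> (g %| k)%Z.
  apply: addgrp_int; split; first by exists 0; rewrite rmorph0 mul0r rmorph0 mul0r addr0; apply: (inOK_int 0).
  move=> k l [a ha] [b hb]; exists (a - b); have := inOKB ha hb; congr (inOK d _).
  by rewrite !rmorphB /= mulrBl rmorphB /=; ring.
have g0 : g != 0%N.
  apply/eqP => g0; have : H (2 * d)%:Z.
    exists 0; have := inOK_s; congr (inOK d _).
    by rewrite rmorph0 add0r -[(2 * d)%:Z%:~R]/((2 * d)%:R) divff // rmorph1 mul1r.
  by move/hg; rewrite g0 dvd0z; lia.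
have [a ha] := (hg g).2 (dvdzz g).
set b := g%:Z%:~R / (2 * d)%:R in ha; set om := ratr a + ratr b * s in ha.
have b0 : b != 0 by rewrite mulf_neq0 ?invr_eq0 // intr_eq0.
have omc : om^* = ratr a - ratr b * s by rewrite /om conj_K.
have hOK z : inOK d z <-> exists i j : int, z = i%:~R + j%:~R * om.
  split=> [hz|[i [j ->]]]; last first.
    by apply: (addgrpD inOK_addgrp); [apply: inOK_int|apply: inOK_int_mul].
  have [[x [y Ez]] _] := hz; have [k Ek] : exists k : int, y = k%:~R / (2 * d)%:R.
    by apply: (@inOK_denom x); rewrite -Ez.
  have /hg/dvdzP[j Ej] : H k by exists x; rewrite -Ek -Ez.
  have Ezj : z - j%:~R * om = ratr (x - j%:~R * a).
    have -> : z = ratr x + j%:~R * ratr b * s.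
      have Ey : y = j%:~R * b by rewrite Ek Ej rmorphM /= -mulrA.
      by rewrite Ez Ey [ratr (_ * _)]rmorphM /= ratr_int.
    by rewrite /om [ratr (_ - _)]rmorphB /= [ratr (_ * a)]rmorphM /= ratr_int; ring.
  have [i Ei] : exists i : int, x - j%:~R * a = i%:~R.
    apply: inOK_rat; rewrite -Ezj; apply: inOKB => //; exact: inOK_int_mul.
  by exists i, j; rewrite -(ratr_int C i) -Ei -Ezj subrK.
have hK z : inK d z <-> ratspan om z.
  split=> [[x [y ->]]|[n [i [j [n0 E]]]]].
    have [i [j Es]] := (hOK s).1 inOK_s.
    pose D := denq x * denq y.
    have D0 : 0 < D by rewrite mulr_gt0 ?denq_gt0.
    exists `|D|%N, (numq x * denq y + numq y * denq x * i), (numq y * denq x * j).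
    split; first by rewrite absz_gt0 gt_eqF.
    have -> : (`|D|%N)%:R = D%:~R :> C by rewrite -[LHS]/((`|D|%N%:Z)%:~R) gtz0_abs.
    have Ex : (denq x)%:~R * ratr x = (numq x)%:~R :> C.
      by rewrite /ratr mulrC divfK // intr_eq0 denq_neq0.
    have Ey : (denq y)%:~R * ratr y = (numq y)%:~R :> C.
      by rewrite /ratr mulrC divfK // intr_eq0 denq_neq0.
    rewrite {1}Es /D !(rmorphD, rmorphM) /= -Ex -Ey; ring.
  have nC : (n%:R : C) != 0 by rewrite pnatr_eq0 -lt0n.
  have nQ : (n%:R : rat) != 0 by rewrite pnatr_eq0 -lt0n.
  have [[x [y Exy]] _] : inOK d (n%:R * z) by apply/hOK; exists i, j.
  exists (x / n%:R), (y / n%:R); apply: (mulfI nC); rewrite Exy !fmorph_div /= !ratr_nat.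
  by field.
have [t [n [Et En]]] := inOK_trnm ha.
have omt : om + om^* = t%:~R.
  by rewrite omc /om -(ratr_int C t) -Et rmorphMn /=; ring.
have omn : om * om^* = n%:~R.
  rewrite omc /om -(ratr_int C n) -En rmorphD rmorphM !rmorphXn /= ratr_nat.
  have -> : (ratr a + ratr b * s) * (ratr a - ratr b * s) = ratr a ^+ 2 - ratr b ^+ 2 * (s * s) by ring.
  by rewrite s_sqr; ring.
have omi : om != om^*.
  rewrite -subr_eq0 omc; have -> : om - (ratr a - ratr b * s) = 2%:R * (ratr b * s) by rewrite /om; ring.
  by rewrite mulf_neq0 ?pnatr_eq0 // mulf_neq0 ?s_neq0 // fmorph_eq0.
have omm z : ratspan om z -> (exists t : int, z + z^* = t%:~R) ->
    (exists n : int, z * z^* = n%:~R) -> order_of om 1 z.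
  move=> /hK hz [t' Et'] [n' En'].
  have /hOK[i [j ->]] := inOK_of_trnm hz Et' En'.
  by exists i, j; rewrite mul1r.
exists (Quad omt omn omi omm) => /=; split=> // m z; split.
  move=> [i [w [/hOK[j [k ->]] ->]]]; exists (i + m%:Z * j), k.
  by rewrite rmorphD rmorphM /=; ring.
move=> [i [j ->]]; exists i, (j%:~R * om); split; last by ring.
exact: inOK_int_mul.
Qed.

End ImaginaryQuadratic.

(** * Counting equivalence classes *)

Lemma dep_choice (X Y : Type) (R : X -> Y -> Prop) :
  (forall x, exists y, R x y) -> exists f : X -> Y, forall x, R x (f x).
Proof.
move=> h; exists (fun x => proj1_sig (constructive_indefinite_description _ (h x))) => x.
exact: proj2_sig.
Qed.

Section Counting.
Local Open Scope nat_scope.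
Variables (X : Type) (P : X -> Prop) (eqv : X -> X -> Prop).

Definition equiv_on : Prop :=
  [/\ forall x, P x -> eqv x x,
      forall x y, P x -> P y -> eqv x y -> eqv y x &
      forall x y z, P x -> P y -> P z -> eqv x y -> eqv y z -> eqv x z].

Lemma count_le m n : equiv_on -> count_is P eqv m -> count_is P eqv n -> m <= n.
Proof.
move=> [rf sm ts] [f [fP fi fs]] [g [gP gi gs]].
have [h hh] := dep_choice (fun i => gs _ (fP i)).
rewrite -(card_ord m) -(card_ord n); apply: (@leq_card _ _ h) => i j E.
apply: fi; apply: (ts _ (g (h i))) => //; rewrite E; apply: sm => //.
Qed.

Lemma count_unique m n : equiv_on -> count_is P eqv m -> count_is P eqv n -> m = n.
Proof. by move=> heq hm hn; apply/eqP; rewrite eqn_leq !count_le. Qed.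

(** The choice behind [num_classes] is meaningful once some count is known to exist; this is what
    [lat_finite] and [supers_finite] are for. *)
Lemma num_classesP m : count_is P eqv m -> count_is P eqv (num_classes P eqv).
Proof. by move=> h; apply: (epsilon_spec (inhabits 0)); exists m. Qed.

Lemma num_classes_eq m : equiv_on -> count_is P eqv m -> num_classes P eqv = m.
Proof. by move=> heq h; apply: (count_unique heq (num_classesP h) h). Qed.

(** The two sides correspond through a relation, total in both directions, because the
    correspondences used below depend on choices of bases, matrices or generators. *)
Lemma count_transfer (Y : Type) (Q : Y -> Prop) (eqY : Y -> Y -> Prop) (R : X -> Y -> Prop) m :
  (forall x, P x -> exists2 y, Q y & R x y) -> (forall y, Q y -> exists2 x, P x & R x y) ->
  (forall x x' y y', P x -> P x' -> Q y -> Q y' -> R x y -> R x' y' ->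
     eqv x x' <-> eqY y y') ->
  count_is Q eqY m -> count_is P eqv m.
Proof.
move=> tX tY hR [f [fQ fi fs]].
have [g hg] : exists g : 'I_m -> X, forall i, P (g i) /\ R (g i) (f i).
  by apply: (@dep_choice _ _ (fun i x => P x /\ R x (f i))) => i; have [x Px Rx] := tY _ (fQ i); exists x.
exists g; split=> [i|i j E|x Px]; first by case: (hg i).
  have [Pi Ri] := hg i; have [Pj Rj] := hg j; apply: fi.
  by apply/(hR _ _ _ _ Pi Pj _ _ Ri Rj).
have [y Qy Rxy] := tX _ Px; have [i Ei] := fs _ Qy; exists i; have [Pi Ri] := hg i.
by apply/(hR _ _ _ _ Px Pi _ _ Rxy Ri).
Qed.

Lemma count_ext (P' : X -> Prop) m : (forall x, P x <-> P' x) -> count_is P eqv m -> count_is P' eqv m.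
Proof. by move=> h; rewrite (set_ext h). Qed.

Lemma count_reps (T : eqType) (l : seq T) (f : T -> X) : uniq l ->
  (forall t, t \in l -> P (f t)) ->
  (forall t t', t \in l -> t' \in l -> eqv (f t) (f t') -> t = t') ->
  (forall x, P x -> exists2 t, t \in l & eqv x (f t)) -> count_is P eqv (size l).
Proof.
move=> ul hP hi hs; exists (fun i => f (tnth (in_tuple l) i)); split.
- by move=> i; apply: hP; apply: mem_tnth.
- move=> i j /hi E; apply/(tuple_uniqP (in_tuple l)) => //.
  by apply: E; apply: mem_tnth.
- move=> x /hs[t tl E]; have /tnthP[i Ei] : t \in in_tuple l by [].
  by exists i; rewrite -Ei.
Qed.

(** In a covering family of least size no two members are equivalent, as one of them could be
    dropped. *)
Lemma count_cover k (f : 'I_k -> X) : equiv_on ->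
  (forall i, P (f i)) -> (forall x, P x -> exists i, eqv x (f i)) -> exists m, count_is P eqv m.
Proof.
move=> [rf sm ts] hP hs.
have [|m [g [gP gs]] gmin] := @ex_min_nat (fun k => exists f : 'I_k -> X,
  (forall i, P (f i)) /\ (forall x, P x -> exists i, eqv x (f i))); first by exists k, f.
exists m, g; split=> // i j E; apply/eqP; apply/negPn/negP => ij.
case: m g gP gs gmin i j E ij => [|m] g gP gs gmin i j E ij; first by case: i E ij.
have h := gmin m; rewrite ltnn in h; suff : false by []; apply: h.
exists (g \o lift j); split=> [l|x /[dup] Px /gs[l hl]] /=; first exact: gP.
case: (unliftP j l) => [l' El|El]; first by exists l'; rewrite -El.
case: (unliftP j i) => [i' Ei|Ei]; last by rewrite Ei eqxx in ij.
by exists i'; rewrite -Ei; apply: (ts _ (g j)) => //; rewrite -?El //; apply: sm; rewrite // El.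
Qed.

Lemma count_code (T : finType) (code : X -> T) : equiv_on ->
  (forall x y, P x -> P y -> code x = code y -> eqv x y) -> exists m, count_is P eqv m.
Proof.
move=> heq inj; have [rf sm ts] := heq.
case: (classic (exists x, P x)) => [[x0 Px0]|hn]; last first.
  exists 0; exists (fun i : 'I_0 => match i with Ordinal m lt => match notF lt with end end).
  by split=> [[]|[]|x Px] //; case: hn; exists x.
have [f hf] : exists f : T -> X, forall t, P (f t) /\ ((exists2 x, P x & code x = t) -> code (f t) = t).
  apply: (@dep_choice _ _ (fun t y => P y /\ ((exists2 x, P x & code x = t) -> code y = t))) => t.
  case: (classic (exists2 x, P x & code x = t)) => [[x Px E]|hn].
    by exists x.
  by exists x0; split=> // /hn.
apply: (@count_cover #|T| (fun i => f (enum_val i)) heq) => [i|x Px]; first by case: (hf (enum_val i)).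
exists (enum_rank (code x)); rewrite enum_rankK; have [h1 h2] := hf (code x).
by apply: inj => //; rewrite h2 //; exists x.
Qed.

End Counting.

Section CountSum.
Local Open Scope nat_scope.
Variables (X : Type) (eqv : X -> X -> Prop).
Implicit Types P : X -> Prop.

Lemma count_or P1 P2 m n :
  (forall x y, P1 x -> P2 y -> ~ eqv x y /\ ~ eqv y x) ->
  count_is P1 eqv m -> count_is P2 eqv n -> count_is (fun x => P1 x \/ P2 x) eqv (m + n).
Proof.
move=> dj [f [fP fi fs]] [g [gP gi gs]].
exists (fun i => match split i with inl j => f j | inr j => g j end); split.
- by move=> i; case: (split i) => j; [left|right].
- move=> i j; case: (splitP i) => k Ek; case: (splitP j) => l El E; apply: val_inj; rewrite /= Ek El.
  + by rewrite (fi _ _ E).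
  + by case: (dj _ _ (fP k) (gP l)).
  + by case: (dj _ _ (fP l) (gP k)) => _ /(_ E).
  + by rewrite (gi _ _ E).
- move=> x [/fs[i hi]|/gs[i hi]].
    exists (lshift n i); case: splitP => j /= Ej; first by have -> : j = i by apply: val_inj.
    by have := ltn_ord i; rewrite Ej ltnNge leq_addr.
  exists (rshift m i); case: splitP => j /= Ej; first by have := ltn_ord j; rewrite -Ej ltnNge leq_addr.
  by have -> : j = i by apply: val_inj; apply/eqP; rewrite -(eqn_add2l m) Ej.
Qed.

Lemma count_sum (I : eqType) (s : seq I) P (c : X -> I -> Prop) (n : I -> nat) : uniq s ->
  (forall x, P x -> exists2 i, i \in s & c x i) ->
  (forall x y i j, P x -> P y -> eqv x y -> c x i -> c y j -> i = j) ->
  (forall i, i \in s -> count_is (fun x => P x /\ c x i) eqv (n i)) ->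
  count_is P eqv (\sum_(i <- s) n i).
Proof.
elim: s P => [|i s IH] P.
  move=> _ tot _ _; rewrite big_nil.
  exists (fun i : 'I_0 => match i with Ordinal m lt => match notF lt with end end).
  by split=> [[]|[]|x /tot[]].
move=> /andP[is_ us] tot unq cnt; rewrite big_cons.
have E : forall x, (P x /\ c x i) \/ (P x /\ exists2 j, j \in s & c x j) <-> P x.
  move=> x; split=> [[[]|[]]//|Px]; have [j] := tot _ Px; rewrite inE => /orP[/eqP->|js] cx.
    by left.
  by right; split=> //; exists j.
apply: (count_ext E); apply: count_or.
- move=> x y [Px cx] [Py [j js cy]]; split=> e.
    by move: is_; rewrite (unq _ _ _ _ Px Py e cx cy) js.
  by move: is_; rewrite -(unq _ _ _ _ Py Px e cy cx) js.
- by apply: cnt; rewrite inE eqxx.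
- apply: IH => //.
  + by move=> x [].
  + by move=> x y k l [Px _] [Py _]; apply: unq.
  + move=> j js; apply: (@count_ext _ (fun x => P x /\ c x j)); last by apply: cnt; rewrite inE js orbT.
    by move=> x; split=> [[Px cx]|[[Px _] cx]] //; split=> //; split=> //; exists j.
Qed.

Lemma count_fiber (Y : Type) (Q : Y -> Prop) (eqY : Y -> Y -> Prop) (p : X -> Y) P m n :
  equiv_on Q eqY ->
  (forall x, P x -> Q (p x)) -> (forall x x', P x -> P x' -> eqv x x' -> eqY (p x) (p x')) ->
  count_is Q eqY m -> (forall y, Q y -> count_is (fun x => P x /\ eqY (p x) y) eqv n) ->
  count_is P eqv (m * n).
Proof.
move=> [rf sm ts] PQ cmp [f [fQ fi fs]] fib.
have -> : m * n = \sum_(i <- enum 'I_m) n by rewrite big_enum sum_nat_const card_ord.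
apply: (@count_sum _ _ P (fun x i => eqY (p x) (f i)) (fun _ => n)).
- exact: enum_uniq.
- by move=> x /PQ/fs[i hi]; exists i => //; rewrite mem_enum.
- move=> x y i j Px Py e hi hj; apply: fi; apply: (ts _ (p x)) => //; [exact: PQ| |].
    by apply: sm => //; apply: PQ.
  by apply: (ts _ (p y)) => //; [apply: PQ|apply: PQ|apply: cmp].
- by move=> i _; apply: fib.
Qed.

End CountSum.

(** * Counting lines *)

Lemma coprimez_absz (k : int) (N : nat) :
  coprime `|k| N <-> exists u v : int, u * k + v * N%:Z = 1.
Proof.
split=> [c|[u [v E]]].
  have [u [v E]] := Bezoutz k N; exists u, v; rewrite E /gcdz /=.
  by move/eqP: c => ->.
rewrite /coprime -dvdn1; have : ((gcdn `|k| N)%:Z %| (u * k + v * N%:Z))%Z.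
  by apply: rpredD; apply: dvdz_mull; rewrite dvdzE /= ?dvdn_gcdl ?dvdn_gcdr.
by rewrite E dvdzE.
Qed.

Lemma phi_u_reps (N : nat) : (0 < N)%N -> exists s : seq nat, [/\ uniq s, size s = phi_u N,
  forall k, k \in s -> coprime k N,
  forall k l, k \in s -> l \in s ->
    (N%:Z %| k%:Z - l%:Z)%Z \/ (N%:Z %| k%:Z + l%:Z)%Z -> k = l &
  forall k : int, coprime `|k| N -> exists2 l, l \in s &
    (N%:Z %| k - l%:Z)%Z \/ (N%:Z %| k + l%:Z)%Z].
Proof.
move=> N0; have [N2|N2] := leqP N 2.
  exists [:: 1%N]; rewrite /phi_u N2; split=> //.
  - by move=> k; rewrite inE => /eqP->; rewrite coprime1n.
  - by move=> k l; rewrite !inE => /eqP-> /eqP->.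
  - move=> k c; exists 1%N; rewrite ?inE //.
    have [N1|N2'] : N = 1%N \/ N = 2%N by lia.
      by left; rewrite N1 dvd1z.
    left; rewrite N2' in c *; rewrite coprimen2 in c.
    rewrite dvdzE /= dvdn2; move: c; lia.
exists [seq k <- iota 1 N./2 | coprime k N]; split.
- by rewrite filter_uniq // iota_uniq.
- by rewrite /phi_u leqNgt N2 /= half_totient // -muln2 mulnK.
- by move=> k; rewrite mem_filter => /andP[].
- move=> k l; rewrite !mem_filter !mem_iota => /andP[ck kI] /andP[cl lI].
  case=> /dvdzP[q Eq].
    have : q = 0 by nia.
    by move=> q0; rewrite q0 in Eq; lia.
  have [q0|q1] : q = 0 \/ q = 1 by nia.
    by rewrite q0 in Eq; lia.
  by rewrite q1 in Eq; lia.
- move=> k c; have NZ : N%:Z != 0 by lia.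
  have r0 := modz_ge0 k NZ; have rlt : (k %% N)%Z < N by apply: ltz_pmod.
  have Ek := divz_eq k N; set r := (k %% N)%Z in r0 rlt Ek; set q := (k %/ N)%Z in Ek.
  have cr : coprime `|r| N.
    have /coprimez_absz[u [v E]] := c; apply/coprimez_absz; exists u, (v + u * q).
    by rewrite -E [in RHS]Ek; ring.
  have rN : (`|r| < N)%N by lia.
  have Er : r = `|r|%N by lia.
  have rpos : (0 < `|r|)%N.
    by case: `|r|%N cr => //; rewrite /coprime gcd0n => /eqP N1; rewrite N1 in N2.
  have [rh|rh] := leqP `|r|%N N./2.
    exists `|r|%N; first by rewrite mem_filter cr mem_iota rpos add1n ltnS.
    by left; rewrite -Er Ek; apply/dvdzP; exists q; ring.
  exists (N - `|r|)%N.
    rewrite mem_filter coprime_subl ?cr 1?ltnW // mem_iota add1n ltnS; lia.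
  right; apply/dvdzP; exists (q + 1); rewrite -subzn 1?ltnW // -Er Ek; ring.
Qed.

Definition asb (P : Prop) : bool := if excluded_middle_informative P then true else false.
Lemma asbP P : asb P <-> P.
Proof. by rewrite /asb; case: (excluded_middle_informative P). Qed.

(** * Finiteness, and counts of overlattices, sublattices and generators *)

Section Counts.
Variables (C : numClosedFieldType) (Q : quad C).
Local Notation om := (qgen Q).
Local Notation inQ := (ratspan om).
Local Notation Ord := (order_of om).
Local Notation latt := (latt Q).
Local Notation lat := (lat Q).
Implicit Types (A B D M I S : C -> Prop).

(** A subgroup between [O_a] and [n^-1 O_a] is determined by which of the [n^2] representatives of
    the quotient it contains. *)
Definition between_code (a n : nat) S : {ffun 'I_n * 'I_n -> bool} :=
  [ffun p : 'I_n * 'I_n => asb (S (((p.1 : nat)%:R + (p.2 : nat)%:R * (a%:R * om)) / n%:R))].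

Lemma between_code_sub a n S S' : (0 < n)%N -> addgrp S -> addgrp S' ->
  (forall z, Ord a z -> S z) -> (forall z, Ord a z -> S' z) ->
  (forall z, S z -> Ord a (n%:R * z)) ->
  between_code a n S = between_code a n S' -> forall z, S z -> S' z.
Proof.
move=> n0 sS sS' OS OS' Sn E z Sz; have nC := natr_neq0 C n0.
have [i [j Ez]] := Sn _ Sz; have nZ : n%:Z != 0 by lia.
have key (t : int) : exists (r : 'I_n) (q : int), t = q * n%:Z + (r : nat)%:Z.
  have r0 := modz_ge0 t nZ; have rlt : (t %% n)%Z < n by apply: ltz_pmod.
  have rn : (`|(t %% n)%Z| < n)%N by lia.
  by exists (Ordinal rn), (t %/ n)%Z; rewrite /= gez0_abs // -divz_eq.
have [r [q Ei]] := key i; have [r' [q' Ej]] := key j.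
pose z0 := ((r : nat)%:R + (r' : nat)%:R * (a%:R * om)) / n%:R.
pose z1 := q%:~R + q'%:~R * (a%:R * om).
have Oz1 : Ord a z1 by exists q, q'.
have Ezz : z = z0 + z1.
  by apply: (mulfI nC); rewrite Ez Ei Ej !(rmorphD, rmorphM) /= /z0 /z1; field.
have Sz0 : S z0 by rewrite -[z0](addrK z1) -Ezz; apply: (addgrpB sS) => //; apply: OS.
have : between_code a n S (r, r') by rewrite ffunE; apply/asbP.
rewrite E ffunE => /asbP /= S'z0; rewrite Ezz.
by apply: (addgrpD sS') => //; apply: OS'.
Qed.

Definition homoth M M' : Prop := exists2 lam : C, lam != 0 & M' = scl lam M.

Lemma homoth_equiv P : equiv_on P homoth.
Proof.
split=> [M _|M M' _ _ [lam l0 ->]|M M' M'' _ _ _ [lam l0 ->] [mu m0 ->]].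
- by exists 1; rewrite ?oner_eq0 // scl1.
- by exists lam^-1; rewrite ?invr_eq0 // sclK.
- by exists (mu * lam); rewrite ?mulf_neq0 // scl_scl.
Qed.

(** By [lat_short] every lattice can be rescaled to lie between [O_l] and [n^-1 O_l], with the same
    [n] for all; [F] chooses the rescaled lattice. *)
Lemma lat_finite l : (0 < l)%N -> exists m, count_is (fun M => lat M l) homoth m.
Proof.
move=> l0; have [n n0 short] := lat_short Q l0.
have [F hF] : exists F : (C -> Prop) -> (C -> Prop), forall M, lat M l ->
    [/\ homoth M (F M), addgrp (F M), forall z, Ord l z -> F M z & forall z, F M z -> Ord l (n%:R * z)].
  apply: (@dep_choice _ _ (fun M M' => lat M l -> [/\ homoth M M', addgrp M',
    forall z, Ord l z -> M' z & forall z, M' z -> Ord l (n%:R * z)])) => M.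
  case: (classic (lat M l)) => lM; last by exists M.
  have [x [Mx x0 hx]] := short _ lM; exists (scl x^-1 M) => _; split.
  - by exists x^-1; rewrite // invr_eq0.
  - by apply: addgrp_scl; apply: lat_addgrp lM.
  - by move=> z Oz; rewrite /scl invrK mulrC; apply: (lat_stable lM).
  - by move=> z; rewrite /scl invrK => /hx; rewrite mulrAC divff // mul1r.
apply: (@count_code _ _ _ _ (fun M => between_code l n (F M))) => [|M M' lM lM' E].
  exact: homoth_equiv.
have [hM sM OM Mn] := hF _ lM; have [hM' sM' OM' Mn'] := hF _ lM'.
have EF : F M = F M'.
  apply: set_ext => z; split.
    exact: (between_code_sub n0 sM sM' OM OM' Mn E).
  exact: (between_code_sub n0 sM' sM OM' OM Mn' (esym E)).
have [_ sy tr] := homoth_equiv (fun _ => True).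
by apply: (tr _ (F M)) => //; rewrite EF; apply: sy.
Qed.

Definition supers A (N b : nat) S : Prop :=
  exists be, [/\ S = addZ A be, ordmod A be N & lat S b].

Lemma supers_finite a N b : (0 < a)%N -> (0 < N)%N ->
  exists m, count_is (supers (Ord a) N b) (@eq _) m.
Proof.
move=> a0 N0; apply: (@count_code _ _ _ _ (fun S => between_code a N S)) => [|S S' h h' E].
  by split=> // x y z _ _ _ -> ->.
have aux T : supers (Ord a) N b T ->
    [/\ addgrp T, forall z, Ord a z -> T z & forall z, T z -> Ord a (N%:R * z)].
  move=> [be [ET hN lT]]; split; first exact: lat_addgrp lT.
    by move=> z Oz; rewrite ET; apply: addZ_self.
  have sO := addgrp_Ord Q a.
  move=> z; rewrite ET => -[x [k [Ox ->]]].
  have -> : N%:R * (x + k%:~R * be) = N%:R * x + k%:~R * (N%:Z%:~R * be) by ring.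
  apply: (addgrpD sO); first exact: addgrp_nat_mul.
  by apply: (addgrp_int_mul _ sO); apply/hN; apply: dvdzz.
have [s1 s2 s3] := aux _ h; have [t1 t2 t3] := aux _ h'.
apply: set_ext => z; split.
  exact: (between_code_sub N0 s1 t1 s2 t2 s3 E).
exact: (between_code_sub N0 t1 s1 t2 s2 t3 (esym E)).
Qed.

(* D and O_f are compared through an x in D with index [D : O_f x] prime to N. *)
Lemma supers_transport D f N b m : lat D f -> (0 < N)%N ->
  count_is (supers (Ord f) N b) (@eq _) m -> count_is (supers D N b) (@eq _) m.
Proof.
move=> lD N0; have [x [n [Dx x0 cop n0 hn]]] := lat_coprime_elt lD N0.
have f0 := lat_gt0 lD; have hx := latt_inQ (lat_latt lD) Dx.
have lA : lat (scl x (Ord f)) f by apply: lat_scl => //; apply: lat_Ord.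
have AD z : scl x (Ord f) z -> D z.
  by rewrite /scl => h; rewrite -[z](mulVKf x0) mulrC; apply: (lat_stable lD).
have nDA z : D z -> scl x (Ord f) (n%:R * z) by move/hn; rewrite /scl; congr (Ord f _); ring.
pose R (S S' : C -> Prop) :=
  exists2 be, ordmod (scl x (Ord f)) be N & S = addZ D be /\ scl x S' = addZ (scl x (Ord f)) be.
apply: (@count_transfer _ _ _ _ _ _ R).
- move=> S [be [ES hbe lS]]; have [ga hga Ega] := transport_surj lA lD AD nDA cop n0 hbe.
  exists (scl x^-1 (addZ (scl x (Ord f)) ga)); last first.
    by exists ga => //; rewrite ES Ega sclVK.
  exists (x^-1 * ga); split.
  + by rewrite addZ_scl ?invr_eq0 // sclK.
  + by move=> k; rewrite -hga /scl mulrCA.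
  + apply: lat_scl; rewrite ?invr_eq0 //; first exact: inQ_inv.
    by apply/(transport_lat lA lD AD nDA cop n0 N0 b hga); rewrite Ega -ES.
- move=> S [be [ES hbe lS]].
  have hga : ordmod (scl x (Ord f)) (x * be) N.
    by move=> k; rewrite -hbe /scl mulrCA mulKf.
  have EA : scl x S = addZ (scl x (Ord f)) (x * be) by rewrite ES addZ_scl.
  exists (addZ D (x * be)); last by exists (x * be).
  exists (x * be); split=> //.
    exact: (transport_ordmod lA AD nDA cop n0 hga).
  by apply/(transport_lat lA lD AD nDA cop n0 N0 b hga); rewrite -EA; apply: lat_scl.
- move=> S T S' T' _ _ _ _ [be hbe [ES ES']] [ga hga [ET ET']]; split=> E.
    apply: (scl_inj x0); rewrite ES' ET'.
    by apply: (transport_inj lA AD nDA cop n0 hbe hga); rewrite -ES -ET.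
  rewrite ES ET; apply: set_ext => z.
  have Eb : addZ (scl x (Ord f)) be = addZ (scl x (Ord f)) ga by rewrite -ES' -ET' E.
  have aux be1 be2 : addZ (scl x (Ord f)) be1 = addZ (scl x (Ord f)) be2 -> addZ D be1 z -> addZ D be2 z.
    move=> E12 [y [k [Dy ->]]].
    have : addZ (scl x (Ord f)) be2 be1.
      by rewrite -E12; apply: addZ_gen; apply: lat_addgrp lA.
    case=> y' [k' [/AD Dy' ->]]; exists (y + k%:~R * y'), (k * k'); split.
      apply: (addgrpD (lat_addgrp lD)) => //; apply: addgrp_int_mul => //; exact: lat_addgrp lD.
    by rewrite rmorphM /=; ring.
  by split; apply: aux.
Qed.

Definition subs D (N g : nat) I : Prop :=
  lat I g /\ exists2 v, D = addZ I v & ordmod I v N.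

Lemma subs_supers D N g m : latt D -> (0 < N)%N ->
  count_is (supers D N g) (@eq _) m -> count_is (subs D N g) (@eq _) m.
Proof.
move=> lD N0; have NC := natr_neq0 C N0.
have hNv : inQ N%:R^-1 by apply: inQ_inv; apply: inQ_nat.
apply: (@count_transfer _ _ _ _ _ _ (fun I S => S = scl N%:R^-1 I)).
- move=> I [lI [v ED hv]]; have [be Ebe hbe] := dual_cyclic lD (lat_addgrp lI) N0 ED hv.
  exists (scl N%:R^-1 I) => //; exists be; split=> //.
  by apply: lat_scl; rewrite ?invr_eq0.
- move=> S [be [ES hbe lS]].
  have [v ED hv] := dual_cyclicV lD (latt_addgrp lD) (lat_latt lS) N0 ES hbe.
  exists (scl N%:R S); last by rewrite sclK.
  split; last by exists v.
  by apply: lat_scl => //; apply: inQ_nat.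
- move=> I I' S S' _ _ _ _ -> ->; split=> [->//|]; apply: scl_inj.
  by rewrite invr_eq0.
Qed.

Definition gens D (N g : nat) (p : (C -> Prop) * C) : Prop :=
  [/\ lat p.1 g, D = addZ p.1 p.2 & ordmod p.1 p.2 N].
Definition gens_eq (p p' : (C -> Prop) * C) : Prop :=
  p'.1 = p.1 /\ (p.1 (p'.2 - p.2) \/ p.1 (p'.2 + p.2)).

Lemma gens_fiber D N g I : (0 < N)%N -> subs D N g I ->
  count_is (fun p => gens D N g p /\ p.1 = I) gens_eq (phi_u N).
Proof.
move=> N0 [lI [v0 ED h0]]; have sI := lat_addgrp lI.
have [s [us <- cops injs surjs]] := phi_u_reps N0.
have congr_mod (i j : int) : I (i%:~R * v0 - j%:~R * v0) <-> (N%:Z %| i - j)%Z.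
  by rewrite -h0 rmorphB mulrBl.
have ord_cop (k : int) : coprime `|k| N -> ordmod I (k%:~R * v0) N /\ addZ I (k%:~R * v0) = D.
  move=> /coprimez_absz[u [t E]]; split=> [j|].
    rewrite mulrA -rmorphM h0; split=> [/dvdzP[q Eq]|h]; last exact: dvdz_mulr.
    apply/dvdzP; exists (u * q + j * t).
    transitivity (j * (u * k + t * N%:Z)); first by rewrite E mulr1.
    transitivity (u * (j * k) + j * t * N%:Z); first by ring.
    by rewrite Eq; ring.
  rewrite ED; apply: set_ext => z; split=> -[x [j [Ix ->]]].
    by exists x, (j * k); rewrite rmorphM /= mulrA.
  exists (x + (j * t)%:~R * (N%:Z%:~R * v0)), (j * u); split.
    by apply: (addgrpD sI) => //; apply: addgrp_int_mul => //; apply/h0; apply: dvdzz.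
  transitivity (x + (j * (u * k + t * N%:Z))%:~R * v0); first by rewrite E mulr1.
  by rewrite !(rmorphM, rmorphD) /=; ring.
apply: (@count_reps _ _ _ _ s (fun k => (I, k%:R * v0))) => //.
- move=> k /cops ck; have [h1 h2] := ord_cop k ck.
  by split=> //; split=> //=.
- move=> k l ks ls [_ /= h]; apply: esym; apply: injs => //.
  case: h => h; [left; exact/congr_mod|right].
  by apply/h0; rewrite rmorphD /= mulrDl.
- move=> [I' v] [[/= lI' EDv hv] EI]; rewrite EI {I' EI lI'} in EDv hv *.
  have [i [k [Ii Ev]]] : addZ I v0 v by rewrite -ED EDv; apply: addZ_gen.
  have hkv : I (k%:~R * v0 - v) by rewrite Ev opprD addrCA subrr addr0; apply: addgrpN.
  have [hk _] := ordmod_addZ_eq sI hv hkv.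
  (* If [g'] is the gcd, [N / g'] already kills [k v0] modulo [I]; so [N] divides [N / g'], and
     [g' = 1]. *)
  have ck : coprime `|k| N.
    pose g' := gcdn `|k| N; have g'0 : (0 < g')%N by rewrite gcdn_gt0 N0 orbT.
    have Ng : (N %| N %/ g')%N.
      suff : (N%:Z %| (N %/ g')%:Z)%Z by [].
      apply/hk; rewrite mulrA -rmorphM; apply/h0.
      have /dvdnP[q Eq] : (g' %| `|k|)%N := dvdn_gcdl _ _.
      rewrite dvdzE abszM /= Eq mulnCA divnK ?dvdn_gcdr //; exact: dvdn_mull.
    have gN : (g' %| N)%N := dvdn_gcdr _ _.
    have EN := divnK gN.
    have Ngp : (0 < N %/ g')%N by rewrite divn_gt0 // dvdn_leq.
    have : (N %/ g' * g' <= N %/ g' * 1)%N by rewrite muln1 EN dvdn_leq.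
    by rewrite leq_pmul2l // /coprime -/g' eqn_leq g'0 andbT.
  have [l ls hl] := surjs _ ck; exists l => //; split=> //=.
  have aux (i' j : int) : I (i'%:~R * v0 + j%:~R * v0) <-> (N%:Z %| i' + j)%Z.
    by rewrite -h0 rmorphD mulrDl.
  case: hl => hl; [left|right].
    have := addgrpN sI (addgrpD sI Ii ((congr_mod k l).2 hl)); congr I.
    by rewrite Ev; ring.
  have := addgrpD sI Ii ((aux k l).2 hl); congr I.
  by rewrite Ev; ring.
Qed.

Lemma gens_count D f N g r : lat D f -> (0 < N)%N ->
  count_is (supers (Ord f) N g) (@eq _) r ->
  count_is (gens D N g) gens_eq (r * phi_u N).
Proof.
move=> lD N0 /(supers_transport lD N0)/(subs_supers (lat_latt lD) N0) hr.
apply: (@count_fiber _ _ _ (subs D N g) (@eq _) (fun p => p.1)) => //.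
- by split=> // x y z _ _ _ -> ->.
- by move=> [I v] [/= lI ED hv]; split=> //; exists v.
- by move=> p p' _ _ [].
- by move=> I hI; apply: gens_fiber.
Qed.

End Counts.

(** * Counting the triples [(M1, M2, v)] *)

Section Triples.
Variables (C : numClosedFieldType) (Q : quad C).
Local Notation om := (qgen Q).
Local Notation inQ := (ratspan om).
Local Notation Ord := (order_of om).
Local Notation lat := (lat Q).
Hypothesis roots : forall z : C, inQ z -> forall n : nat, (0 < n)%N -> z ^+ n = 1 ->
  z = 1 \/ z = -1.
Implicit Types (A B D M I S : C -> Prop) (t : (C -> Prop) * (C -> Prop) * C).

Definition triples D (m1 m2 N : nat) t : Prop :=
  [/\ lat t.1.1 m1, lat t.1.2 m2, D = addZ (mulL t.1.1 t.1.2) t.2 &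
      ordmod (mulL t.1.1 t.1.2) t.2 N].

(** The right side of [twist_equiv], that is, isomorphism of the twisted lattices preserving the
    first axis. *)
Definition trip_eq t t' : Prop := exists al be : C, [/\ al != 0, be != 0,
  t'.1.1 = scl al t.1.1, t'.1.2 = scl be t.1.2 & mulL t'.1.1 t'.1.2 (t'.2 - al * be * t.2)].

Lemma pairs_count D f N g l h r : lat D f -> (0 < N)%N ->
  count_is (fun M => lat M l) (@homoth C) h ->
  count_is (supers Q (Ord f) N g) (@eq _) r ->
  count_is (fun x : (C -> Prop) * ((C -> Prop) * C) => lat x.1 l /\ gens Q D N g x.2)
    (fun x y => homoth x.1 y.1 /\ gens_eq x.2 y.2) (h * (r * phi_u N)).
Proof.
move=> lD N0 hh hr.
apply: (@count_fiber _ _ _ (fun M => lat M l) (@homoth C) (fun x => x.1)) => //.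
- exact: homoth_equiv.
- by move=> x [].
- by move=> x y _ _ [].
move=> M0 lM0; have := gens_count lD N0 hr.
have [_ sy ts] := homoth_equiv (C := C) (fun _ => True).
apply: (@count_transfer _ _ _ _ _ _ (fun x p => x.2 = p)).
- by move=> x [[lx gx] _]; exists x.2.
- by move=> p gp; exists (M0, p) => //; split=> //=; exists 1; rewrite ?oner_eq0 ?scl1.
- move=> x x' p p' [[_ _] hx] [[_ _] hx'] _ _ <- <-; split=> [[]//|E]; split=> //.
  by apply: (ts _ M0) => //; apply: sy.
Qed.

Lemma triples_count D f m1 m2 N h r : lat D f -> (0 < N)%N -> (0 < m1)%N -> (0 < m2)%N ->
  count_is (fun M => lat M (lcmn m1 m2)) (@homoth C) h ->
  count_is (supers Q (Ord f) N (gcdn m1 m2)) (@eq _) r ->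
  count_is (triples D m1 m2 N) trip_eq (h * (r * phi_u N)).
Proof.
move=> lD N0 m10 m20 hh hr; have := pairs_count lD N0 hh hr.
set g := gcdn m1 m2; set l := lcmn m1 m2.
have gm2 : (g %| m2)%N := dvdn_gcdr _ _.
have m1l : (m1 %| l)%N := dvdn_lcml _ _; have m2l : (m2 %| l)%N := dvdn_lcmr _ _.
(* [F] fixes one lift of conductor [m2] for each [I]. As it depends on [I] alone, [M] and [I]
   determine [M2]. *)
have [F hF] : exists F : (C -> Prop) -> (C -> Prop), forall I, lat I g ->
    lat (F I) m2 /\ mulL (F I) (Ord g) = I.
  apply: (@dep_choice _ _ (fun I I0 => lat I g -> lat I0 m2 /\ mulL I0 (Ord g) = I)) => I.
  case: (classic (lat I g)) => lI; last by exists I.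
  by have [I0 h1 h2] := lat_lift lI gm2 m20; exists I0.
have OmM (M : C -> Prop) m : lat M m -> mulL M (Ord m) = M by move=> lM; rewrite mulLC (lat_mul_Ord lM).
pose R t (x : (C -> Prop) * ((C -> Prop) * C)) := [/\ x.2.1 = mulL t.1.1 t.1.2, x.2.2 = t.2,
  mulL x.1 (Ord m1) = t.1.1 & mulL (mulL x.1 (Ord m2)) t.1.2 = F x.2.1].
apply: (@count_transfer _ _ _ _ _ _ R).
- move=> [[M1 M2] v] [/= l1 l2 ED hv]; set I := mulL M1 M2 in ED hv.
  have lI : lat I g by apply: lat_mul.
  have [lF EF] := hF _ lI; have [M2' l2' E2] := lat_inv l2.
  have lJ : lat (mulL (F I) M2') m2 by have := lat_mul lF l2'; rewrite gcdnn.
  have Eg : mulL M1 (Ord g) = mulL (mulL (F I) M2') (Ord g).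
    rewrite mulLAC EF /I -mulLA E2 /g -mulL_Ord mulLA (OmM _ _ l1) //.
  have [lM EM1 EM2] := glue_lat l1 lJ Eg.
  (* Gluing [M1] with [F I] times the inverse of [M2]: both extend to the same lattice over [O_g],
     because [M1 M2 = F I O_g]. *)
  exists ((fun z => M1 z /\ mulL (F I) M2' z), (I, v)); first by split.
  split=> //=; rewrite EM2 -mulLA [mulL M2' _]mulLC E2; exact: OmM.
- move=> [M [I v]] [/= lM [/= lI ED hv]]; have [lF EF] := hF _ lI.
  have lM1 : lat (mulL M (Ord m1)) m1.
    by have := lat_mul_Ordr lM m10; rewrite (gcdn_idPr m1l).
  have lM2 : lat (mulL M (Ord m2)) m2.
    by have := lat_mul_Ordr lM m20; rewrite (gcdn_idPr m2l).
  have [W lW EW] := lat_inv lM2.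
  have lWF : lat (mulL W (F I)) m2 by have := lat_mul lW lF; rewrite gcdnn.
  have EI : mulL (mulL M (Ord m1)) (mulL W (F I)) = I.
    transitivity (mulL (mulL (mulL M (Ord m2)) W) (mulL (Ord m1) (F I))).
      rewrite -{1}(lat_mul_Ord lW) -!mulLA.
      by rewrite [mulL (Ord m1) (mulL (Ord m2) _)]mulLCA [mulL (Ord m1) (mulL W _)]mulLCA.
    by rewrite EW mulLA mulL_Ord gcdnC -/g mulLC.
  exists (mulL M (Ord m1), mulL W (F I), v); first by split; rewrite //= EI.
  by split=> //=; rewrite mulLA EW (lat_mul_Ord lF).
move=> [[M1 M2] v] [[M1' M2'] v'] [M [I u]] [M' [I' u']] [/= l1 l2 ED hv] [/= l1' l2' ED' hv'].
move=> [/= lM [/= lI _ _]] [/= lM' [/= lI' _ _]] [/= EI Eu E1 E2] [/= EI' Eu' E1' E2'].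
subst u u'; have sI := lat_addgrp lI; have sM1 := lat_addgrp l1; have sM2 := lat_addgrp l2.
have lMm2 : lat (mulL M (Ord m2)) m2 by have := lat_mul_Ordr lM m20; rewrite (gcdn_idPr m2l).
rewrite /trip_eq /gens_eq /=; split.
  move=> [al [be [a0 b0 Ea Eb hvv]]].
  have ab0 : al * be != 0 by rewrite mulf_neq0.
  have EII : I' = scl (al * be) I.
    by rewrite EI' EI Ea Eb mulL_scl // scl_mulL // scl_scl mulrC.
  (* Both triples generate the same [D], and the second is [al * be] times the first modulo [I']. By
     [scl_unit] the product is then 1 or -1, so the two scalings are not independent. *)
  have : scl (al * be) D = D.
    rewrite {1}ED -EI addZ_scl // -EII EI' ED' -EI'.
    rewrite -EI' in hvv hv'; have sI' := lat_addgrp lI'.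
    have hvv' : I' (al * be * v - v') by rewrite -opprB; apply: addgrpN.
    by case: (ordmod_addZ_eq sI' hv' hvv').
  move/(scl_unit roots (lat_latt lD) ab0) => hab.
  have EIe : I' = I.
    by rewrite EII; case: hab => ->; rewrite ?sclN ?scl1.
  have bal : be^-1 = al \/ be^-1 = - al.
    case: hab => E; [left|right]; apply: (mulIf b0); rewrite mulVf // ?mulNr E ?opprK //.
  split; last first.
    split=> //; rewrite -EI' EIe in hvv; case: hab => E; rewrite E in hvv.
      by left; rewrite mul1r in hvv.
    by right; rewrite mulN1r opprK in hvv.
  exists al => //.
  have [W lW EW] := lat_inv l2.
  (* As [I' = I] the lifts coincide, so scaling [M2] by [be] scales [M O_m2] by its inverse, which
     is [al] up to sign. The same holds for [M O_m1], and [unglue] gives [M' = al M]. *)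
  have EMm2 : mulL M' (Ord m2) = scl al (mulL M (Ord m2)).
    have lMm2' : lat (mulL M' (Ord m2)) m2.
      by have := lat_mul_Ordr lM' m20; rewrite (gcdn_idPr m2l).
    have : scl be (mulL M' (Ord m2)) = mulL M (Ord m2).
      transitivity (mulL (mulL (mulL M' (Ord m2)) M2') W).
        by rewrite Eb mulL_scl // scl_mulL // -[mulL _ W]mulLA EW (OmM _ _ lMm2').
      by rewrite E2' EIe -E2 -mulLA EW OmM.
    move=> <-; rewrite scl_scl; case: bal => Ebe.
      by rewrite -Ebe mulVf // scl1.
    have -> : al * be = -1 by rewrite -[al]opprK -Ebe mulNr mulVf.
    by rewrite sclN ?scl1 //; apply: addgrp_mulL.
  rewrite -(unglue m10 m20 lM') -(unglue m10 m20 lM) EMm2 E1' Ea -E1.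
  by apply: set_ext.
move=> [[lam l0 EMM] [EII hvv]].
have [e he hve] : exists2 e : C, e = 1 \/ e = -1 & I (v' - e * v).
  case: hvv => hvv; [exists 1|exists (-1)]; [by left|by rewrite mul1r|by right|].
  by rewrite mulN1r opprK.
have e0 : e != 0 by case: he => ->; rewrite ?oppr_eq0 oner_eq0.
(* The product of the two factors must be the sign [e] relating the generators; it does not affect
   [M2], as [-M2 = M2]. *)
exists lam, (e * lam^-1); split=> //.
- by rewrite mulf_neq0 // invr_eq0.
- by rewrite -E1' EMM scl_mulL // E1.
- have [W lW EW] := lat_inv lMm2.
  have E3 : scl lam M2' = M2.
    transitivity (mulL W (mulL (mulL M' (Ord m2)) M2')).
      rewrite EMM !scl_mulL // mulL_scl // mulLA [mulL W _]mulLC EW.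
      by rewrite (lat_mul_Ord l2').
    by rewrite E2' EII -E2 mulLA [mulL W _]mulLC EW (lat_mul_Ord l2).
  have -> : M2' = scl lam^-1 M2 by rewrite -E3 sclK.
  by case: he => ->; rewrite ?mul1r // mulN1r sclN.
- rewrite -EI' EII mulrCA mulfV // mulr1 //.
Qed.

Definition all_triples D (f : nat) t : Prop :=
  exists m1 m2 N, [/\ triples D m1 m2 N t, (0 < N)%N & (lcmn m1 m2 * N = f)%N].

Lemma trip_eq_lat t t' m1 m2 m1' m2' : trip_eq t t' ->
  lat t.1.1 m1 -> lat t.1.2 m2 -> lat t'.1.1 m1' -> lat t'.1.2 m2' -> m1 = m1' /\ m2 = m2'.
Proof.
move=> [al [be [a0 b0 Ea Eb _]]] l1 l2 l1' l2'.
have ha := latt_scl_inQ (lat_latt l1) (lat_latt l1') a0 Ea.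
have hb := latt_scl_inQ (lat_latt l2) (lat_latt l2') b0 Eb.
split; [apply: (lat_inj (lat_scl ha a0 l1))|apply: (lat_inj (lat_scl hb b0 l2))].
  by rewrite -Ea.
by rewrite -Eb.
Qed.

Lemma all_triples_count D f f' (h : nat -> nat) (r : nat -> nat -> nat) :
  lat D f' -> (0 < f)%N ->
  (forall l, (0 < l)%N -> count_is (fun M => lat M l) (@homoth C) (h l)) ->
  (forall g N, (0 < g)%N -> (0 < N)%N -> count_is (supers Q (Ord f') N g) (@eq _) (r g N)) ->
  count_is (all_triples D f) trip_eq
    (\sum_(l <- divisors f) h l * phi_u (f %/ l) *
       \sum_(g <- divisors l) 2 ^ omega (l %/ g) * r g (f %/ l))%N.
Proof.
move=> lD f0 hh hr.
apply: (@count_sum _ _ _ _ _ (fun t l => exists m1 m2,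
  [/\ lat t.1.1 m1, lat t.1.2 m2 & lcmn m1 m2 = l])).
- exact: divisors_uniq.
- move=> t [m1 [m2 [N [[l1 l2 _ _] N0 E]]]]; exists (lcmn m1 m2); last by exists m1, m2.
  by rewrite -dvdn_divisors // -E dvdn_mulr.
- move=> t t' l l' _ _ e [m1 [m2 [l1 l2 <-]]] [m1' [m2' [l1' l2' <-]]].
  by have [-> ->] := trip_eq_lat e l1 l2 l1' l2'.
move=> l; rewrite -dvdn_divisors // => lf.
have l0 : (0 < l)%N := dvdn_gt0 f0 lf.
set N := (f %/ l)%N; have N0 : (0 < N)%N by rewrite divn_gt0 // dvdn_leq.
rewrite big_distrr /=.
apply: (@count_sum _ _ _ _ _ (fun t g => exists m1 m2,
  [/\ lat t.1.1 m1, lat t.1.2 m2 & gcdn m1 m2 = g])).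
- exact: divisors_uniq.
- move=> t [_ [m1 [m2 [l1 l2 E]]]]; exists (gcdn m1 m2); last by exists m1, m2.
  by rewrite -dvdn_divisors // -E (dvdn_trans (dvdn_gcdl _ _)) ?dvdn_lcml.
- move=> t t' g g' _ _ e [m1 [m2 [l1 l2 <-]]] [m1' [m2' [l1' l2' <-]]].
  by have [-> ->] := trip_eq_lat e l1 l2 l1' l2'.
move=> g; rewrite -dvdn_divisors // => gl.
have g0 : (0 < g)%N := dvdn_gt0 l0 gl.
set q := (l %/ g)%N; have q0 : (0 < q)%N by rewrite divn_gt0 // dvdn_leq.
have El : l = (g * q)%N by rewrite mulnC divnK.
(* Equal terms, one for each unitary divisor [x] of [q], that is, for each pair of conductors with
   lcm [l] and gcd [g]. *)
have -> : (h l * phi_u N * (2 ^ omega q * r g N) =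
    \sum_(x <- unitary_divisors q) h l * (r g N * phi_u N))%N.
  rewrite big_const_seq count_predT iter_addn_0 size_unitary_divisors // /omega; ring.
apply: (@count_sum _ _ _ _ _ (fun t x => lat t.1.1 (g * x))).
- by rewrite filter_uniq // divisors_uniq.
- move=> t [[_ [m1 [m2 [l1 l2 Elcm]]]] [m1' [m2' [l1' l2' Eg]]]].
  have E1 := lat_inj l1 l1'; have E2 := lat_inj l2 l2'; subst m1' m2'.
  have gm1 : (g %| m1)%N by rewrite -Eg dvdn_gcdl.
  have gm2 : (g %| m2)%N by rewrite -Eg dvdn_gcdr.
  exists (m1 %/ g)%N; last by rewrite mulnC divnK.
  apply/unitary_divisorsP => //; exists (m2 %/ g)%N; split; last first.
    by rewrite /coprime -(eqn_pmul2r g0) muln_gcdl !divnK // mul1n Eg.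
  apply/eqP; rewrite -(eqn_pmul2r g0) -(eqn_pmul2r g0) [(q * g)%N]mulnC -El.
  rewrite -Elcm -{1}Eg muln_lcm_gcd; apply/eqP.
  by rewrite -{1}(divnK gm1) -{1}(divnK gm2); ring.
- move=> t t' x x' [[_ [m1 [m2 [l1 l2 _]]]] _] [[_ [m1' [m2' [l1' l2' _]]]] _] e lx lx'.
  have [+ _] := trip_eq_lat e lx l2 lx' l2'.
  by move/eqP; rewrite eqn_pmul2l // => /eqP.
move=> x /(unitary_divisorsP _ q0)[y [Eq cxy]].
have [x0 y0] : (0 < x)%N /\ (0 < y)%N by move: q0; rewrite Eq muln_gt0 => /andP[].
have Egcd : gcdn (g * x) (g * y) = g by rewrite -muln_gcdr (eqP cxy) muln1.
have Elcm : lcmn (g * x) (g * y) = l.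
  by rewrite -muln_lcmr El Eq; congr muln; rewrite /lcmn (eqP cxy) divn1.
have gx0 : (0 < g * x)%N by rewrite muln_gt0 g0.
have gy0 : (0 < g * y)%N by rewrite muln_gt0 g0.
apply: (@count_ext _ (triples D (g * x) (g * y) N)); last first.
  by apply: (triples_count lD N0 gx0 gy0); rewrite ?Egcd ?Elcm; [apply: hh|apply: hr].
move=> t; split=> [tt|[[[[m1 [m2 [N' [tt N'0 Ef]]]] [m1' [m2' [l1' l2' El']]]] [m1'' [m2'' [l1'' l2'' Eg'']]]] lx]].
  have [l1 l2 _ _] := tt; split=> //; split; last by exists (g * x)%N, (g * y)%N.
  split; last by exists (g * x)%N, (g * y)%N.
  exists (g * x)%N, (g * y)%N, N; split=> //.
  by rewrite Elcm mulnC divnK.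
have [l1 l2 ED hv] := tt.
have ? := lat_inj l1 l1'; have ? := lat_inj l2 l2'; have ? := lat_inj l1 l1''; have ? := lat_inj l2 l2''.
subst m1' m2' m1'' m2''; have Em1 := lat_inj l1 lx; subst m1.
have Em2 : m2 = (g * y)%N.
  have := muln_lcm_gcd (g * x) m2; rewrite El' Eg'' El Eq.
  move=> E; apply/eqP; rewrite -(eqn_pmul2l gx0) -E; apply/eqP; ring.
subst m2; suff -> : N = N' by [].
by rewrite /N -Ef El' mulKn.
Qed.

End Triples.

(** * From elliptic curves in the surface to triples *)

Section Lines.
Variables (C : numClosedFieldType) (Q : quad C).
Local Notation om := (qgen Q).
Local Notation inQ := (ratspan om).
Local Notation isbas := (isbas Q).
Local Notation latt := (latt Q).
Local Notation latt2 := (latt2 Q).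
Local Notation lat := (lat Q).
Local Notation cond2 := (cond2 Q).
Local Notation cV2 := ('cV[C]_2).
Implicit Types (A B D M I S : C -> Prop) (L : cV2 -> Prop) (x y : cV2).

Definition sublines L x : Prop :=
  x != 0 /\ exists lam mu : C, [/\ L (lam *: x), L (mu *: x) & 'Im (lam * mu^*) != 0].
Definition orbit_rel L x y : Prop :=
  exists M : 'M[C]_2, isoL M L L /\ exists lam : C, lam != 0 /\ M *m x = lam *: y.

Lemma orbit_rel_equiv L (P : cV2 -> Prop) : equiv_on P (orbit_rel L).
Proof.
split=> [x _|x y _ _ [M [iM [lam [l0 E]]]]|x y z _ _ _ [M [iM [lam [l0 E]]]] [M' [iM' [mu [m0 E']]]]].
- exists 1%:M; split; first exact: isoL_id.
  by exists 1; rewrite oner_eq0 mul1mx scale1r.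
- exists (invmx M); split; first exact: isoL_inv.
  exists lam^-1; rewrite invr_eq0; split=> //.
  have [uM _] := iM; apply: (can_inj (mulKmx uM)).
  by rewrite mulKVmx // -scalemxAr E scalerA mulVf // scale1r.
- exists (M' *m M); split; first exact: isoL_comp iM iM'.
  exists (lam * mu); rewrite mulf_neq0 //; split=> //.
  by rewrite -mulmxA E -scalemxAr E' scalerA.
Qed.

Lemma Im_dlt (w : C * C) : ('Im (w.1 * w.2^*) == 0) = (dlt w == 0).
Proof.
apply/eqP/eqP => [/Creal_ImP/CrealP|h].
  by rewrite rmorphM /= conjCK /dlt => ->; rewrite subrr.
apply/Creal_ImP/CrealP; rewrite rmorphM /= conjCK; apply/eqP.
by rewrite -subr_eq0; apply/eqP.
Qed.

Lemma ordmod0 I : addgrp I -> ordmod I 0 1.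
Proof. by move=> sI k; rewrite mulr0 dvd1z; split=> // _; apply: addgrp0. Qed.

Lemma addZ0 I : addgrp I -> addZ I 0 = I.
Proof.
move=> sI; apply: set_ext => z; split=> [[x [k [Ix ->]]]|Iz]; last exact: addZ_self.
by rewrite mulr0 addr0.
Qed.

Section Surface.
Variables (A B : C -> Prop) (c c' : nat).
Hypothesis lA : lat A c.
Hypothesis lB : lat B c'.
Let L := twist A B 0.
Let f := lcmn c c'.
Let D := mulL A B.

Let f_gt0 : (0 < f)%N. Proof. by rewrite lcmn_gt0 (lat_gt0 lA) (lat_gt0 lB). Qed.

Let latt2_L : latt2 L.
Proof. by apply: latt2_twist; [apply: lat_latt lA|apply: lat_latt lB|apply: (inQ_int Q 0)]. Qed.

Let cond2_L : cond2 L f.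
Proof.
have [w bw EB] := latt_basis (lat_latt lB).
have := twist_cond lA lB bw EB (ordmod0 (addgrp_mulL A B)).
by rewrite mul0r muln1.
Qed.

Let detspan_L : detspan L = D.
Proof.
have [w [_ _ d0] EB] := latt_basis (lat_latt lB).
have := detspan_twist 0 (lat_addgrp lA) d0 EB; rewrite mul0r => ->.
by apply: addZ0; apply: addgrp_mulL.
Qed.

(** The basis [w], the matrix [g] and the scalar are left free; [rel_compat] shows that they do not
    affect the classes. *)
Let rel x (t : (C -> Prop) * (C -> Prop) * C) : Prop := exists w g lam,
  [/\ isbas w, t.1.2 = zsp w, lam != 0, g *m x = lam *: cv2 1 0 &
      isoL g L (twist t.1.1 t.1.2 (t.2 / dlt w))].

Let line_triple x : sublines L x -> exists2 t, all_triples Q D f t & rel x t.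
Proof.
move=> [x0 [lam [mu [Llam _ him]]]].
have lam0 : lam != 0.
  by apply: contraNneq him => ->; rewrite mul0r; apply/eqP; apply/Creal_ImP; apply: real0.
(* The vector [x] is only complex, whereas its multiple in [L] has coordinates in [K], as
   [line_normal] requires. *)
have y0 : lam *: x != 0 by rewrite scaler_eq0 negb_or lam0.
have h0 := latt2_inQ 0 latt2_L Llam; have h1 := latt2_inQ 1 latt2_L Llam.
have [g [M2 [u [lM2 hu gx iso]]]] := line_normal latt2_L h0 h1 y0.
have lM1 := latt_line latt2_L h0 h1 y0; set M1 := (fun a => _) in lM1 iso.
have [w bw EM2] := latt_basis lM2; have [_ _ d0] := bw.
have [ug _] := iso; have dg0 : \det g != 0 by move: ug; rewrite unitmxE unitfE.
pose v := u * dlt w; have Eu : u = v / dlt w by rewrite mulfK.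
have hdet : addZ (mulL M1 M2) v = scl (\det g) D.
  rewrite -(detspan_twist v (latt_addgrp lM1) d0 EM2) -Eu.
  by rewrite (detspan_iso iso) detspan_L.
(* Scaling [M1] by this factor turns the determinant lattice, known to be [D] up to a scalar, into
   [D] itself. *)
pose al := (\det g)^-1; have a0 : al != 0 by rewrite invr_eq0.
have lD : latt D by apply: latt_mulL; [apply: lat_latt lA|apply: lat_latt lB].
have hv : inQ v by apply: inQM => //; apply: inQ_dlt.
have lI := latt_mulL lM1 lM2.
have hal : inQ al.
  by apply: inQ_inv; apply: (latt_scl_inQ lD (latt_addZ lI hv) dg0 hdet).
have [m1 l1] := latt_lat lM1; have [m2 l2] := latt_lat lM2.
have [N N0 hN] := latt_ordmod lI hv.
have l1' : lat (scl al M1) m1 by apply: lat_scl.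
have EI : mulL (scl al M1) M2 = scl al (mulL M1 M2) by rewrite scl_mulL.
have hN' : ordmod (mulL (scl al M1) M2) (al * v) N.
  by move=> k; rewrite EI -hN /scl mulrCA mulKf.
exists (scl al M1, M2, al * v).
  exists m1, m2, N; split=> //; first split=> //=.
    by rewrite EI -addZ_scl // hdet scl_scl mulVf // scl1.
  have := twist_cond l1 l2 bw EM2 hN; rewrite -Eu => c2.
  exact: cond2_inj c2 (cond2_iso iso cond2_L).
have [_ []] := @twist_equiv _ M1 M2 (scl al M1) M2 w w v (al * v)
  (latt_addgrp lM1) (lat_addgrp l1') d0 d0 EM2 EM2.
  exists al, 1; split=> //; rewrite ?oner_eq0 ?scl1 //.
  by rewrite mulr1 subrr; apply: addgrp0; apply: addgrp_mulL.
rewrite -Eu => g' [nu [nu0 ge iso']].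
exists w, (g' *m g), (lam^-1 * nu); split=> //=.
- by rewrite mulf_neq0 // invr_eq0.
- have gx' : g *m x = lam^-1 *: cv2 1 0.
    by rewrite -gx -scalemxAr scalerA mulVf // scale1r.
  by rewrite -mulmxA gx' -scalemxAr ge scalerA.
- exact: isoL_comp iso iso'.
Qed.

Let triple_line t : all_triples Q D f t -> exists2 x, sublines L x & rel x t.
Proof.
case: t => [[M1 M2] v] [m1 [m2 [N [[/= l1 l2 ED hv] N0 Ef]]]].
have [w bw EM2] := latt_basis (lat_latt l2); have [_ _ d0] := bw.
have lI := latt_mulL (lat_latt l1) (lat_latt l2).
have hvQ := ordmod_inQ lI N0 hv.
have lL' : latt2 (twist M1 M2 (v / dlt w)).
  apply: latt2_twist; [exact: lat_latt l1|exact: lat_latt l2|].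
  by apply: inQ_div => //; apply: inQ_dlt.
have c2 := twist_cond l1 l2 bw EM2 hv; rewrite Ef in c2.
have [|g iso] := latt2_classify latt2_L lL' f_gt0 cond2_L c2 (oner_neq0 C).
  by rewrite scl1 detspan_L (detspan_twist v (lat_addgrp l1) d0 EM2).
have [ug hg] := iso; pose x := invmx g *m cv2 1 0.
have gx : g *m x = cv2 1 0 by rewrite mulKVmx.
have Lx a : M1 a -> L (a *: x).
  move=> Ma; apply/hg; rewrite -scalemxAr gx.
  have -> : a *: cv2 1 0 = cv2 a 0 by apply: cv2_ext; rewrite cvZ ?cv2_0 ?cv2_1 ?mulr1 ?mulr0.
  by apply/twist_line => //; apply: lat_addgrp l2.
exists x; last first.
  exists w, g, 1; split=> //; rewrite ?oner_eq0 // scale1r //.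
split.
  apply/eqP => E; move: gx; rewrite E mulmx0 => /(congr1 (fun z : cV2 => z 0 0)).
  by rewrite cv2_0 mxE => /eqP; rewrite eq_sym oner_eq0.
have [w1 [_ _ d1] EM1] := latt_basis (lat_latt l1).
exists w1.1, w1.2; split; rewrite ?Im_dlt //; apply: Lx; rewrite EM1.
  by exists 1, 0; rewrite mul1r mul0r addr0.
by exists 0, 1; rewrite mul1r mul0r add0r.
Qed.

Let rel_compat x x' t t' : all_triples Q D f t -> all_triples Q D f t' ->
  rel x t -> rel x' t' -> (orbit_rel L x x' <-> trip_eq t t').
Proof.
case: t => [[M1 M2] v]; case: t' => [[M1' M2'] v'].
move=> [m1 [m2 [N [[/= l1 l2 _ _] _ _]]]] [m1' [m2' [N' [[/= l1' l2' _ _] _ _]]]].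
move=> [w [g [lam [/= bw EM2 lam0 gx iso]]]] [w' [g' [lam' [/= bw' EM2' lam0' gx' iso']]]].
have [_ _ d0] := bw; have [_ _ d0'] := bw'.
rewrite /trip_eq /= -(twist_equiv v v' (lat_addgrp l1) (lat_addgrp l1') d0 d0' EM2 EM2').
have [ug _] := iso; have [ug' _] := iso'.
have Ex : invmx g *m cv2 1 0 = lam^-1 *: x.
  by apply: (can_inj (mulKmx ug)); rewrite mulKVmx // -scalemxAr gx scalerA mulVf // scale1r.
have Ex' : invmx g' *m cv2 1 0 = lam'^-1 *: x'.
  by apply: (can_inj (mulKmx ug')); rewrite mulKVmx // -scalemxAr gx' scalerA mulVf // scale1r.
split=> [[M [iM [mu [mu0 EM]]]]|[h [mu [mu0 he ih]]]].
  exists (g' *m (M *m invmx g)), (lam^-1 * mu * lam'); split.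
  - by rewrite !mulf_neq0 ?invr_eq0.
  - by rewrite -!mulmxA Ex -!scalemxAr EM -scalemxAr gx' !scalerA.
  - exact: isoL_comp (isoL_comp (isoL_inv iso) iM) iso'.
exists (invmx g' *m (h *m g)); split.
  exact: isoL_comp (isoL_comp iso ih) (isoL_inv iso').
exists (lam * mu * lam'^-1); split; first by rewrite !mulf_neq0 ?invr_eq0.
by rewrite -!mulmxA gx -!scalemxAr he -scalemxAr Ex' !scalerA.
Qed.

Lemma lines_count m :
  count_is (all_triples Q D f) (@trip_eq C) m -> count_is (sublines L) (orbit_rel L) m.
Proof.
apply: (@count_transfer _ _ _ _ _ _ rel); [exact: line_triple|exact: triple_line|].
by move=> x x' t t' _ _ ht ht' r r'; apply: rel_compat.
Qed.

End Surface.
End Lines.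

(** * Translation between the notions of the statement and those of the proof *)

Section Bridge.
Variables (R : realType) (d : nat) (Q : quad R[i]).
Hypothesis inKE : forall z, inK d z <-> ratspan (qgen Q) z.
Hypothesis inOrderE : forall n z, inOrder d n z <-> order_of (qgen Q) n z.
Local Notation C := (R[i]).
Local Notation Ord := (order_of (qgen Q)).

Lemma inOrder_Ord n : inOrder d n = Ord n.
Proof. by apply: set_ext => z; apply: inOrderE. Qed.

Lemma is_latticeP w : is_lattice d w <-> isbas Q w.
Proof.
split=> [[/inKE h1 /inKE h2 fr]|[h1 h2 d0]]; first exact: isbas_free.
by split; [apply/inKE|apply/inKE|move=> i j; apply: zsp_free].
Qed.

Lemma has_conductorP M n : latt Q M -> has_conductor d M n <-> lat Q M n.
Proof.
move=> lM; split=> [[n0 h]|[_ n0 h]]; split=> // x.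
  rewrite -inOrderE -h; split=> [hx|[]//]; split=> //; apply/inKE.
  have [y My y0] := latt_neq0 lM.
  rewrite -[x](mulfK y0); apply: inQ_div; apply: (latt_inQ lM) => //; exact: hx.
rewrite inOrderE -h; split=> [[]//|hx]; split=> //; apply/inKE.
by apply: (@Ord_inQ _ Q n); apply/h.
Qed.

Lemma homotheticP w w' : isbas Q w -> isbas Q w' ->
  homothetic d w w' <-> homoth (zsp w) (zsp w').
Proof.
move=> bw bw'; split=> [[lam [_ l0 h]]|[lam l0 E]].
  exists lam => //; apply: set_ext => z; rewrite -[zsp w' z]/(zspan w' z) h; split.
    by move=> [y [hy ->]]; apply: mem_scl.
  by move=> hz; exists (lam^-1 * z); rewrite mulVKf.
exists lam; split=> //.
  by apply/inKE; apply: (latt_scl_inQ (latt_zsp bw) (latt_zsp bw') l0 E).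
move=> z; rewrite -[zspan w' z]/(zsp w' z) E; split=> [hz|[y [hy ->]]].
  by exists (lam^-1 * z); rewrite mulVKf.
exact: mem_scl.
Qed.

Lemma hcl_count l : (0 < l)%N -> count_is (fun M => lat Q M l) (@homoth C) (hcl R d l).
Proof.
move=> l0; have [m hm] := lat_finite Q l0.
have tot1 w : is_lattice d w /\ has_conductor d (zspan w) l ->
    lat Q (zsp w) l /\ isbas Q w.
  by move=> [/is_latticeP bw /(has_conductorP _ (latt_zsp bw))].
have tot2 M : lat Q M l -> exists2 w, is_lattice d w /\ has_conductor d (zspan w) l & M = zsp w.
  move=> lM; have [w bw E] := latt_basis (lat_latt lM); exists w => //; split.
    exact/is_latticeP.
  by apply/(has_conductorP _ (latt_zsp bw)); rewrite -E.
have cw : count_is (fun w : C * C => is_lattice d w /\ has_conductor d (zspan w) l) (homothetic d) m.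
  refine (@count_transfer _ _ (homothetic d) _ (fun M => lat Q M l) (@homoth _)
    (fun w M => M = zsp w) m _ _ _ hm).
  - by move=> w /tot1[lw _]; exists (zsp w).
  - exact: tot2.
  - by move=> w w' M M' /tot1[_ bw] /tot1[_ bw'] _ _ -> ->; apply: homotheticP.
refine (@count_transfer _ _ (@homoth _) _ _ (homothetic d) (fun M w => M = zsp w) _ _ _ _ (num_classesP cw)).
- by move=> M /tot2[w hw E]; exists w.
- by move=> w /tot1[lw _]; exists (zsp w).
- by move=> M M' w w' _ _ /tot1[_ bw] /tot1[_ bw'] -> ->; rewrite homotheticP.
Qed.

Lemma cyclic_superP a N S : (0 < N)%N ->
  cyclic_super d a N S <-> exists2 be, S = addZ (Ord a) be & ordmod (Ord a) be N.
Proof.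
move=> N0; have sO := addgrp_Ord Q a; rewrite /cyclic_super inOrder_Ord; split.
  move=> [be [ES hN hk]]; exists be; first by apply: set_ext.
  have [g hg] : exists g : nat, ordmod (Ord a) be g.
    apply: addgrp_int; split; first by rewrite mul0r; apply: addgrp0.
    by move=> i j hi hj; rewrite rmorphB mulrBl; apply: addgrpB.
  suff -> : N = g by [].
  have gN : (g %| N)%N by have /hg := (hN : Ord a (N%:Z%:~R * be)).
  apply/eqP; rewrite eq_sym eqn_leq dvdn_leq //= leqNgt; apply/negP => gltN.
  have g0 : (0 < g)%N := dvdn_gt0 N0 gN.
  by apply: (hk g); [rewrite g0|apply/(hg g); apply: dvdzz].
move=> [be -> hN]; exists be; split=> //; first by apply/(hN N); apply: dvdzz.
move=> k /andP[k0 kN] /(hN k); rewrite dvdzE /= => /(dvdn_leq k0); by rewrite leqNgt kN.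
Qed.

Lemma rK_count a b N : (0 < a)%N -> (0 < N)%N ->
  count_is (supers Q (Ord a) N b) (@eq _) (rK R d a b N).
Proof.
move=> a0 N0; have [m hm] := supers_finite Q b a0 N0.
have EP : (fun S => cyclic_super d a N S /\ has_conductor d S b) = supers Q (Ord a) N b.
  apply: set_ext => S; split.
    move=> [/(cyclic_superP _ _ N0)[be ES hN] hb]; exists be; split=> //.
    apply/has_conductorP => //; rewrite ES.
    by apply: latt_addZ; [apply: latt_Ord|apply: ordmod_inQ hN => //; apply: latt_Ord].
  move=> [be [ES hN lS]]; split; first by apply/cyclic_superP => //; exists be.
  by apply/has_conductorP => //; apply: lat_latt lS.
have Ee : (fun S T : C -> Prop => forall z, S z <-> T z) = @eq _.
  apply: functional_extensionality => S; apply: set_ext => T.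
  by split=> [/set_ext|->].
by rewrite /rK EP Ee; apply: num_classesP hm.
Qed.

End Bridge.

Theorem theorem1p1 (R : realType) (d : nat) (w w' : R[i] * R[i]) (c c' : nat) :
  (0 < d)%N ->
  only_pm1_roots R d ->
  is_lattice d w -> is_lattice d w' ->
  has_conductor d (zspan w) c -> has_conductor d (zspan w') c' ->
  let f := lcmn c c' in
  let f' := gcdn c c' in
  N_curves w w' =
  (\sum_(l <- divisors f)
     hcl R d l * phi_u (f %/ l) *
     \sum_(g <- divisors l) 2 ^ omega (l %/ g) * rK R d f' g (f %/ l))%N.
Proof.
move=> d0 roots lw lw' cw cw' f f'.
have [Q [inKE inOrderE]] := @quad_exists R d d0.
have /(is_latticeP inKE) bw := lw; have /(is_latticeP inKE) bw' := lw'.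
have lA : lat Q (zsp w) c by apply/(has_conductorP inKE inOrderE _ (latt_zsp bw)).
have lB : lat Q (zsp w') c' by apply/(has_conductorP inKE inOrderE _ (latt_zsp bw')).
(* The period lattice of the surface is the untwisted case. *)
have EL : inLam w w' = twist (zsp w) (zsp w') 0.
  by apply: set_ext => v; rewrite /inLam /twist mul0r subr0; split=> -[].
have roots' z : ratspan (qgen Q) z -> forall n : nat, (0 < n)%N -> z ^+ n = 1 -> z = 1 \/ z = -1.
  by move=> /inKE; apply: roots.
have f0 : (0 < f)%N by rewrite lcmn_gt0 (lat_gt0 lA) (lat_gt0 lB).
have f'0 : (0 < f')%N by rewrite gcdn_gt0 (lat_gt0 lA).
have lD := lat_mul lA lB.
have := all_triples_count roots' lD f0 (hcl_count inKE inOrderE)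
  (fun g N _ N0 => rK_count inKE inOrderE g f'0 N0).
move/(lines_count lA lB) => cnt.
rewrite /N_curves; apply: num_classes_eq.
  by rewrite /same_orbit /autA EL; apply: orbit_rel_equiv.
by rewrite /elliptic_line /same_orbit /autA EL.
Qed.
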